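(* Let $N\ge 1$ be an integer, let $X=\{1,\ldots,N\}^{\mathbb{Z}}$ be the full shift, and let $\widehat{X}$ be the Kalikow-type subshift associated with $X$. Then every measure of maximal entropy for $\widehat{X}$ is $\mathfrak{T}_{\widehat X}$-invariant.
   Context: Kalikow-type subshift: let $X\subset\Sigma^{\mathbb{Z}}$ be a subshift ($\Sigma$ finite) with shift map $T$, $(Ty)_n=y_{n+1}$, and let $\sigma$ be the shift on $\{-1,1\}^{\mathbb{Z}}$. Let $\widehat{T}(x,y)=(\sigma x,T^{x_0}y)$ on $\{-1,1\}^{\mathbb{Z}}\times X$. Define $\pi:\{-1,1\}^{\mathbb{Z}}\times X\to(\{-1,1\}\times\Sigma)^{\mathbb{Z}}$ by $\pi(x,y)_n=(\widehat{T}^n(x,y))_0$, meaning the pair of $0$-th coordinates of the two components of $\widehat{T}^n(x,y)$; explicitly $\pi(x,y)_n=(x_n,\,y_{\Phi_n(x)})$ with $\Phi_n(x)=\sum_{j=0}^{n-1}x_j$ for $n>0$, $\Phi_0(x)=0$, $\Phi_n(x)=-\sum_{j=n}^{-1}x_j$ for $n<0$. The Kalikow-type subshift associated with $X$ is the image $\widehat{X}=\pi(\{-1,1\}^{\mathbb{Z}}\times X)$, a subshift of $(\{-1,1\}\times\Sigma)^{\mathbb{Z}}$. The Gibbs relation $\mathfrak{T}_{\widehat X}$ is the set of pairs $(z,z')\in\widehat X\times\widehat X$ with $z_n=z'_n$ for all but finitely many $n\in\mathbb{Z}$. A Borel probability measure $\mu$ on $\widehat X$ is $\mathfrak{T}_{\widehat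 X}$-invariant if $\mu(\gamma(A))=\mu(A)$ for every Borel isomorphism $\gamma:A\to B$ between Borel sets $A,B\subset\widehat X$ with $(z,\gamma(z))\in\mathfrak{T}_{\widehat X}$ for all $z\in A$. A measure of maximal entropy for $\widehat X$ is a shift-invariant Borel probability measure whose Kolmogorov entropy equals the topological entropy of $\widehat X$. *)

(* Defs.v *)
From HB Require Import structures.
From mathcomp Require Import all_boot all_order all_algebra.
From mathcomp Require Import all_classical all_reals all_analysis.

Set Implicit Arguments.
Unset Strict Implicit.
Unset Printing Implicit Defensive.

Import Order.TTheory GRing.Theory Num.Theory.
Import numFieldNormedType.Exports.

Local Open Scope classical_set_scope.
Local Open Scope ring_scope.

(* Measurable types must be pointed, hence the successor: the alphabet with
   N >= 1 letters is 'I_n.+1 with N = n.+1. *)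
HB.instance Definition _ (n : nat) := isPointed.Build 'I_n.+1 ord0.

Definition conf (A : pointedType) : Type := {ptws int -> discrete_topology A}.

HB.instance Definition _ (A : pointedType) := Pointed.on (conf A).
HB.instance Definition _ (A : pointedType) := Nbhs.on (conf A).
HB.instance Definition _ (A : pointedType) := Topological.on (conf A).

Notation borel T := (g_sigma_algebraType (@open T)).

Section Shifts.
Context {A : pointedType}.

Definition shift_by (k : int) (y : conf A) : conf A := fun n => y (n + k).

Definition left_shift : conf A -> conf A := shift_by 1.

Definition gibbs_relation (X : set (conf A)) (z z' : conf A) : Prop :=
  [/\ X z, X z' & finite_set [set n | z n != z' n]].

End Shifts.

(* {-1,1} is encoded by bool: true is +1 and false is -1. *)
Definition step (b : bool) : int := if b then 1 else -1.

(* Negz m denotes -(m+1), so the second sum is over -(m+1) <= j <= -1. *)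
Definition walk (x : conf bool) (n : int) : int :=
  match n with
  | Posz m => \sum_(j < m) step (x j%:Z)
  | Negz m => - \sum_(j < m.+1) step (x (- j.+1%:Z))
  end.

Section Kalikow.
Context {A : pointedType}.

Definition skew (p : conf bool * conf A) : conf bool * conf A :=
  (left_shift p.1, shift_by (step (p.1 0)) p.2).

Definition kalikow_map (p : conf bool * conf A) : conf (bool * A)%type :=
  fun n => (p.1 n, p.2 (walk p.1 n)).

Definition kalikow_subshift (X : set (conf A)) : set (conf (bool * A)%type) :=
  kalikow_map @` (setT `*` X).

Lemma walkS (x : conf bool) (n : int) :
  walk x (n + 1) = step (x 0) + walk (left_shift x) n.
Proof.
case: n => [m|m].
  rewrite -PoszD addn1 /= big_ord_recl; congr (_ + _).
  by apply: eq_bigr => i _; rewrite /left_shift /shift_by lift0 -addn1 PoszD.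
have shE j : left_shift x (- j.+1%:Z) = x (- j%:Z).
  by rewrite /left_shift /shift_by -addn1 PoszD opprD addrNK.
have -> : Negz m + 1 = - m%:Z by rewrite NegzE -addn1 PoszD opprD addrNK.
rewrite [walk (left_shift x) _]/= big_ord_recl shE opprD oppr0 addrA subrr.
rewrite add0r.
case: m => [|m]; first by rewrite oppr0 /= !big_ord0 oppr0.
by rewrite -NegzE /=; congr (- _); apply: eq_bigr => i _; rewrite /= shE.
Qed.

(* Together these two facts say that kalikow_map p n is the pair of 0-th
   coordinates of the n-th iterate of skew at p, for every n in Z. *)
Lemma kalikow_map0 p : kalikow_map p 0 = (p.1 0, p.2 0).
Proof. by rewrite /kalikow_map /= big_ord0. Qed.

Lemma kalikow_map_skew p : kalikow_map (skew p) = left_shift (kalikow_map p).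
Proof.
apply/funext => n; rewrite /kalikow_map /left_shift /shift_by /= walkS.
by rewrite [_ + walk _ _]addrC.
Qed.

End Kalikow.

Section KolmogorovEntropy.
Context {R : realType} {d : measure_display} {T : measurableType d}.
Variables (mu : probability T R) (S : T -> T).

(* A finite measurable partition is a labelling f : T -> 'I_k with measurable
   fibres; the atoms of the join of the S^-i(f), i < n, are indexed by words.
   Since ln 0 = 0, null atoms contribute 0. The limit in partition_entropy exists
   by subadditivity when mu is S-invariant. *)
Definition join_entropy (k : nat) (f : T -> 'I_k) (n : nat) : R :=
  \sum_(w : {ffun 'I_n -> 'I_k})
    let p := fine (mu [set x | forall i : 'I_n, f (iter i S x) = w i]) in
    - (p * ln p).

Definition partition_entropy (k : nat) (f : T -> 'I_k) : R :=
  limn (fun n => join_entropy f n / n%:R).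

Definition kolmogorov_entropy : \bar R :=
  ereal_sup [set e | exists k (f : T -> 'I_k),
    (forall a, measurable (f @^-1` [set a])) /\ e = (partition_entropy f)%:E].

End KolmogorovEntropy.

Section TopologicalEntropy.
Context (R : realType) {T : topologicalType}.
Variables (K : set T) (S : T -> T).

(* Open covers of K are given by open subsets of the ambient space; the limit in
   cover_entropy exists by subadditivity when K is compact and S is continuous
   and maps K into K. *)
Definition open_cover (U : set (set T)) : Prop :=
  (forall V, U V -> open V) /\ K `<=` \bigcup_(V in U) V.

Definition cover_join (U : set (set T)) (n : nat) : set (set T) :=
  [set \bigcap_(i < n) (iter i S @^-1` V i) |
    V in [set V : nat -> set T | forall i, U (V i)]].

Definition cover_number (U : set (set T)) : R :=
  inf [set m%:R | m in [set m | exists V : 'I_m -> set T,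
    (forall i, U (V i)) /\ K `<=` \bigcup_i V i]].

Definition cover_entropy (U : set (set T)) : R :=
  limn (fun n => ln (cover_number (cover_join U n)) / n%:R).

Definition topological_entropy : \bar R :=
  ereal_sup [set (cover_entropy U)%:E | U in open_cover].

End TopologicalEntropy.

Section MeasuresOnSubshifts.
Context {R : realType} {A : pointedType}.

(* A Borel probability measure on a (closed) subshift X is a Borel probability
   measure on the full shift giving X mass 1. *)
Definition maximal_entropy_measure (X : set (conf A))
    (mu : probability (borel (conf A)) R) : Prop :=
  [/\ mu X = 1%E,
      forall B : set (borel (conf A)), measurable B ->
        mu (left_shift @^-1` B) = mu B &
      kolmogorov_entropy mu left_shift = topological_entropy R X left_shift].

Definition borel_isomorphism (B C : set (borel (conf A)))
    (g : borel (conf A) -> borel (conf A)) : Prop :=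
  [/\ measurable B, measurable C, set_bij B C g, measurable_fun B g &
      forall D : set (borel (conf A)),
        measurable D -> D `<=` B -> measurable (g @` D)].

Definition gibbs_invariant (X : set (conf A))
    (mu : probability (borel (conf A)) R) : Prop :=
  mu X = 1%E /\
  forall (B C : set (borel (conf A))) (g : borel (conf A) -> borel (conf A)),
    B `<=` X -> C `<=` X -> borel_isomorphism B C g ->
    (forall z, B z -> gibbs_relation X z (g z)) ->
    mu (g @` B) = mu B.

End MeasuresOnSubshifts.

(* Main.v *)
(* Write N = n + 1, c = N + 1/N, and let the walk of a point z of the subshift
   be the sequence of partial sums of its steps; z is a point exactly when equal
   positions of the walk carry equal labels.

   Entropy. If R counts the visited sites, the weights N ^ (position - R) of the
   words of length k add up to at least c ^ k and are at most 1, so the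
   topological entropy is at least ln c. By the Kolmogorov-Sinai theorem and
   concavity of the block entropies, a measure of maximal entropy satisfies
   H(z_0 | z_-k .. z_-1) >= ln c for every k.

   Prediction. Compare the conditional law of z_0 = (step, label) with the
   following prediction: the label is uniform if the current site is new and is
   copied otherwise; the step follows the drift of the past with odds N : 1/N
   (or is fair if there is no drift). The divergence from this prediction is at
   most ln N * (P(new site) - E(step * drift)) - (ln c - ln 2) * P(no drift), up
   to small errors. Stationarity gives P(new site) <= E(step * drift), and c > 2
   if N > 1. Hence there is almost surely a drift if N > 1, and the prediction is
   exact.

   Exchange. It follows that, given the past, a legal word w of length k has
   probability c ^ -k * N ^ (displacement of w along the drift - number of new
   sites). Under drift the past covers a half line of sites, so two words leading
   from the same past to a new site have the same exponent: it is determined by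
   the past alone. Thus they can be exchanged without changing the measure, and a
   partial isomorphism inside the Gibbs relation is a countable union of such
   exchanges. *)
Require Import Defs.
From HB Require Import structures.
From mathcomp Require Import all_boot all_order all_algebra.
From mathcomp Require Import all_classical all_reals all_analysis.
From mathcomp Require Import zify ring lra.

Set Implicit Arguments.
Unset Strict Implicit.
Unset Printing Implicit Defensive.

Import Order.TTheory GRing.Theory Num.Theory.
Import numFieldNormedType.Exports.

Local Open Scope classical_set_scope.
Local Open Scope ring_scope.

(** * Sets determined by finitely many coordinates *)

Section LocalSets.
Context {A : pointedType}.
Implicit Types (z : conf A) (W : set (conf A)).

(** The prediction is what the counting dictates: whether the site is new or old, the choices for
    the next letter have weights [N ^ (step - new)] with total [c], and the prediction normalizes
    these weights, with the step measured along the drift. The obstacle is that drift and newness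
    depend on the whole past, while entropies see finite windows. So drift is replaced by a guess
    [g] read on finitely many coordinates, divergences of size e^2 become total variations of size
    e, and equalities come from letting e tend to 0. P(new site) is controlled by a conservation
    law: a new site is a record of the walk in one direction, a record implies drift by recurrence,
    and under drift the rate of records is the mean speed. For N = 1 the gap between [c] and 2
    closes and gives no drift, but then all weights are 1 and any direction serves. Two points in
    the Gibbs relation can stay displaced against each other after their last difference, so they
    may discover new sites at different times. An exchange is therefore extended to a time at which
    both enter a new site. *)

Definition depends_on (I : set int) W :=
  forall z z', (forall i, I i -> z i = z' i) -> W z -> W z'.

Definition centered (K : nat) : set int := [set i | (`|i| < K)%N].

Lemma proj_nbhs z (i : int) : nbhs z [set z' : conf A | z' i = z i].
Proof.
exact: (@proj_continuous int (fun=> discrete_topology A) i z _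
  (@discrete_set1 (discrete_topology A) (z i))).
Qed.

Lemma centered_nbhs z K :
  nbhs z [set z' : conf A | forall i, centered K i -> z i = z' i].
Proof.
elim: K => [|K IH]; first by apply: filterE => z' i.
apply: filterS (filterI IH (filterI (proj_nbhs z K%:Z) (proj_nbhs z (- K%:Z)))).
move=> z' [/= h [h1 h2]] i iK.
have [iK'|iK'] := ltnP `|i|%N K; first exact: h.
have [->|->] : i = K%:Z \/ i = - K%:Z by move: iK iK'; rewrite /centered/=; lia.
  by rewrite h1.
by rewrite h2.
Qed.

Lemma open_local W K : depends_on (centered K) W -> open W.
Proof.
move=> WK; rewrite openE => z Wz.
by apply: filterS (centered_nbhs z K) => z' h; apply: WK Wz.
Qed.

(** The sets containing a central cylinder around [z] form a filter; it converges to [z] because it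
    does so for each of the coordinate topologies whose supremum is the product topology. *)
Lemma nbhs_centered z W : nbhs z W ->
  exists K, forall z', (forall i, centered K i -> z i = z' i) -> W z'.
Proof.
pose F : set_system (conf A) := [set V | exists K,
  forall z', (forall i, centered K i -> z i = z' i) -> V z'].
have FF : Filter F.
  split; first by exists 0%N.
    move=> P Q [K hK] [L hL]; exists (maxn K L) => z' h; split.
      by apply: hK => i iK; apply: h; rewrite /centered/= leq_max iK.
    by apply: hL => i iK; apply: h; rewrite /centered/= leq_max iK orbT.
  by move=> P Q PQ [K hK]; exists K => z' h; exact/PQ/hK.
suff h : F --> (z : {ptws int -> discrete_topology A}) by move=> Wz; exact: h.
apply/cvg_sup => i U [V] [[V'] _ <-] /= Vz VU; exists `|i|.+1%N => z' h.
by apply: VU; rewrite /= -(h i)//= /centered/= ltnS.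
Qed.

(** The [K]-th set collects the points whose central cylinder of radius [K] lies in [W]. *)
Lemma open_bigcup_local W : open W ->
  exists2 V : nat -> set (conf A), (forall K, depends_on (centered K) (V K)) &
    W = \bigcup_K V K.
Proof.
move=> oW; exists (fun K => [set z | forall z',
    (forall i, centered K i -> z i = z' i) -> W z']).
  move=> K z z' zz' h y z'y; apply: h => i iK.
  by rewrite zz'// z'y.
apply/seteqP; split => [z Wz|z [K _ /= h]]; last exact: h.
have [K hK] := nbhs_centered (open_nbhs_nbhs (conj oW Wz)).
by exists K.
Qed.

Lemma measurable_local (W : set (borel (conf A))) K :
  depends_on (centered K) W -> measurable W.
Proof. by move=> /open_local oW; exact: sub_sigma_algebra. Qed.

Definition local_sets : set (set (conf A)) :=
  [set W | exists K, depends_on (centered K) W].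

(** Open sets are countable unions of local sets. Local sets are stable under intersection, so a
    finite measure is determined by its values on them; [mu_swap] relies on this. *)
Lemma borel_local : @measurable _ (borel (conf A)) = <<s local_sets >>.
Proof.
apply/seteqP; split => [W|W].
  apply: smallest_sub; first exact: smallest_sigma_algebra.
  move=> U /open_bigcup_local[V hV ->].
  apply: sigma_algebra_bigcup => K; apply: sub_sigma_algebra.
  by exists K.
apply: smallest_sub.
  by split; [exact: measurable0|move=> U mU; exact: measurableD
            |move=> F mF; exact: bigcup_measurable].
by move=> U [K] /measurable_local.
Qed.

Lemma depends_onS (I J : set int) W :
  I `<=` J -> depends_on I W -> depends_on J W.
Proof. by move=> IJ h z z' zz'; apply: h => i /IJ /zz'. Qed.

Lemma depends_onI I W W' :
  depends_on I W -> depends_on I W' -> depends_on I (W `&` W').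
Proof. by move=> h h' z z' zz' [? ?]; split; [apply: h zz' _|apply: h' zz' _]. Qed.

Lemma depends_onC I W : depends_on I W -> depends_on I (~` W).
Proof. by move=> h z z' zz' nW Wz'; apply: nW; apply: h Wz' => i /zz'. Qed.

Lemma depends_onU I W W' :
  depends_on I W -> depends_on I W' -> depends_on I (W `|` W').
Proof.
move=> h h' z z' zz' [?|?]; [left|right]; first exact: h zz' _.
exact: h' zz' _.
Qed.

Lemma measurable_depends (W : set (borel (conf A))) (i j : int) :
  depends_on [set l | i <= l < j] W -> measurable W.
Proof.
move=> h; apply: (@measurable_local _ (maxn `|i| `|j|).+1).
apply: depends_onS h => l /=; rewrite /centered/=; lia.
Qed.

End LocalSets.

Lemma measurable_preimage_conf (A B : pointedType)
    (f : borel (conf A) -> borel (conf B)) :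
  (forall K, exists L, forall z z', (forall i, centered L i -> z i = z' i) ->
    forall i, centered K i -> f z i = f z' i) ->
  forall W, measurable W -> measurable (f @^-1` W).
Proof.
move=> hf W mW; have : measurable_fun [set: borel (conf A)] f.
  apply: (@measurability _ _ (borel (conf A)) (borel (conf B)) _ _ local_sets).
    exact: borel_local.
  move=> _ [V [K hV] <-]; rewrite setTI; have [L hL] := hf K.
  by apply: (@measurable_local _ _ L) => z z' /hL/hV.
by move=> /(_ measurableT _ mW); rewrite setTI.
Qed.

Lemma measurable_shift (A : pointedType) k (W : set (borel (conf A))) :
  measurable W ->
  measurable ((shift_by k : borel (conf A) -> borel (conf A)) @^-1` W).
Proof.
apply: measurable_preimage_conf => K; exists (K + `|k|)%N => z z' zz' i iK.
by apply: zz'; move: iK; rewrite /centered/=; lia.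
Qed.

(** * Real-valued probabilities and finite-valued random variables *)

Section RealValuedProbability.
Context {d : measure_display} {T : measurableType d} {R : realType}.
Variable mu : probability T R.
Implicit Types A B : set T.

Definition prob A : R := fine (mu A).

Lemma prE A : measurable A -> mu A = (prob A)%:E.
Proof. by move=> mA; rewrite /prob fineK// fin_num_measure. Qed.

Lemma pr_ge0 A : 0 <= prob A.
Proof. exact/fine_ge0/measure_ge0. Qed.

Lemma pr0 : prob set0 = 0.
Proof. by rewrite /prob measure0. Qed.

Lemma prT : prob setT = 1.
Proof. by rewrite /prob probability_setT. Qed.

Lemma le_pr A B : measurable A -> measurable B -> A `<=` B -> prob A <= prob B.
Proof.
by move=> mA mB AB; rewrite -lee_fin -!prE//; apply: le_measure; rewrite ?inE.
Qed.

Lemma pr_le1 A : measurable A -> prob A <= 1.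
Proof. by move=> mA; rewrite -prT; exact: le_pr. Qed.

Lemma prDI A B : measurable A -> measurable B ->
  prob A = prob (A `\` B) + prob (A `&` B).
Proof.
move=> mA mB; apply: EFin_inj; rewrite EFinD -!prE//.
- exact: measureDI.
- exact: measurableI.
- exact: measurableD.
Qed.

Lemma prU A B : measurable A -> measurable B -> A `&` B = set0 ->
  prob (A `|` B) = prob A + prob B.
Proof.
move=> mA mB AB; apply: EFin_inj; rewrite EFinD -!prE//; last exact: measurableU.
exact: measureU.
Qed.

Lemma pr_leU A B : measurable A -> measurable B -> prob (A `|` B) <= prob A + prob B.
Proof.
move=> mA mB; have mBA : measurable (B `\` A) by exact: measurableD.
have -> : A `|` B = A `|` (B `\` A).
  apply/seteqP; split=> t [?|]; [by left| |by left|by case; right].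
  by move=> ?; have [?|?] := pselect (A t); [left|right].
rewrite prU//; last by rewrite setDIK.
by rewrite lerD2l; apply: le_pr.
Qed.

Lemma prC A : measurable A -> prob (~` A) = 1 - prob A.
Proof.
move=> mA; rewrite -prT (prDI measurableT mA) setTD setTI; ring.
Qed.

Lemma le_prU A B C : measurable A -> measurable B -> measurable C ->
  A `<=` B `|` C -> prob A <= prob B + prob C.
Proof.
move=> mA mB mC ABC; apply: le_trans (pr_leU mB mC).
by apply: le_pr => //; exact: measurableU.
Qed.

Lemma le_pr_sum (I : finType) (F : I -> set T) B : measurable B ->
  (forall i, measurable (F i)) -> (forall t, B t -> exists i, F i t) ->
  prob B <= \sum_i prob (F i).
Proof.
move=> mB mF BF; have {BF} : forall t, B t -> exists2 i, i \in index_enum I & F i t.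
  by move=> t /BF[i Fi]; exists i; rewrite ?mem_index_enum.
elim: (index_enum I) B mB => [|i s IH] B mB BF.
  rewrite big_nil (_ : B = set0) ?pr0// -subset0 => t /BF[i].
  by rewrite in_nil.
rewrite big_cons (prDI mB (mF i)) addrC; apply: lerD.
  by apply: le_pr; [exact: measurableI|exact: mF|exact: subIsetr].
apply: IH; first exact: measurableD.
move=> t [/BF[j + Fj] nFi]; rewrite inE => /predU1P[ji|js]; last by exists j.
by rewrite ji in Fj.
Qed.

Lemma pr_eq0S A B : measurable A -> measurable B -> A `<=` B -> prob B = 0 ->
  prob A = 0.
Proof.
by move=> mA mB AB B0; apply/le_anti; rewrite pr_ge0 -B0 le_pr.
Qed.

Lemma pr_bigcup0 (F : nat -> set T) : (forall i, measurable (F i)) ->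
  (forall i, prob (F i) = 0) -> prob (\bigcup_i F i) = 0.
Proof.
move=> mF F0; apply/le_anti; rewrite pr_ge0 andbT.
have mU : measurable (\bigcup_i F i) by exact: bigcup_measurable.
rewrite -lee_fin -prE//; apply: le_trans (generalized_Boole_inequality _ mF mU) _.
by rewrite eseries0 // => i _ _ /=; rewrite prE ?F0.
Qed.

Lemma pr_decreasing (F : nat -> set T) (e : R) : (forall i, measurable (F i)) ->
  (forall i j, (i <= j)%N -> F j `<=` F i) -> 0 < e ->
  exists K, forall k, (K <= k)%N -> prob (F k) <= prob (\bigcap_i F i) + e.
Proof.
move=> mF dF e0; have mI : measurable (\bigcap_i F i) by exact: bigcap_measurable.
have : mu \o F @ \oo --> mu (\bigcap_i F i).
  apply: nonincreasing_cvg_mu => //.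
    by apply: (le_lt_trans (probability_le1 mu (mF _))); rewrite ltry.
  by move=> i j ij; apply/subsetPset/dF.
rewrite prE// => /fine_cvgP[_] /cvgrPdist_le/(_ _ e0)[K _ hK].
exists K => k /hK /=; rewrite ler_distlC => /andP[_].
by rewrite /prob.
Qed.

Lemma pr_increasing (F : nat -> set T) (e : R) : (forall i, measurable (F i)) ->
  (forall i j, (i <= j)%N -> F i `<=` F j) -> 0 < e ->
  exists K, forall k, (K <= k)%N -> prob (\bigcup_i F i) - e <= prob (F k).
Proof.
move=> mF dF e0; have mI : measurable (\bigcup_i F i) by exact: bigcup_measurable.
have : mu \o F @ \oo --> mu (\bigcup_i F i).
  apply: nondecreasing_cvg_mu => //.
  by move=> i j ij; apply/subsetPset/dF.
rewrite prE// => /fine_cvgP[_] /cvgrPdist_le/(_ _ e0)[K _ hK].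
exists K => k /hK /=; rewrite ler_distlC => /andP[+ _].
by rewrite /prob.
Qed.

Definition simple_rv (I : finType) (X : T -> I) :=
  forall i, measurable (X @^-1` [set i]).

Lemma measurable_simple (I : finType) (X : T -> I) (Q : I -> Prop) :
  simple_rv X -> measurable [set t | Q (X t)].
Proof.
move=> mX.
have -> : [set t | Q (X t)] = \bigcup_(i in [set i | Q i]) (X @^-1` [set i]).
  by apply/seteqP; split=> [t Qt|t [i Qi /= Xt]]; [exists (X t)|rewrite /= Xt].
by apply: fin_bigcup_measurable => // i _; exact: mX.
Qed.

Lemma pr_sum (I : finType) (X : T -> I) A : simple_rv X -> measurable A ->
  prob A = \sum_i prob (A `&` X @^-1` [set i]).
Proof.
move=> mX mA; apply: EFin_inj; rewrite -prE// -sumEFin.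
rewrite (eq_bigr (fun i => mu (A `&` X @^-1` [set i]))); last first.
  by move=> i _; rewrite prE//; exact: measurableI.
transitivity (mu (\bigcup_(i in [set: I]) (A `&` X @^-1` [set i]))).
  congr (mu _); apply/seteqP; split=> [t At|t [i _ []//]].
  by exists (X t).
rewrite measure_fin_bigcup//; last by move=> i _; exact: measurableI.
  rewrite (fsbigE (index_enum I))//.
  - by apply: eq_bigl => i; rewrite in_setT.
  - exact: index_enum_uniq.
  - by move=> i _; rewrite mem_index_enum.
  exact: finite_finset.
by move=> i j _ _ [t [[_ <-] [_ <-]]].
Qed.

Lemma simple_comp (I J : finType) (X : T -> I) (f : I -> J) :
  simple_rv X -> simple_rv (f \o X).
Proof. by move=> mX j; exact: (measurable_simple (fun i => f i = j)). Qed.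

Lemma simple_pair (I J : finType) (X : T -> I) (Y : T -> J) :
  simple_rv X -> simple_rv Y -> simple_rv (fun t => (X t, Y t)).
Proof.
move=> mX mY [i j].
rewrite (_ : _ @^-1` _ = X @^-1` [set i] `&` Y @^-1` [set j]).
  exact: measurableI.
by apply/seteqP; split=> t /= [-> ->].
Qed.

Lemma pr_simple (I : finType) (X : T -> I) (Q : I -> Prop) : simple_rv X ->
  prob [set t | Q (X t)] = \sum_(i | `[< Q i >]) prob (X @^-1` [set i]).
Proof.
move=> mX; rewrite (pr_sum mX); last exact: measurable_simple.
rewrite [RHS]big_mkcond; apply: eq_bigr => i _; case: asboolP => Qi.
  by congr prob; apply/seteqP; split=> [t []//|t /= Xt]; rewrite Xt.
rewrite (_ : _ `&` _ = set0) ?pr0//.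
by rewrite -subset0 => t [/= + Xt]; rewrite Xt.
Qed.

End RealValuedProbability.

(** * Entropy of finite partitions *)

Section GibbsInequality.
Context {R : realType}.
Implicit Types p q : R.

Lemma ln_le_subr1 p : 0 < p -> ln p <= p - 1.
Proof.
move=> p0; rewrite -[X in ln X](subrKC 1).
by apply: le_ln1Dx; lra.
Qed.

(* The divergence dominates the squared Hellinger distance: apply ln t <= t - 1
   to t = sqrt (q / p). *)
Lemma divergence_term p q : 0 <= p -> 0 <= q -> (0 < p -> 0 < q) ->
  p - q + (Num.sqrt p - Num.sqrt q) ^+ 2 <= p * (ln p - ln q).
Proof.
rewrite le_eqVlt => /predU1P[<- q0 _|p0 q0 /(_ p0) {}q0].
  by rewrite sqrtr0 !sub0r sqrrN sqr_sqrtr// mul0r addNr.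
have sp : 0 < Num.sqrt p by rewrite sqrtr_gt0.
have sq : 0 < Num.sqrt q by rewrite sqrtr_gt0.
have := sqr_sqrtr (ltW q0); have := sqr_sqrtr (ltW p0).
move: (Num.sqrt p) (Num.sqrt q) sp sq {p0 q0} => s t s0 t0 <- <-.
have h : ln (t / s) <= t / s - 1 by apply: ln_le_subr1; rewrite divr_gt0.
rewrite !lnXn//.
have -> : s ^+ 2 * (ln s *+ 2 - ln t *+ 2) = s ^+ 2 * 2 * - ln (t / s).
  by rewrite ln_div ?posrE//; ring.
have : s ^+ 2 * 2 * (1 - t / s) <= s ^+ 2 * 2 * - ln (t / s).
  apply: ler_wpM2l; last by lra.
  by rewrite mulr_ge0// sqr_ge0.
apply: le_trans; rewrite le_eqVlt; apply/orP; left; apply/eqP; field.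
by rewrite gt_eqF.
Qed.

Section Finite.
Context {I : finType}.
Variables P Q : I -> R.
Hypotheses (P0 : forall i, 0 <= P i) (Q0 : forall i, 0 <= Q i).
Hypothesis PQ : forall i, 0 < P i -> 0 < Q i.

Lemma divergence_ge : \sum_i P i - \sum_i Q i +
  \sum_i (Num.sqrt (P i) - Num.sqrt (Q i)) ^+ 2 <=
  \sum_i P i * (ln (P i) - ln (Q i)).
Proof.
rewrite -sumrB -big_split; apply: ler_sum => i _.
by apply: divergence_term => //; exact: PQ.
Qed.

Lemma divergence_ge0 : \sum_i Q i <= \sum_i P i ->
  0 <= \sum_i P i * (ln (P i) - ln (Q i)).
Proof.
move=> QP; apply: le_trans divergence_ge; apply: addr_ge0; first by rewrite subr_ge0.
by apply: sumr_ge0 => i _; exact: sqr_ge0.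
Qed.

(** Factor [P - Q] as a difference of squares of square roots and split the product by Young's
    inequality with parameter [e]: one term is the Hellinger distance, bounded by the divergence,
    the other sums to [2 * e]. *)
Lemma total_variation_le e : 0 < e -> \sum_i P i = 1 -> \sum_i Q i = 1 ->
  \sum_i `|P i - Q i| <=
  (\sum_i P i * (ln (P i) - ln (Q i))) / (2 * e) + 2 * e.
Proof.
move=> e0 P1 Q1; have := divergence_ge; rewrite P1 Q1 subrr add0r => D.
have t i : `|P i - Q i| <=
    (Num.sqrt (P i) - Num.sqrt (Q i)) ^+ 2 / (2 * e) + e * (P i + Q i).
  have := sqr_sqrtr (Q0 i); have := sqr_sqrtr (P0 i).
  move: (Num.sqrt (P i)) (Num.sqrt (Q i)) => s t <- <-.
  rewrite subr_sqr normrM.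
  have e2 : 0 < 2 * e by lra.
  have h : 2 * e * (`|s - t| * `|s + t|) <= (s - t) ^+ 2 + e ^+ 2 * (s + t) ^+ 2.
    rewrite -(real_normK (num_real (s - t))) -(real_normK (num_real (s + t))).
    by have := sqr_ge0 (`|s - t| - e * `|s + t|); rewrite sqrrB; lra.
  have h2 : (s - t) ^+ 2 + e ^+ 2 * (s + t) ^+ 2 <=
      (s - t) ^+ 2 + 2 * e * (e * (s ^+ 2 + t ^+ 2)).
    rewrite lerD2l; have := mulr_ge0 (sqr_ge0 e) (sqr_ge0 (s - t)).
    by rewrite !expr2; lra.
  rewrite -(ler_pM2l e2); apply: le_trans h _; apply: le_trans h2 _.
  rewrite mulrDr le_eqVlt; apply/orP; left; apply/eqP; field.
  by rewrite gt_eqF.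
apply: le_trans (ler_sum _ (fun i _ => t i)) _.
rewrite big_split /= -mulr_suml -mulr_sumr big_split /= P1 Q1.
have -> : e * (1 + 1) = 2 * e by ring.
by rewrite lerD2r; apply: ler_wpM2r D; rewrite invr_ge0; lra.
Qed.

End Finite.

(** This is [ln t <= t] for t = 1 / sqrt p. It provides the explicit error term of
    [entropy_fano]. *)
Lemma xlnx_le_sqrt p : 0 <= p -> - (p * ln p) <= 2 * Num.sqrt p.
Proof.
rewrite le_eqVlt => /predU1P[<-|p0]; first by rewrite mul0r oppr0 sqrtr0 mulr0.
have sp : 0 < Num.sqrt p by rewrite sqrtr_gt0.
have := sqr_sqrtr (ltW p0); move: (Num.sqrt p) sp => s s0 <-.
rewrite lnXn//; have := ltW (ln_sublinear (x := s^-1) _).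
rewrite invr_gt0 lnV ?posrE// => /(_ s0) h.
have : s ^+ 2 * 2 * - ln s <= s ^+ 2 * 2 * s^-1.
  by apply: ler_wpM2l h; rewrite mulr_ge0// sqr_ge0.
have -> : s ^+ 2 * 2 * s^-1 = 2 * s by field; rewrite gt_eqF.
by apply: le_trans; rewrite le_eqVlt; apply/orP; left; apply/eqP; ring.
Qed.

End GibbsInequality.

Section Entropy.
Context {d : measure_display} {T : measurableType d} {R : realType}.
Variable mu : probability T R.
Local Notation pr := (prob mu).

Definition entropy (I : finType) (X : T -> I) : R :=
  \sum_i let p := pr (X @^-1` [set i]) in - (p * ln p).

Lemma pr_transfer (I J : finType) (Z : T -> I) (f : I -> J) (g : J -> R) :
  simple_rv Z ->
  \sum_j pr ((f \o Z) @^-1` [set j]) * g j =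
  \sum_i pr (Z @^-1` [set i]) * g (f i).
Proof.
move=> mZ; rewrite (partition_big f predT)//=; apply: eq_bigr => j _.
have -> : (f \o Z) @^-1` [set j] = [set t | f (Z t) = j] by [].
rewrite (pr_simple mu (fun i => f i = j) mZ) mulr_suml.
apply: eq_big => [i|i /asboolP <-//].
by apply/asboolP/eqP.
Qed.

Lemma pr_simple_sum1 (I : finType) (Z : T -> I) : simple_rv Z ->
  \sum_i pr (Z @^-1` [set i]) = 1.
Proof.
move=> mZ; rewrite -(prT mu) (pr_sum mu mZ measurableT).
by apply: eq_bigr => i _; rewrite setTI.
Qed.

(** Summing over the values of [Z] lets the entropies of several functions of [Z] be compared term
    by term. *)
Lemma entropyE (I J : finType) (Z : T -> I) (f : I -> J) : simple_rv Z ->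
  entropy (f \o Z) =
  \sum_i pr (Z @^-1` [set i]) * - ln (pr ((f \o Z) @^-1` [set f i])).
Proof.
move=> mZ; rewrite -(pr_transfer f (fun j => - ln (pr ((f \o Z) @^-1` [set j]))))//.
by apply: eq_bigr => j _; rewrite mulrN.
Qed.

Lemma le_pr_comp (I J : finType) (Z : T -> I) (f : I -> J) i : simple_rv Z ->
  pr (Z @^-1` [set i]) <= pr ((f \o Z) @^-1` [set f i]).
Proof.
move=> mZ; apply: le_pr; [exact: mZ|exact: simple_comp|].
by move=> t /= ->.
Qed.

Lemma entropy_ge0 (I : finType) (Z : T -> I) : simple_rv Z -> 0 <= entropy Z.
Proof.
move=> mZ; apply: sumr_ge0 => i _ /=; rewrite -mulrN mulr_ge0 ?pr_ge0//.
by rewrite oppr_ge0 ln_le0// pr_le1//; exact: mZ.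
Qed.

Lemma entropy_inj (I J : finType) (Z : T -> I) (f : I -> J) : simple_rv Z ->
  injective f -> entropy (f \o Z) = entropy Z.
Proof.
move=> mZ fI; rewrite entropyE//; apply: eq_bigr => i _.
rewrite mulrN; congr (- (_ * ln (pr _))).
by apply/seteqP; split=> t /= => [/fI//|->].
Qed.

Lemma entropy_comp (I J : finType) (Z : T -> I) (f : I -> J) : simple_rv Z ->
  entropy (f \o Z) <= entropy Z.
Proof.
move=> mZ; rewrite entropyE//; apply: ler_sum => i _ /=; rewrite -mulrN.
have := pr_ge0 mu (Z @^-1` [set i]); rewrite le_eqVlt => /predU1P[<-|p0].
  by rewrite !mul0r.
have h := le_pr_comp f i mZ.
by rewrite ler_wpM2l ?pr_ge0// lerN2 ler_ln// posrE// (lt_le_trans p0).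
Qed.

(** The difference of the two sides is the divergence of the law of [(X, W)] from [q], under which
    [X] is drawn given [f W] alone; [q] has total mass at most 1. *)
Lemma cond_entropy_comp (I J K : finType) (X : T -> I) (W : T -> J)
    (f : J -> K) : simple_rv X -> simple_rv W ->
  entropy (fun t => (X t, W t)) - entropy W <=
  entropy (fun t => (X t, f (W t))) - entropy (f \o W).
Proof.
move=> mX mW; pose Z t := (X t, W t).
have mZ : simple_rv Z by exact: simple_pair.
pose g (z : I * J) := (z.1, f z.2).
have mgZ : simple_rv (g \o Z) by exact: simple_comp.
have mfW : simple_rv (f \o W) by exact: simple_comp.
rewrite -/Z (_ : entropy W = entropy (snd \o Z))// (entropyE snd mZ).
rewrite (_ : entropy (fun t => (X t, f (W t))) = entropy (g \o Z))//.
rewrite (_ : entropy (f \o W) = entropy ((f \o snd) \o Z))//.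
rewrite (entropyE g mZ) (entropyE (f \o snd) mZ) -subr_ge0.
pose p z := pr (Z @^-1` [set z]).
pose pW j := pr (W @^-1` [set j]).
pose pf k := pr ((f \o W) @^-1` [set k]).
pose pg z := pr ((g \o Z) @^-1` [set z]).
pose q z := pW z.2 * pg (g z) / pf (f z.2).
have pp z : 0 < p z -> [/\ 0 < pW z.2, 0 < pg (g z) & 0 < pf (f z.2)].
  move=> pz; split; apply: lt_le_trans pz _.
  - exact: (le_pr_comp snd).
  - exact: (le_pr_comp g).
  - exact: (le_pr_comp (f \o snd)).
suff : 0 <= \sum_z p z * (ln (p z) - ln (q z)).
  move/le_trans; apply; rewrite /entropy -!sumrB; apply: ler_sum => z _.
  have := pr_ge0 mu (Z @^-1` [set z]); rewrite le_eqVlt => /predU1P[p0|p0].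
    by rewrite /p -p0 !mul0r !oppr0 !addr0.
  have [h1 h2 h3] := pp z p0.
  rewrite /q ln_div ?posrE ?mulr_gt0// lnM ?posrE//.
  rewrite -/(p z) -[pr _]/(pg (g z)) -[pr (_ @^-1` [set z.2])]/(pW z.2).
  rewrite -[pr (_ @^-1` [set (f \o snd) z])]/(pf (f z.2)).
  by rewrite le_eqVlt; apply/orP; left; apply/eqP; ring.
apply: divergence_ge0.
- by move=> z; exact: pr_ge0.
- by move=> z; rewrite mulr_ge0 ?invr_ge0 ?pr_ge0// mulr_ge0 ?pr_ge0.
- by move=> z /pp[? ? ?]; rewrite divr_gt0// mulr_gt0.
rewrite [X in _ <= X](pr_simple_sum1 mZ) -(pr_simple_sum1 mW).
rewrite -(pair_bigA _ (fun i j => q (i, j))) exchange_big /=.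
apply: ler_sum => j _; rewrite /q /=.
rewrite -mulr_suml -mulr_sumr.
have -> : \sum_i pg (i, f j) = pf (f j).
  rewrite /pf (pr_sum mu mX); last exact: mfW.
  apply: eq_bigr => i _; congr pr.
  by apply/seteqP; split=> t /= [h1 h2]; rewrite /g /= h1 h2.
have [->|h] := eqVneq (pf (f j)) 0; first by rewrite mulr0 mul0r pr_ge0.
by rewrite -mulrA divff// mulr1.
Qed.

(** On the diagonal [ln t <= t - 1] gives terms that add up to the probability of [X <> Y]. Off the
    diagonal each atom has mass at most [e], and [xlnx_le_sqrt] applies. *)
Lemma entropy_fano (I : finType) (X Y : T -> I) (e : R) :
  simple_rv X -> simple_rv Y -> 0 <= e -> pr [set t | X t <> Y t] <= e ->
  entropy (fun t => (X t, Y t)) - entropy Y <=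
  e + #|{: I * I}|%:R * (2 * Num.sqrt e).
Proof.
move=> mX mY e0 he; pose Z t := (X t, Y t).
have mZ : simple_rv Z by exact: simple_pair.
rewrite -/Z (_ : entropy Y = entropy (snd \o Z))// (entropyE snd mZ).
pose p z := pr (Z @^-1` [set z]).
pose pY j := pr (Y @^-1` [set j]).
have mD : measurable [set t | X t <> Y t].
  exact: (measurable_simple (fun z : I * I => z.1 <> z.2) mZ).
have hz z : - (p z * ln (p z)) - p z * - ln (pY z.2) <=
    (if z.1 == z.2 then pY z.2 - p z else 0) + 2 * Num.sqrt e.
  have s0 : 0 <= Num.sqrt e := sqrtr_ge0 e.
  have pz0 : 0 <= p z := pr_ge0 mu _.
  have hp : p z <= pY z.2 := le_pr_comp snd z mZ.
  have pY1 : pY z.2 <= 1 by apply: pr_le1; exact: mY.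
  case: eqP => [zz|zz].
    move: pz0; rewrite le_eqVlt => /predU1P[p0|p0].
      by rewrite -p0 !mul0r !oppr0 !addr0; have := pr_ge0 mu (Y @^-1` [set z.2]);
        rewrite -/(pY _); lra.
    have pY0 := lt_le_trans p0 hp.
    have : p z * ln (pY z.2 / p z) <= p z * (pY z.2 / p z - 1).
      by rewrite ler_pM2l// ln_le_subr1// divr_gt0.
    have -> : p z * (pY z.2 / p z - 1) = pY z.2 - p z.
      by field; rewrite gt_eqF.
    by rewrite ln_div ?posrE//; lra.
  rewrite add0r; apply: (@le_trans _ _ (2 * Num.sqrt (p z))).
    apply: le_trans (xlnx_le_sqrt pz0); rewrite mulrN opprK -[leRHS]addr0 lerD2l.
    by rewrite mulr_ge0_le0// ln_le0.
  rewrite ler_pM2l// ler_wsqrtr//; apply: le_trans he; apply: le_pr => //.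
  by case: z {hp pY1 pz0} zz => i j /= ij t [/= -> ->].
rewrite -sumrB; apply: le_trans (ler_sum _ (fun z _ => hz z)) _.
rewrite big_split /= sumr_const -[X in _ + X <= _]mulr_natl lerD2r.
rewrite (eq_bigr (fun z => (fun i j => if i == j then pY j - p (i, j) else 0)
  z.1 z.2)); last by case.
rewrite -(pair_bigA _ (fun i j => if i == j then pY j - p (i, j) else 0)) /=.
rewrite (eq_bigr (fun i => pY i - p (i, i))); last first.
  move=> i _; rewrite -big_mkcond (big_pred1 i)//.
apply: (le_trans _ he).
rewrite sumrB (pr_simple_sum1 mY).
have -> : [set t | X t <> Y t] = ~` [set t | X t = Y t] by [].
have mE : measurable [set t | X t = Y t].
  exact: (measurable_simple (fun z : I * I => z.1 = z.2) mZ).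
rewrite prC// lerD2l lerN2 (pr_sum mu mX mE).
apply: ler_sum => i _; apply: le_pr; [|exact: mZ|].
  by apply: measurableI => //; exact: mX.
by move=> t /= [XY Xi]; rewrite /Z -XY Xi.
Qed.

End Entropy.

(** * Approximation of Borel sets by local sets *)

Section Approximation.
Context {A : pointedType} {R : realType}.
Variable mu : probability (borel (conf A)) R.
Local Notation pr := (prob mu).

(** The approximable sets form a sigma-algebra: a countable union is first cut at a finite stage, at
    cost [r / 2], by continuity from below. *)
Lemma approx_local (B : set (borel (conf A))) (e : R) :
  measurable B -> 0 < e ->
  exists (K : nat) (W : set (borel (conf A))), depends_on (centered K) W /\
    pr ((B `\` W) `|` (W `\` B)) <= e.
Proof.
pose D : set (set (borel (conf A))) := [set B | measurable B /\
  forall e : R, 0 < e -> exists (K : nat) (W : set (borel (conf A))),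
    depends_on (centered K) W /\ pr ((B `\` W) `|` (W `\` B)) <= e].
have mlocal K (W : set (borel (conf A))) : depends_on (centered K) W -> measurable W.
  exact: measurable_local.
have mY (B1 B2 : set (borel (conf A))) : measurable B1 -> measurable B2 ->
    measurable ((B1 `\` B2) `|` (B2 `\` B1)).
  by move=> m1 m2; apply: measurableU; exact: measurableD.
have D0 : D set0.
  split=> // e0 e0p; exists 0%N, set0; split=> //.
  by rewrite !set0D setU0 pr0 ltW.
have DC B' : D B' -> D (~` B').
  move=> [mB hB]; split; first exact: measurableC.
  move=> r r0; have [K [W [hW rW]]] := hB r r0.
  exists K, (~` W); split; first exact: depends_onC.
  by rewrite !setDE !setCK setUC [~` W `&` _]setIC [~` B' `&` _]setIC -!setDE.
have DU B1 B2 : D B1 -> D B2 -> D (B1 `|` B2).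
  move=> [m1 h1] [m2 h2]; split; first exact: measurableU.
  move=> r r0; have r2 : 0 < r / 2 by rewrite divr_gt0.
  have [K1 [W1 [hW1 rW1]]] := h1 _ r2; have [K2 [W2 [hW2 rW2]]] := h2 _ r2.
  exists (maxn K1 K2), (W1 `|` W2).
  have hW : depends_on (centered (maxn K1 K2)) (W1 `|` W2).
    apply: depends_onU; [apply: depends_onS hW1|apply: depends_onS hW2];
      by move=> i; rewrite /centered /= leq_max => ->; rewrite ?orbT.
  split=> //; rewrite (splitr r); apply: le_trans (lerD rW1 rW2).
  have mW1 := mlocal _ _ hW1; have mW2 := mlocal _ _ hW2.
  apply: le_prU; try by apply: mY; [..|exact: mlocal hW] => //; exact: measurableU.
  - exact: mY.
  - exact: mY.
  by move=> z /=; tauto.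
suff DB B' : measurable B' -> D B' by move=> /DB[_ h] e0; exact: h.
rewrite borel_local; apply: smallest_sub => //; last first.
  move=> W [K hW]; split; first exact: mlocal hW.
  by move=> r r0; exists K, W; split=> //; rewrite setDv setU0 pr0 ltW.
split=> // [B1 /DC|F hF]; first by rewrite setTD.
pose G n : set (borel (conf A)) := \big[setU/set0]_(i < n) F i.
have DG n : D (G n).
  by rewrite /G; elim/big_ind : _ => // i _; exact: hF.
have mF : measurable (\bigcup_k F k : set (borel (conf A))).
  by apply: bigcup_measurable => k _; case: (hF k).
split=> // r r0; have r2 : 0 < r / 2 by rewrite divr_gt0.
have GE : \bigcup_k F k = \bigcup_n G n.
  apply/seteqP; split=> [z [k _ Fz]|z [k _]].
    by exists k.+1 => //; rewrite /G -bigcup_mkord; exists k => /=.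
  by rewrite /G -bigcup_mkord => -[j _ Fz]; exists j.
have [N hN] := pr_increasing mu (F := G) (fun i => (DG i).1)
  (fun i j ij => subset_bigsetU ij) r2.
have [mG /(_ _ r2)[K [W [hW rW]]]] := DG N.
exists K, W; split=> //; have mW := mlocal _ _ hW.
have GF : G N `<=` \bigcup_k F k by rewrite GE => z Gz; exists N.
have rG : pr ((\bigcup_k F k) `\` G N) <= r / 2.
  have := hN N (leqnn N); rewrite -GE (prDI mu mF mG) setIidr//.
  by rewrite lerBlDr [leRHS]addrC lerD2r.
rewrite (splitr r); apply: le_trans (lerD rG rW).
apply: le_prU; [exact: mY|exact: measurableD|exact: mY|].
move=> z /= [[Fz nW]|[Wz nF]]; last by right; right; split=> // /GF.
by have [Gz|nGz] := pselect (G N z); [right; left|left].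
Qed.

End Approximation.

(** * Words read in a window *)

Section Windows.
Context {n : nat}.
Local Notation A := (bool * 'I_n.+1)%type.
Implicit Types (z : conf A) (i j : int) (k : nat).

Definition window i k z : k.-tuple A := [tuple z (i + l%:Z) | l < k].

(** A right inverse of [window i k], by which functions of points that depend on the window only are
    evaluated on words; outside the window it takes a default value. *)
Definition extend i k (u : k.-tuple A) : conf A :=
  fun l => if i <= l then nth point u `|l - i|%N else point.

Lemma extendE i k (u : k.-tuple A) (l : 'I_k) : extend i u (i + l%:Z) = tnth u l.
Proof.
rewrite /extend (_ : i <= i + l%:Z) ?(tnth_nth point); last by lia.
by congr nth; lia.
Qed.

Lemma window_extend i k (u : k.-tuple A) : window i k (extend i u) = u.
Proof. by apply: eq_from_tnth => l; rewrite tnth_mktuple extendE. Qed.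

Lemma eq_windowP i k z z' :
  window i k z = window i k z' <->
  (forall l : int, i <= l < i + k%:Z -> z l = z' l).
Proof.
split=> [/(congr1 (@tnth _ _)) h l il|h].
  have lk : (`|l - i| < k)%N by lia.
  have := congr1 (fun f => f (Ordinal lk)) h; rewrite !tnth_mktuple /=.
  by rewrite (_ : i + `|l - i|%N%:Z = l)//; lia.
apply: eq_from_tnth => l; rewrite !tnth_mktuple; apply: h.
by have := ltn_ord l; lia.
Qed.

Lemma extend_window i k z l : i <= l < i + k%:Z ->
  extend i (window i k z) l = z l.
Proof. by move: l; apply/eq_windowP; rewrite window_extend. Qed.

Lemma depends_window i k (W : set (conf A)) :
  depends_on [set l | i <= l < i + k%:Z] W ->
  forall z, W z <-> W (extend i (window i k z)).
Proof.
by move=> h z; split; apply: h => l /= il; rewrite extend_window.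
Qed.

Lemma simple_window i k : simple_rv (window i k : borel (conf A) -> k.-tuple A).
Proof.
move=> u; apply: (@measurable_depends _ _ i (i + k%:Z)) => z z' zz' /= <-.
by apply/eq_windowP => l il; rewrite zz'.
Qed.

Lemma window_shift i k l z : window i k (shift_by l z) = window (i + l) k z.
Proof.
by apply: eq_from_tnth => m; rewrite !tnth_mktuple /shift_by addrAC.
Qed.

Lemma sub_windowE i k j m : i <= j -> j + m%:Z <= i + k%:Z ->
  window j m = (window j m \o @extend i k) \o window i k.
Proof.
move=> ij jm; apply/funext => z; apply/eq_windowP => l jl.
by rewrite extend_window//; lia.
Qed.

End Windows.

Lemma iter_left_shift (A : pointedType) k (z : conf A) :
  iter k left_shift z = shift_by k%:Z z.
Proof.
elim: k => [|k IH]; first by apply/funext => l; rewrite /shift_by addr0.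
apply/funext => l; rewrite iterS IH /left_shift /shift_by -addrA.
by congr (z _); lia.
Qed.

Lemma shift_by_add (A : pointedType) k l (z : conf A) :
  shift_by k (shift_by l z) = shift_by (k + l) z.
Proof. by apply/funext => m; rewrite /shift_by addrA. Qed.

Lemma shift_by0 (A : pointedType) (z : conf A) : shift_by 0 z = z.
Proof. by apply/funext => m; rewrite /shift_by addr0. Qed.

(** * Invariance under all powers of the shift *)

Section Invariance.
Context {A : pointedType} {R : realType}.
Variable mu : probability (borel (conf A)) R.
Hypothesis inv : forall B : set (borel (conf A)), measurable B ->
  mu (left_shift @^-1` B) = mu B.
Local Notation pr := (prob mu).

Lemma pr_shift (k : int) (B : set (borel (conf A))) : measurable B ->
  pr ((shift_by k : borel (conf A) -> borel (conf A)) @^-1` B) = pr B.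
Proof.
have hnat (m : nat) (C : set (borel (conf A))) : measurable C ->
    pr ((shift_by m%:Z : borel (conf A) -> borel (conf A)) @^-1` C) = pr C.
  elim: m C => [|m IH] C mC.
    by congr (pr _); apply/seteqP; split=> z /=; rewrite shift_by0.
  rewrite -[RHS]/(fine _) -inv// -[RHS]IH; last exact: (measurable_shift 1).
  congr (pr _); apply/seteqP; split=> z /=; rewrite /left_shift shift_by_add;
    by rewrite -PoszD add1n.
move=> mB; case: k => m; first exact: hnat.
rewrite -(hnat m.+1); last exact: measurable_shift.
congr (pr _); apply/seteqP; split=> z /=; rewrite shift_by_add NegzE addNr;
  by rewrite shift_by0.
Qed.

Lemma entropy_shift (I : finType) (X : borel (conf A) -> I) k : simple_rv X ->
  entropy mu (X \o (shift_by k : borel (conf A) -> borel (conf A))) =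
  entropy mu X.
Proof. by move=> mX; apply: eq_bigr => i _; rewrite comp_preimage pr_shift. Qed.

Lemma simple_shift (I : finType) (X : borel (conf A) -> I) k : simple_rv X ->
  simple_rv (X \o (shift_by k : borel (conf A) -> borel (conf A))).
Proof. by move=> mX i; rewrite comp_preimage; exact: measurable_shift. Qed.

End Invariance.

(** * Entropy of a stationary process *)

Section KolmogorovSinai.
Context {n : nat} {R : realType}.
Local Notation A := (bool * 'I_n.+1)%type.
Variable mu : probability (borel (conf A)) R.
Hypothesis inv : forall B : set (borel (conf A)), measurable B ->
  mu (left_shift @^-1` B) = mu B.
Local Notation pr := (prob mu).
Local Notation Omega := (borel (conf A)).

Definition block_entropy k : R := entropy mu (window 0 k : Omega -> k.-tuple A).

Lemma block_entropyE i k :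
  entropy mu (window i k : Omega -> k.-tuple A) = block_entropy k.
Proof.
rewrite -[RHS](entropy_shift inv i); last exact: simple_window.
congr entropy; apply/funext => z /=.
by rewrite window_shift add0r.
Qed.

Lemma join_entropyE k (f : Omega -> 'I_k) j :
  join_entropy mu left_shift f j =
  entropy mu (fun z => [ffun i : 'I_j => f (iter i left_shift z)]).
Proof.
apply: eq_bigr => w _; rewrite /= -/(pr _).
suff -> : [set x | forall i : 'I_j, f (iter i left_shift x) = w i] =
   (fun z => [ffun i : 'I_j => f (iter i left_shift z)]) @^-1` [set w] by [].
apply/seteqP; split=> z /= h.
  by apply/ffunP => i; rewrite ffunE.
by move=> i; rewrite -h ffunE.
Qed.

(** A long window almost determines [f]: its fibres are approximated by local sets [V a], [g]
    guesses a label whose set contains the window, and Fano's inequality bounds what is left. *)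
Lemma cond_window_small k (f : Omega -> 'I_k) (e : R) : simple_rv f -> 0 < e ->
  exists m : nat,
    entropy mu (fun z => (f z, window (- m%:Z) (2 * m) z)) -
    entropy mu (window (- m%:Z) (2 * m) : Omega -> _) <= e.
Proof.
move=> mf e0; have k0 : (0 < k)%N by case: (f point) => ? /=; case: (k).
pose a0 : 'I_k := Ordinal k0.
pose c : R := #|{: 'I_k * 'I_k}|%:R.
have c0 : 0 <= c by rewrite ler0n.
(* Both [r] and its square root will be at most [t], so Fano's bound is at most [t * (1 + 2 * c)],
   that is [e / 2]. *)
pose t : R := e / (2 * (1 + 2 * c)).
have t0 : 0 < t by rewrite divr_gt0// mulr_gt0//; lra.
pose r := Num.min t (t ^+ 2).
have r0 : 0 < r by rewrite lt_min t0 exprn_gt0.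
have hr : r + c * (2 * Num.sqrt r) <= e.
  have h1 : r <= t by rewrite ge_min lexx.
  have h2 : Num.sqrt r <= t.
    by rewrite -(ger0_norm (ltW t0)) -sqrtr_sqr ler_wsqrtr// ge_min lexx orbT.
  have -> : e = 2 * (t * (1 + 2 * c)).
    by rewrite /t; field; rewrite gt_eqF//; lra.
  have := ler_wpM2l c0 h2; have := mulr_ge0 (ltW t0) c0; lra.
have rk : 0 < r / k%:R by rewrite divr_gt0// ltr0n.
have /choice[V hV] : forall a : 'I_k, exists KW : nat * set Omega,
    depends_on (centered KW.1) KW.2 /\
    pr ((f @^-1` [set a] `\` KW.2) `|` (KW.2 `\` f @^-1` [set a])) <= r / k%:R.
  move=> a; have [K [W h]] := approx_local mu (mf a) rk.
  by exists (K, W).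
pose m := \max_a (V a).1.
have hVm a : depends_on (centered m) (V a).2.
  apply: depends_onS (hV a).1 => i; rewrite /centered /= => ia.
  exact: (leq_trans ia (leq_bigmax (F := fun a => (V a).1) a)).
have mV a : measurable (V a).2 := measurable_local (hVm a).
exists m.
pose W : Omega -> _ := window (- m%:Z) (2 * m).
pose g (u : (2 * m).-tuple A) : 'I_k :=
  odflt a0 [pick a | `[< (V a).2 (extend (- m%:Z) u) >]].
have VW a z : (V a).2 z <-> (V a).2 (extend (- m%:Z) (W z)).
  apply: depends_window; apply: depends_onS (hVm a) => l.
  rewrite /centered /=; lia.
have mW : simple_rv W by exact: simple_window.
have mg : simple_rv (g \o W) by exact: simple_comp.
apply: le_trans (cond_entropy_comp mu g mf mW) _.
apply: le_trans hr; apply: entropy_fano => //; first exact: ltW.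
have mY a : measurable ((f @^-1` [set a] `\` (V a).2) `|`
    ((V a).2 `\` f @^-1` [set a])).
  by apply: measurableU; apply: measurableD => //; exact: mf.
have mD : measurable [set z | f z <> (g \o W) z].
  exact: (measurable_simple (fun u : 'I_k * 'I_k => u.1 <> u.2)
    (simple_pair mf mg)).
have -> : r = \sum_(a < k) r / k%:R.
  rewrite sumr_const card_ord -[RHS]mulr_natr -mulrA mulVf ?mulr1//.
  by rewrite pnatr_eq0 -lt0n.
apply: le_trans (ler_sum _ (fun a _ => (hV a).2)).
apply: le_pr_sum => // z /=; rewrite /g.
(* A wrong guess [a] puts the point in the set of [a] but not in its fibre; without any guess the
   point is missed by the set of its own label. *)
case: pickP => [a /asboolP h /= fa|/(_ (f z)) /asboolP h _].
  by exists a; right; split; [exact: (VW a z).2|exact: fa].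
by exists (f z); left; split=> [//|] /(VW (f z) z).1.
Qed.

(** This is the core of the Kolmogorov-Sinai theorem. The labels at times 0 to [j - 1] are adjoined
    one by one to a window of length [j + 2 * m], which contains the [2 * m] letters around each of
    these times; each label costs at most [e]. *)
Lemma join_entropy_le k (f : Omega -> 'I_k) (e : R) : simple_rv f -> 0 < e ->
  exists m : nat, forall j,
    join_entropy mu left_shift f j <= block_entropy (j + 2 * m) + j%:R * e.
Proof.
move=> mf e0; have [m hm] := cond_window_small mf e0.
exists m => j; rewrite join_entropyE.
pose V : Omega -> _ := window (- m%:Z) (j + 2 * m).
pose F i : Omega -> {ffun 'I_i -> 'I_k} :=
  fun z => [ffun l : 'I_i => f (iter l left_shift z)].
have mV : simple_rv V by exact: simple_window.
have mF i : simple_rv (F i).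
  elim: i => [|i IH].
    move=> u; rewrite (_ : _ @^-1` _ = setT)//.
    by apply/seteqP; split=> // z _ /=; apply/ffunP => -[].
  pose h (p : 'I_k * {ffun 'I_i -> 'I_k}) : {ffun 'I_i.+1 -> 'I_k} :=
    [ffun l => oapp p.2 p.1 (unlift ord_max l)].
  rewrite (_ : F i.+1 = h \o (fun z => ((f \o shift_by i%:Z) z, F i z))).
    by apply/simple_comp/simple_pair => //; exact: simple_shift.
  apply/funext => z; apply/ffunP => l; rewrite !ffunE /=.
  case: unliftP => [l' ->|->] /=; first by rewrite ffunE /bump leqNgt ltn_ord add0n.
  by rewrite iter_left_shift.
have FV i : (i <= j)%N ->
    entropy mu (fun z => (F i z, V z)) <= entropy mu V + i%:R * e.
  elim: i => [_|i IH ij].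
    rewrite mul0r addr0 (_ : (fun z => (F 0%N z, V z)) = (fun v => (F 0%N point, v)) \o V).
      by rewrite entropy_comp.
    by apply/funext => z /=; congr pair; apply/ffunP => -[].
  have mfi : simple_rv (f \o (shift_by i%:Z : Omega -> Omega)).
    exact: simple_shift.
  have mFV : simple_rv (fun z => (F i z, V z)) by exact: simple_pair.
  pose h (p : 'I_k * ({ffun 'I_i -> 'I_k} * (j + 2 * m).-tuple A)) :=
    ([ffun l : 'I_i.+1 => oapp p.2.1 p.1 (unlift ord_max l)], p.2.2).
  rewrite (_ : (fun z => (F i.+1 z, V z)) =
    h \o (fun z => ((f \o shift_by i%:Z) z, (F i z, V z)))).
    apply: le_trans (entropy_comp mu h _) _; first exact: simple_pair.
    pose g (p : {ffun 'I_i -> 'I_k} * (j + 2 * m).-tuple A) :=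
      window (i%:Z - m%:Z) (2 * m) (extend (- m%:Z) p.2).
    have := cond_entropy_comp mu g mfi mFV.
    have WE : window (- m%:Z) (2 * m) \o shift_by i%:Z = g \o (fun z => (F i z, V z)).
      apply/funext => z /=; rewrite window_shift /g /=.
      have := @sub_windowE n (- m%:Z) (j + 2 * m)%N (i%:Z - m%:Z) (2 * m).
      move=> /(_ _ _)/(congr1 (@^~ z)) /= <-; rewrite ?[_ + i%:Z]addrC//; lia.
    rewrite -WE.
    have -> : (fun t => ((f \o shift_by i%:Z) t, g (F i t, V t))) =
        (fun z => (f z, window (- m%:Z) (2 * m) z)) \o shift_by i%:Z.
      by apply/funext => z /=; rewrite [g _](congr1 (@^~ z) (esym WE)).
    rewrite !entropy_shift//; [|exact: simple_window|].
      by move=> h1; have := IH (ltnW ij); rewrite -natr1; lra.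
    by apply: simple_pair => //; exact: simple_window.
  apply/funext => z; congr pair; apply/ffunP => l; rewrite !ffunE /=.
  case: unliftP => [l' ->|->] /=; first by rewrite ffunE /bump leqNgt ltn_ord add0n.
  by rewrite iter_left_shift.
have := FV j (leqnn j); rewrite (block_entropyE (- m%:Z)); apply: le_trans.
rewrite -/(F j) (_ : entropy mu (F j) = entropy mu (fst \o (fun z => (F j z, V z))))//.
by apply: entropy_comp; exact: simple_pair.
Qed.

Lemma entropy_window_pair (i a b : int) (k j l : nat) :
  i <= a -> a + j%:Z <= i + k%:Z -> i <= b -> b + l%:Z <= i + k%:Z ->
  (forall x, i <= x < i + k%:Z -> a <= x < a + j%:Z \/ b <= x < b + l%:Z) ->
  entropy mu (fun z : Omega => (window a j z, window b l z)) = block_entropy k.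
Proof.
move=> ia ak ib bk cover.
pose h (u : k.-tuple A) := (window a j (extend i u), window b l (extend i u)).
rewrite (_ : (fun z => (window a j z, window b l z)) = h \o (window i k : Omega -> k.-tuple A)).
  rewrite entropy_inj ?block_entropyE//; first exact: simple_window.
  move=> u v huv; rewrite -(window_extend i u) -(window_extend i v).
  apply: (eq_windowP _ _ _ _).2 => x /cover[]; move: x.
    exact: (eq_windowP _ _ _ _).1 (congr1 fst huv).
  exact: (eq_windowP _ _ _ _).1 (congr1 snd huv).
apply/funext => z; congr pair.
  by rewrite {1}(sub_windowE ia ak).
by rewrite {1}(sub_windowE ib bk).
Qed.

(** By stationarity the two sides are the conditional entropies of the letter at time [k + 1] given
    the letters from time 0 and from time 1. *)
Lemma block_entropy_concave k :
  block_entropy k.+2 - block_entropy k.+1 <= block_entropy k.+1 - block_entropy k.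
Proof.
have mW i j : simple_rv (window i j : Omega -> j.-tuple A) by exact: simple_window.
have WE : window 1 k = (window 1 k \o @extend n 0 k.+1) \o window 0 k.+1.
  by apply: sub_windowE => //; lia.
have := cond_entropy_comp mu (window 1 k \o @extend n 0 k.+1)
  (mW k.+1%:Z 1%N) (mW 0 k.+1).
rewrite -WE (_ : (fun t => _) = (fun t : Omega => (window k.+1%:Z 1 t, window 1 k t))).
  rewrite (block_entropyE 0 k.+1) (block_entropyE 1 k).
  rewrite (@entropy_window_pair 0 k.+1%:Z 0 k.+2 1 k.+1) //; try lia.
  by rewrite (@entropy_window_pair 1 k.+1%:Z 1 k.+1 1 k) //; try lia.
by apply/funext => t; rewrite [in RHS]WE.
Qed.

End KolmogorovSinai.

(** * The walk of a point and legal labels *)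

Lemma int_step_ind (P : int -> Prop) :
  P 0 -> (forall k, P k <-> P (k + 1)) -> forall k, P k.
Proof.
move=> P0 PS; case; elim=> [|k IH] //.
- by rewrite -addn1 PoszD; apply/(PS _).1.
- by apply/(PS _).2; rewrite (_ : Negz 0 + 1 = 0).
- by apply/(PS _).2; rewrite (_ : Negz k.+1 + 1 = Negz k)//; lia.
Qed.

Lemma walk0 x : walk x 0 = 0. Proof. exact: big_ord0. Qed.

Lemma walk_succ x k : walk x (k + 1) = walk x k + step (x k).
Proof.
case: k => [k|[|k]].
- by rewrite -PoszD addn1 /= big_ord_recr.
- by rewrite (_ : Negz 0 + 1 = 0)// walk0 /= big_ord1 addNr.
rewrite (_ : Negz k.+1 + 1 = Negz k); last by lia.
by rewrite /= [in RHS]big_ord_recr /= opprD addrNK.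
Qed.

Arguments walk : simpl never.

Section Position.
Context {B : pointedType}.
Local Notation A := (bool * B)%type.
Implicit Types (z : conf A) (i j k : int).

Definition pos z k : int := walk (fun i => (z i).1) k.

Definition up z k : int := step (z k).1.

Lemma pos0 z : pos z 0 = 0. Proof. exact: walk0. Qed.

Lemma posS z k : pos z (k + 1) = pos z k + up z k. Proof. exact: walk_succ. Qed.

Lemma up_cases z k : up z k = 1 \/ up z k = -1.
Proof. by rewrite /up /step; case: (z k).1; [left|right]. Qed.

Lemma pos_shift z k l : pos (shift_by k z) l = pos z (k + l) - pos z k.
Proof.
move: l; apply: int_step_ind => [|l]; first by rewrite pos0 addr0 subrr.
rewrite posS addrA posS /up /shift_by [l + k]addrC.
by split=> [->|/eqP]; [ring|rewrite [_ + _ - _]addrAC (inj_eq (addIr _)) => /eqP].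
Qed.

Lemma posB_ext z z' i j : i <= j -> (forall l, i <= l < j -> (z l).1 = (z' l).1) ->
  pos z j - pos z i = pos z' j - pos z' i.
Proof.
move=> ij; have -> : j = i + `|j - i|%N%:Z by lia.
elim: `|_|%N => [|m IH] h; first by rewrite addr0 !subrr.
rewrite -addn1 PoszD addrA !posS /up h; last by lia.
by rewrite [LHS]addrAC [RHS]addrAC IH// => l il; apply: h; lia.
Qed.

Lemma pos_ext z z' k : (forall l, 0 <= l < k \/ k <= l < 0 -> z l = z' l) ->
  pos z k = pos z' k.
Proof.
move=> h; have [k0|k0] := leP 0 k.
  have := @posB_ext z z' 0 k k0; rewrite !pos0 !subr0; apply.
  by move=> l lk; rewrite h//; left.
have := @posB_ext z z' k 0 (ltW k0); rewrite !pos0 !sub0r => /(_ _)/oppr_inj; apply.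
by move=> l lk; rewrite h//; right.
Qed.

Lemma pos_ivt z i j (s : int) : i <= j ->
  pos z i <= s <= pos z j \/ pos z j <= s <= pos z i ->
  exists2 l, i <= l <= j & pos z l = s.
Proof.
move=> ij; have -> : j = i + `|j - i|%N%:Z by lia.
elim: `|_|%N => [|m IH] h.
  by exists i; [lia|move: h; rewrite addr0; lia].
have [e|ne] := pselect (pos z (i + m.+1%:Z) = s).
  by exists (i + m.+1%:Z) => //; lia.
have [|l il <-] := IH; last by exists l => //; lia.
have {ne} : pos z (i + m.+1%:Z) < s \/ s < pos z (i + m.+1%:Z).
  by case: (ltgtP (pos z (i + m.+1%:Z)) s) => // ?; [left|right].
move: h; rewrite -addn1 PoszD addrA posS.
move: (pos z i) (pos z (i + m%:Z)) {IH} => a b; case: (up_cases z (i + m%:Z)) => ->; lia.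
Qed.

Definition legal_on (I : set int) z :=
  forall i j, I i -> I j -> pos z i = pos z j -> (z i).2 = (z j).2.

(** The scenery is recovered by reading a site at some time when it is visited, and legality makes
    the choice of that time immaterial. An unvisited site receives the label at time 0, the default
    of [xget]. *)
Lemma kalikow_legal z : kalikow_subshift [set: conf B] z <-> legal_on setT z.
Proof.
split=> [[[x y] _ <-] i j _ _ ij|h]; first exact: (congr1 y ij).
pose y : conf B := fun s => (z (xget 0 [set i | pos z i = s])).2.
exists ((fun i => (z i).1), y) => //; apply/funext => i.
rewrite /kalikow_map /= -/(pos z i) [RHS]surjective_pairing; congr pair.
apply: h => //; have := @xgetPex _ 0 [set j | pos z j = pos z i].
by move=> /(_ (ex_intro _ i erefl)).
Qed.

Lemma kalikow_shift z k : legal_on setT z -> legal_on setT (shift_by k z).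
Proof.
move=> h i j _ _; rewrite !pos_shift => /eqP; rewrite (inj_eq (addIr _)) => /eqP.
by move=> /h; rewrite ![k + _]addrC; apply.
Qed.

End Position.

(** The limit is the infimum of the ratios, which the linear lower bound keeps above [L]. Indices
    are divided by a nearly optimal [m.+1], and [M] bounds [u] at every remainder. *)
Lemma fekete (R : realType) (u : nat -> R) (L : R) :
  (forall m, 0 <= u m) -> (forall m k, u (m + k)%N <= u m + u k) ->
  (forall m, m%:R * L <= u m) ->
  exists2 l, L <= l & (fun m => u m / m%:R) @ \oo --> l.
Proof.
move=> u0 uD uL; pose E : set R := [set u m.+1 / m.+1%:R | m in setT].
have E0 : E !=set0 by exists (u 1%N / 1%:R), 0%N.
have EL : lbound E L.
  by move=> _ [m _ <-]; rewrite ler_pdivlMr ?ltr0n// mulrC.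
have hasE : has_inf E by split=> //; exists L.
exists (inf E); first exact: lb_le_inf.
apply/cvgrPdist_le => e e0.
have e2 : 0 < e / 2 by rewrite divr_gt0.
have [_ [m _ <-] hm] := inf_adherent e2 hasE.
pose M : R := \sum_(r < m.+1) u r.
have M0 : 0 <= M by apply: sumr_ge0 => r _; exact: u0.
have uM q r : (r < m.+1)%N -> u (q * m.+1 + r)%N <= q%:R * u m.+1 + M.
  move=> rm; elim: q => [|q IH].
    rewrite mul0n mul0r !add0r /M (bigD1 (Ordinal rm)) //= lerDl.
    by apply: sumr_ge0 => ? _; exact: u0.
  rewrite mulSn -addnA; apply: le_trans (uD _ _) _.
  by rewrite -natr1 mulrDl mul1r [_ + u m.+1]addrC -addrA lerD2l.
exists (Num.bound (M / (e / 2))).+1 => // k /= hk.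
have k0 : (0 < k)%N by apply: leq_trans hk.
have kR : 0 < k%:R :> R by rewrite ltr0n.
have lE : inf E <= u k / k%:R.
  apply: ge_inf; first by exists L.
  by exists k.-1; rewrite ?prednK.
rewrite ler0_norm ?subr_le0// opprB lerBlDl.
rewrite ler_pdivrMr//.
have Mk : M <= e / 2 * k%:R.
  rewrite mulrC -ler_pdivrMr//; apply: le_trans (ltW (archi_boundP _)) _.
    by rewrite divr_ge0// ltW.
  by rewrite ler_nat; apply: ltnW.
have := uM (k %/ m.+1)%N (k %% m.+1)%N (ltn_pmod _ (ltn0Sn m)).
rewrite -divn_eq => h; apply: le_trans h _.
have : (k %/ m.+1)%:R * u m.+1 <= (inf E + e / 2) * k%:R.
  apply: (@le_trans _ _ (k%:R * (u m.+1 / m.+1%:R))).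
    rewrite mulrA mulrAC ler_wpM2r ?u0//.
    rewrite ler_pdivlMr ?ltr0n// -natrM ler_nat; exact: leq_divM.
  by rewrite mulrC ler_pM2r// ltW.
by move: (inf E) Mk => I *; lra.
Qed.

(** * Counting legal words *)

Section Words.
Context {n : nat} {R : realType}.
Local Notation A := (bool * 'I_n.+1)%type.
Local Notation N := (n.+1%:R : R).
Implicit Types (z : conf A) (k j : nat).

Definition growth_rate : R := N + N^-1.

Definition words k : {set k.-tuple A} :=
  [set u | `[< exists2 z : conf A, legal_on setT z & window 0 k z = u >]].

Lemma wordsP k (u : k.-tuple A) :
  reflect (exists2 z : conf A, legal_on setT z & window 0 k z = u) (u \in words k).
Proof. by rewrite inE; exact: asboolP. Qed.

Definition put (k : int) (s : A) z : conf A := fun l => if l == k then s else z l.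

Lemma putE (k : int) s z : put k s z k = s. Proof. by rewrite /put eqxx. Qed.

Lemma put_neq (k : int) s z (l : int) : l != k -> put k s z l = z l.
Proof. by rewrite /put => /negPf ->. Qed.

(** Newness relative to the times from 0 on, as suits the counting of words; [new_in] refers to a
    window of the past, [new_site] and [new_at] to the whole past. *)
Definition fresh z k := `[< forall i : int, 0 <= i < k%:Z -> pos z i <> pos z k%:Z >].

Lemma eq_fresh z z' k : (forall l : int, 0 <= l < k%:Z -> z l = z' l) ->
  fresh z k = fresh z' k.
Proof.
move=> h; have e (i : int) : 0 <= i <= k%:Z -> pos z i = pos z' i.
  by move=> ik; apply: pos_ext => l lk; apply: h; lia.
have ek := e k%:Z.
by apply/asboolP/asboolP => hz i ik; have := hz i ik; rewrite ?ek ?e; try lia.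
Qed.

(** Change the step at time [k] and the scenery at the site occupied then. If the site is fresh, no
    letter on [0, k) reads it; otherwise its label stays the same. Letters outside [0, k] may
    change. *)
Lemma legal_extend z k (s : A) : legal_on setT z -> fresh z k || (s.2 == (z k%:Z).2) ->
  exists2 z', legal_on setT z' &
    (forall l : int, 0 <= l < k%:Z -> z' l = z l) /\ z' k%:Z = s.
Proof.
move=> /kalikow_legal[[x y] _ <-]; set z0 := kalikow_map _ => hs.
pose x' : conf bool := fun l => if l == k%:Z then s.1 else x l.
pose y' : conf 'I_n.+1 := fun t => if t == pos z0 k%:Z then s.2 else y t.
have wx l : 0 <= l <= k%:Z -> walk x' l = pos z0 l.
  move=> lk; pose z1 : conf A := fun l => (x' l, ord0).
  have := @posB_ext _ z1 z0 0 l; rewrite !pos0 !subr0; apply; first by lia.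
  by move=> m ml; rewrite /z1 /x' /=; case: eqP => // mk; lia.
exists (kalikow_map (x', y')); first by apply/kalikow_legal; exists (x', y').
split=> [l lk|]; rewrite -[LHS]/(x' _, y' (walk x' _)) wx; try lia.
  rewrite /x' /y'; case: eqP => [e|_]; first by lia.
  rewrite -[RHS]/(x l, y (pos z0 l)); congr pair; case: eqP => // lk'.
  case/orP: hs => [/asboolP /(_ l lk)//|/eqP ->].
  by rewrite lk'.
by rewrite /x' /y' !eqxx; case: s {hs x' y' wx}.
Qed.

Definition nfresh z k : nat := \sum_(i < k) fresh z i.

Definition weight z k : R := N ^ (pos z k%:Z - (nfresh z k)%:Z).

(** The induction also bounds the earlier positions strictly: a site that is not fresh repeats an
    earlier position, hence lies strictly below the count, which leaves room for a step up. *)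
Lemma pos_le_nfresh z k : pos z k%:Z <= (nfresh z k)%:Z.
Proof.
suff [//] : pos z k%:Z <= (nfresh z k)%:Z /\
    forall i : int, 0 <= i < k%:Z -> pos z i < (nfresh z k)%:Z.
elim: k => [|k [IH1 IH2]].
  by rewrite pos0 /nfresh big_ord0; split=> // i; lia.
have eS : pos z k.+1%:Z = pos z k%:Z + up z k%:Z by rewrite -addn1 PoszD posS.
rewrite eS /nfresh big_ord_recr /= -/(nfresh z k).
have hu : up z k%:Z <= 1 by case: (up_cases z k%:Z) => ->.
have [[F IH]|[F lt]] :
  (fresh z k = true /\ forall i : int, 0 <= i <= k%:Z -> pos z i <= (nfresh z k)%:Z) \/
  (fresh z k = false /\ pos z k%:Z < (nfresh z k)%:Z).
- case: (boolP (fresh z k)) => [F|/asboolP/existsNP[i] /not_implyP[ik /contrapT e]].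
    left; split=> // i ik; have [ik'|->//] : 0 <= i < k%:Z \/ i = k%:Z by lia.
    exact/ltW/IH2.
  by right; split=> //; rewrite -e; exact: IH2.
- rewrite F addn1; move: (nfresh z k) (up z k%:Z) hu IH1 IH => N u hu IH1 IH.
  split; first by move: (pos z k%:Z) IH1 => *; lia.
  move=> i ik; have : 0 <= i <= k%:Z by lia.
  by move=> /IH; move: (pos z i) => *; lia.
rewrite F addn0; move: (nfresh z k) (up z k%:Z) hu lt IH2 => N u hu lt IH2.
split; first by move: (pos z k%:Z) lt => *; lia.
by move=> i ik; have [/IH2//|->//] : 0 <= i < k%:Z \/ i = k%:Z by lia.
Qed.

Lemma N_gt0 : 0 < N. Proof. by rewrite ltr0n. Qed.

Lemma N_neq0 : N != 0. Proof. by rewrite gt_eqF// N_gt0. Qed.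

Lemma weight_gt0 z k : 0 < weight z k.
Proof. by rewrite exprz_gt0// N_gt0. Qed.

Lemma weight_le1 z k : weight z k <= 1.
Proof.
have := pos_le_nfresh z k; rewrite /weight -subr_le0.
move: (_ - _) => [[|m]//|m] _.
by rewrite NegzE -exprnN invf_le1 ?exprn_gt0 ?N_gt0// exprn_ege1// ler1n.
Qed.

Lemma weightS z k : weight z k.+1 = weight z k * N ^ (up z k%:Z - (fresh z k)%:Z).
Proof.
rewrite /weight -expfzDr ?N_neq0//; congr (_ ^ _).
rewrite -[in pos _ _]addn1 PoszD posS /nfresh big_ord_recr /= PoszD; ring.
Qed.

Lemma eq_weight z z' k : (forall l : int, 0 <= l < k%:Z -> z l = z' l) ->
  weight z k = weight z' k.
Proof.
move=> h; rewrite /weight /nfresh; congr (_ ^ (_ - Posz _)).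
  by apply: pos_ext => l lk; apply: h; lia.
by apply: eq_bigr => i _; congr nat_of_bool; apply: eq_fresh => l li; apply: h;
  have := ltn_ord i; lia.
Qed.

(** At a fresh site the N labels compensate the factor 1/N, at an old one a single label is allowed;
    in both cases the two steps contribute N and 1/N. *)
Lemma sum_choices (f : bool) (b : 'I_n.+1) :
  \sum_(s : A | f || (s.2 == b)) N ^ (step s.1 - f%:Z) = growth_rate.
Proof.
rewrite big_mkcond.
rewrite -(pair_bigA _ (fun e a => if f || (a == b) then N ^ (step e - f%:Z) else 0)) /=.
have inner e : \sum_a (if f || (a == b) then N ^ (step e - f%:Z) else 0) = N ^ step e.
  case: f => /=.
    rewrite sumr_const card_ord -[_ ^ _ *+ _]mulr_natl -[X in X * _]expr1z.
    rewrite -expfzDr ?N_neq0//.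
    by congr (_ ^ _); ring.
  by rewrite -big_mkcond big_pred1_eq subr0.
rewrite (eq_bigr (fun e => N ^ step e)) => [|e _]; last exact: inner.
by rewrite big_bool /step expr1z exprN1.
Qed.

(** For each legal word one legal point carrying it is chosen. By [legal_extend] and [sum_choices]
    its extensions multiply the weight by [growth_rate]; only these extensions are counted, whence
    an inequality. *)
Lemma word_sum_ge k :
  growth_rate ^+ k <= \sum_(u in words k) weight (extend 0 u) k.
Proof.
elim: k => [|k IH].
  have w0 : [tuple] \in words 0.
    apply/wordsP; exists (fun=> point) => //; exact: tuple0.
  rewrite expr0 (big_pred1 [tuple]) => [|u]; last first.
    by rewrite (tuple0 u) /= w0; apply/esym/eqP/val_inj.
  by rewrite /weight pos0 /nfresh big_ord0.
pose pre (v : k.+1.-tuple A) := window 0 k (extend 0 v).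
have preW z : pre (window 0 k.+1 z) = window 0 k z.
  by apply/eq_windowP => l lk; rewrite extend_window//; lia.
rewrite (partition_big pre (mem (words k))) /=; last first.
  by move=> v /wordsP[z hz <-]; apply/wordsP; exists z; rewrite ?preW.
rewrite exprS; apply: (@le_trans _ _
    (\sum_(u in words k) growth_rate * weight (extend 0 u) k)).
  by rewrite -mulr_sumr ler_pM2l// /growth_rate addr_gt0 ?invr_gt0 ?N_gt0.
apply: ler_sum => u /wordsP[z hz zu].
pose V s := window 0 k.+1 (put k%:Z s z).
pose ok (s : A) := fresh z k || (s.2 == (z k%:Z).2).
have VI : injective V.
  move=> s t /(eq_windowP _ _ _ _).1/(_ k%:Z); rewrite !putE; apply; lia.
have okV s : ok s -> V s \in words k.+1.
  move=> /(legal_extend hz)[z' hz' [z'z z'k]]; apply/wordsP; exists z' => //.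
  apply/eq_windowP => l lk; have [lk'|->] : 0 <= l < k%:Z \/ l = k%:Z by lia.
    by rewrite z'z// put_neq//; lia.
  by rewrite z'k putE.
have preV s : pre (V s) = u.
  rewrite preW -zu; apply/eq_windowP => l lk; rewrite put_neq//; lia.
have wV s : weight (extend 0 (V s)) k.+1 =
    weight (extend 0 u) k * N ^ (step s.1 - (fresh z k)%:Z).
  rewrite (@eq_weight _ (put k%:Z s z)) => [|l lk]; last by rewrite extend_window//; lia.
  have zk l : 0 <= l < k%:Z -> put k%:Z s z l = z l by move=> lk; rewrite put_neq//; lia.
  rewrite weightS /up putE (eq_fresh zk); congr (_ * _).
  by apply: eq_weight => l lk; rewrite zk// -zu extend_window//; lia.
rewrite -(sum_choices (fresh z k) (z k%:Z).2) mulrC mulr_sumr.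
rewrite (eq_bigr (fun s => weight (extend 0 (V s)) k.+1)); last by move=> s _; rewrite wV.
rewrite (eq_bigl (mem [set s | ok s]%SET)) => [|s]; last by rewrite /= inE.
rewrite -(big_imset (fun v => weight (extend 0 v) k.+1)) /=; last by move=> s t _ _ /VI.
rewrite big_mkcond [leRHS]big_mkcond; apply: ler_sum => v _.
case: imsetP => [[s + ->]|_]; last by case: ifP => // _; exact/ltW/weight_gt0.
by rewrite inE => oks; rewrite okV//= preV eqxx.
Qed.

Lemma words_ge k : growth_rate ^+ k <= #|words k|%:R.
Proof.
apply: le_trans (word_sum_ge k) _.
rewrite -[#|_|]sum1_card natr_sum; apply: ler_sum => u _; exact: weight_le1.
Qed.

Lemma growth_ge2 : 2 <= growth_rate.
Proof.
have := sqr_ge0 (N - 1); rewrite sqrrB1 => h; have N0 := N_gt0.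
rewrite -(ler_pM2l N0) /growth_rate [leRHS]mulrDr divff ?N_neq0//.
by rewrite expr2 in h; move: (N) h => x; lra.
Qed.

Lemma growth_gt0 : 0 < growth_rate.
Proof. by apply: lt_le_trans growth_ge2. Qed.

Lemma words_submult j k : (#|words (j + k)| <= #|words j| * #|words k|)%N.
Proof.
pose g (u : (j + k).-tuple A) := (window 0 j (extend 0 u), window j%:Z k (extend 0 u)).
have gI : injective g.
  move=> u v guv; rewrite -(window_extend 0 u) -(window_extend 0 v).
  apply/(eq_windowP _ _ _ _).2 => l lk.
  have [lj|lj] : 0 <= l < 0 + j%:Z \/ j%:Z <= l < j%:Z + k%:Z by lia.
    exact: (eq_windowP _ _ _ _).1 (congr1 fst guv) l lj.
  exact: (eq_windowP _ _ _ _).1 (congr1 snd guv) l lj.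
rewrite -cardsX -(card_imset _ gI); apply/subset_leq_card/fintype.subsetP => p.
move=> /imsetP[u /wordsP[z hz <-] ->]; rewrite inE /=; apply/andP; split.
  apply/wordsP; exists z => //.
  by apply/eq_windowP => l lk; rewrite extend_window//; lia.
apply/wordsP; exists (shift_by j%:Z z); first exact: kalikow_shift.
rewrite window_shift add0r.
by apply/eq_windowP => l lk; rewrite extend_window//; lia.
Qed.

End Words.

(** * Topological entropy from below, by the cover of letters *)

Section TopologicalEntropy.
Context {n : nat} {R : realType}.
Local Notation A := (bool * 'I_n.+1)%type.
Local Notation X := (kalikow_subshift [set: conf 'I_n.+1]).

Definition letter_cover : set (set (conf A)) :=
  [set [set z | z 0 = a] | a in [set: A]].

Lemma letter_cover_join k (V : set (conf A)) : cover_join left_shift letter_cover k V ->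
  forall z z', V z -> V z' -> window 0 k z = window 0 k z'.
Proof.
move=> [W hW <-] z z' hz hz'; apply/eq_windowP => l lk.
have [a _ Wa] := hW `|l|%N; have lk' : (`|l| < k)%N by lia.
have := hz `|l|%N lk'; have := hz' `|l|%N lk'.
rewrite -Wa /= !iter_left_shift /shift_by add0r (_ : `|l|%N%:Z = l); last by lia.
by move=> -> ->.
Qed.

Lemma letter_cover_window k (u : k.-tuple A) :
  cover_join left_shift letter_cover k [set z | window 0 k z = u].
Proof.
exists (fun i => [set z : conf A | z 0 = nth point u i]).
  by move=> i; exists (nth point u i).
apply/seteqP; split=> [z /= h|z /= zu i ik].
  apply: eq_from_tnth => l; rewrite tnth_mktuple (tnth_nth point).
  by have := h l (ltn_ord l); rewrite /= iter_left_shift.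
rewrite /= iter_left_shift -[RHS]/(nth point u (Ordinal ik)) -tnth_nth.
by rewrite -zu tnth_mktuple.
Qed.

(** Each member of the joined cover fixes the word on [0, k), so a subcover has a different member
    for each legal word. *)
Lemma cover_number_letter k :
  cover_number R X (cover_join left_shift letter_cover k) = #|@words n k|%:R.
Proof.
rewrite /cover_number; set E := (Y in inf Y).
have Ew : E #|@words n k|%:R.
  exists #|@words n k| => //; exists (fun i => [set z | window 0 k z = enum_val i]).
  split=> [i|z /kalikow_legal hz]; first exact: letter_cover_window.
  have zw : window 0 k z \in words k by apply/wordsP; exists z.
  by exists (enum_rank_in zw (window 0 k z)) => //=; rewrite enum_rankK_in.
have Elb : lbound E #|@words n k|%:R.
  move=> _ [m [V [hV cV]] <-]; rewrite ler_nat.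
  have /choice[f hf] : forall u : {u | u \in @words n k}, exists i : 'I_m,
      exists2 z, V i z & window 0 k z = sval u.
    move=> [u /= /wordsP[z hz zu]].
    have [|i _ Vi] := cV z; first exact/kalikow_legal.
    by exists i, z.
  have fI : injective f.
    move=> u v fuv; have [z Vz zu] := hf u; have [z' Vz' zv] := hf v.
    apply/val_inj; rewrite /= -[LHS]zu -[RHS]zv.
    by apply: (letter_cover_join (hV (f u))) => //; rewrite fuv.
  by have := leq_card f fI; rewrite card_sig card_ord.
apply/le_anti; rewrite ge_inf//=; last by exists #|@words n k|%:R.
by apply: lb_le_inf => //; exists #|@words n k|%:R.
Qed.

Lemma topological_entropy_ge :
  ((ln (@growth_rate n R))%:E <= topological_entropy R X left_shift)%E.
Proof.
have W0 k : (0 < #|@words n k|)%N.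
  rewrite -(ltr_nat R); apply: lt_le_trans (words_ge k).
  by rewrite exprn_gt0// growth_gt0.
have [|||l Ll cl] := @fekete R (fun k => ln #|@words n k|%:R) (ln (@growth_rate n R)).
- by move=> m; apply: ln_ge0; rewrite ler1n.
- move=> m k; rewrite -lnM ?posrE ?ltr0n// -natrM ler_ln ?posrE ?ltr0n ?muln_gt0 ?W0//.
  by rewrite ler_nat words_submult.
- move=> m; rewrite mulr_natl -lnXn ?growth_gt0//.
  rewrite ler_ln ?posrE ?exprn_gt0 ?growth_gt0// ?ltr0n//.
  exact: words_ge.
apply: (@le_trans _ _ (cover_entropy R X left_shift letter_cover)%:E).
  rewrite lee_fin /cover_entropy; under eq_fun do rewrite cover_number_letter.
  by rewrite (cvg_lim _ cl).
apply: ereal_sup_ubound; exists letter_cover => //; split=> [_ [a _ <-]|z _].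
  apply: (@open_local _ _ 1) => z z' zz' /= <-.
  by rewrite zz'.
by exists [set z' | z' 0 = z 0] => //; exists (z 0).
Qed.

End TopologicalEntropy.

(** * Lower bounds for the block entropies *)

Section BlockEntropy.
Context {n : nat} {R : realType}.
Local Notation A := (bool * 'I_n.+1)%type.
Local Notation X := (kalikow_subshift [set: conf 'I_n.+1]).
Variable mu : probability (borel (conf A)) R.
Hypothesis mme : maximal_entropy_measure X mu.

Lemma mme_inv (B : set (borel (conf A))) : measurable B ->
  mu (left_shift @^-1` B) = mu B.
Proof. by case: mme => _ + _; exact. Qed.

Lemma block_entropy_ge (e : R) : 0 < e -> exists C : R, forall j,
  j%:R * (ln (@growth_rate n R) - e) - C <= block_entropy mu j.
Proof.
move=> e0; set h := ln (@growth_rate n R).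
have h0 : 0 < h by rewrite ln_gt0// (lt_le_trans _ growth_ge2)// ltr1n.
(* Three errors [r] occur: in the supremum, in the limit and in [join_entropy_le]. The bound [h / 2]
   keeps [h - r] positive. *)
pose r := Num.min (e / 3) (h / 2).
have r0 : 0 < r by rewrite lt_min !divr_gt0.
have re : r <= e / 3 by rewrite ge_min lexx.
have rh : r < h.
  have : r <= h / 2 by rewrite ge_min lexx orbT.
  by move: h0; move: (h) => x; lra.
have : ((h - r)%:E < kolmogorov_entropy mu left_shift)%E.
  case: mme => _ _ ->; apply: lt_le_trans topological_entropy_ge.
  by rewrite lte_fin ltrBlDr ltrDl.
move=> /ereal_sup_gt[_ [k [f [mf ->]]]]; rewrite lte_fin /partition_entropy.
set v := (fun j => _) => hv.
have cv : cvg (v @ \oo).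
  (* A divergent sequence has the default limit 0, which lies below [h - r]. *)
  apply: contrapT => /dvgP hdv; move: hv; rewrite hdv => h1.
  by have : h - r < 0 by []; rewrite ltNge subr_ge0 ltW.
have /cvgrPdist_le/(_ _ r0)[J _ hJ] : v @ \oo --> limn v by [].

have [m hm] := join_entropy_le mme_inv mf r0.
(* [C] absorbs the blocks too short for the limit and the [2 * m] additional letters of a longer
   one. *)
pose C := (J + 2 * m)%:R * `|h - e|; exists C => j.
have H0 : 0 <= block_entropy mu j by apply: entropy_ge0; exact: simple_window.
have hC : (h - e) <= `|h - e| := ler_norm _.
rewrite lerBlDr; have [jJ|Jj] := leqP j (J + 2 * m).
  apply: le_trans (lerD H0 (lexx C)); rewrite add0r.
  apply: (@le_trans _ _ (j%:R * `|h - e|)); first by rewrite ler_wpM2l.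
  by rewrite ler_wpM2r// ler_nat.
have [i ji] : exists i, j = (i + 2 * m)%N by exists (j - 2 * m)%N; lia.
have Ji : (J <= i)%N by lia.
have i0 : 0 < i%:R :> R by rewrite ltr0n; lia.
have := hJ i Ji; rewrite /= ler_distlC => /andP[h1 _].
have h2 : h - 2 * r <= v i by move: hv h1; move: (limn v) => x; lra.
move: h2; rewrite /v ler_pdivlMr// => h2; have := hm i; rewrite -ji => h3.
have h4 : i%:R * r <= i%:R * (e / 3) by rewrite ler_pM2l.
have h5 : (2 * m)%:R * (h - e) <= C.
  apply: (@le_trans _ _ ((2 * m)%:R * `|h - e|)); first by rewrite ler_wpM2l.
  by rewrite ler_wpM2r// ler_nat leq_addl.
rewrite ji natrD mulrDl -ji; move: h2 h3 h4 h5.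
by move: (h) (i%:R : R) C (block_entropy mu j) => x y c b; lra.
Qed.

(** Increments decrease by concavity, so a single one below [ln growth_rate] would keep the growth
    of all later block entropies at a strictly smaller rate, against [block_entropy_ge]. *)
Lemma block_entropy_increment k :
  ln (@growth_rate n R) <= block_entropy mu k.+1 - block_entropy mu k.
Proof.
pose d k := block_entropy mu k.+1 - block_entropy mu k.
have dle k' : d k'.+1 <= d k' by exact: block_entropy_concave mme_inv k'.
rewrite leNgt; apply/negP => dk; set h := ln (@growth_rate n R) in dk.
have dec j : d (k + j)%N <= d k.
  elim: j => [|j IH]; first by rewrite addn0.
  by rewrite addnS; apply: le_trans IH.
have bound j : block_entropy mu (k + j) <= block_entropy mu k + j%:R * d k.
  elim: j => [|j IH]; first by rewrite addn0 mul0r addr0.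
  have := dec j; rewrite addnS -natr1 /d => dj; move: IH; rewrite /d; lra.
pose e := (h - d k) / 2.
have e0 : 0 < e by rewrite divr_gt0// subr_gt0.
have [C hC] := block_entropy_ge e0.
pose B := block_entropy mu k + C - k%:R * (h - e).
have hB j : j%:R * e <= B.
  have := le_trans (hC (k + j)%N) (bound j); rewrite natrD -/h => h1.
  have -> : e = (h - e) - d k by rewrite /e; field.
  by move: h1; rewrite /B; lra.
have := hB (Num.bound `|B / e|); apply/negP; rewrite -ltNge -ltr_pdivrMr//.
apply: le_lt_trans (ler_norm _) _; exact: archi_boundP (normr_ge0 _).
Qed.

End BlockEntropy.

(** * Measurability of events defined by the walk *)

Lemma measurable_forall d (T : measurableType d) (I : countType)
    (F : I -> set T) : (forall i, measurable (F i)) ->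
  measurable [set t | forall i, F i t].
Proof.
move=> mF; rewrite (_ : [set t | _] =
    \bigcap_m (if unpickle m is Some i then F i else setT)).
  by apply: bigcap_measurable => // m _; case: unpickle => [i|]; [exact: mF|].
apply/seteqP; split=> [t h m _|t h i]; first by case: unpickle.
by have := h (pickle i) Logic.I; rewrite pickleK.
Qed.

Lemma measurable_exists d (T : measurableType d) (I : countType)
    (F : I -> set T) : (forall i, measurable (F i)) ->
  measurable [set t | exists i, F i t].
Proof.
move=> mF; rewrite (_ : [set t | _] = ~` [set t | forall i, (~` F i) t]).
  by apply/measurableC/measurable_forall => i; exact: measurableC.
apply/seteqP; split=> [t [i Fi] h|t]; first exact: (h i).
by move=> /existsNP[i /contrapT]; exists i.
Qed.

Lemma measurable_imply d (T : measurableType d) (P : Prop) (F : set T) :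
  measurable F -> measurable [set t | P -> F t].
Proof.
move=> mF; have [p|np] := pselect P.
  by rewrite (_ : [set t | _] = F)//; apply/seteqP; split=> t /= h; [exact: h|move=> _].
by rewrite (_ : [set t | _] = setT)//; apply/seteqP; split=> // t _ /np.
Qed.

Section MeasurableEvents.
Context {B : pointedType}.
Local Notation A := (bool * B)%type.
Implicit Types (z : conf A) (I : set int).

Lemma measurable_pos (i j : int) (Q : int -> int -> Prop) :
  measurable ([set z : conf A | Q (pos z i) (pos z j)] : set (borel (conf A))).
Proof.
apply: (@measurable_local _ _ (maxn `|i| `|j|).+1) => z z' zz' /=.
rewrite (@pos_ext _ z z' i) ?(@pos_ext _ z z' j)// => l li; apply: zz';
  rewrite /centered /=; lia.
Qed.

Lemma measurable_legal_on I :
  measurable ([set z : conf A | legal_on I z] : set (borel (conf A))).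
Proof.
pose G i j : set (borel (conf A)) := if `[< I i /\ I j >] then
  [set z : conf A | pos z i = pos z j -> (z i).2 = (z j).2] else setT.
have mG i j : measurable (G i j).
  rewrite /G; case: asboolP => // _.
  apply: (@measurable_local _ _ (maxn `|i| `|j|).+1) => z z' zz' /=.
  have ei : pos z i = pos z' i.
    by apply: pos_ext => l li; apply: zz'; rewrite /centered /=; lia.
  have ej : pos z j = pos z' j.
    by apply: pos_ext => l lj; apply: zz'; rewrite /centered /=; lia.
  have zi : z i = z' i by apply: zz'; rewrite /centered /=; lia.
  have zj : z j = z' j by apply: zz'; rewrite /centered /=; lia.
  by rewrite ei ej zi zj.
rewrite (_ : [set z | _] = [set z | forall i, [set z | forall j, G i j z] z]).
  by apply: measurable_forall => i; exact: measurable_forall.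
apply/seteqP; split=> z /= h i j; rewrite /G; last first.
  by move=> Ii Ij; have := h i j; rewrite /G asboolT.
by case: asboolP => // -[Ii Ij]; exact: h.
Qed.

End MeasurableEvents.

(** * Prediction of the next symbol *)

Section Predictor.
Context {n : nat} {R : realType}.
Local Notation A := (bool * 'I_n.+1)%type.
Local Notation X := (kalikow_subshift [set: conf 'I_n.+1]).
Local Notation N := (n.+1%:R : R).
Local Notation growth := (@growth_rate n R).
Local Notation Omega := (borel (conf A)).
Implicit Types (z : conf A).

Definition new_in k z : bool :=
  `[< forall i : int, - k%:Z <= i < 0 -> pos z i <> 0 >].

(** Meaningful when [new_in k z] fails; on legal points it is then independent of the visit that
    [xget] selects. *)
Definition old_label k z : 'I_n.+1 :=
  (z (xget 0 [set i : int | - k%:Z <= i < 0 /\ pos z i = 0])).2.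

Lemma eq_new_in k z z' : (forall l : int, - k%:Z <= l < 0 -> z l = z' l) ->
  new_in k z = new_in k z'.
Proof.
move=> h; have e (i : int) : - k%:Z <= i < 0 -> pos z i = pos z' i.
  by move=> ik; apply: pos_ext => l lk; apply: h; lia.
by apply/asboolP/asboolP => hz i ik; have := hz i ik; rewrite e.
Qed.

Lemma eq_old_label k z z' : (forall l : int, - k%:Z <= l < 0 -> z l = z' l) ->
  ~~ new_in k z -> old_label k z = old_label k z'.
Proof.
move=> h /asboolP/existsNP[i /not_implyP[ik /contrapT i0]].
have e (j : int) : - k%:Z <= j < 0 -> pos z j = pos z' j.
  by move=> jk; apply: pos_ext => l lk; apply: h; lia.
rewrite /old_label; have <- : [set i : int | - k%:Z <= i < 0 /\ pos z i = 0] =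
    [set i : int | - k%:Z <= i < 0 /\ pos z' i = 0].
  by apply/seteqP; split=> j /= [jk j0]; split=> //; [rewrite -e|rewrite e].
have [jk _] : [set i : int | - k%:Z <= i < 0 /\ pos z i = 0]
  (xget 0 [set i : int | - k%:Z <= i < 0 /\ pos z i = 0]) by apply: xgetPex; exists i.
by rewrite h.
Qed.

Lemma old_label_legal k (I : set int) z : legal_on I z ->
  [set i : int | - k%:Z <= i <= 0] `<=` I ->
  ~~ new_in k z -> (z 0).2 = old_label k z.
Proof.
move=> hz kI /asboolP/existsNP[i /not_implyP[ik /contrapT i0]].
rewrite /old_label.
have [jk j0] : [set i : int | - k%:Z <= i < 0 /\ pos z i = 0]
  (xget 0 [set i : int | - k%:Z <= i < 0 /\ pos z i = 0]) by apply: xgetPex; exists i.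
by apply: hz; [apply: kI => /=; lia|apply: kI => /=; lia|rewrite j0 pos0].
Qed.

Definition step_prob (o : option bool) (e : bool) : R :=
  if o is Some b then (if e == b then N else N^-1) / growth else 2^-1.

Definition label_prob k z (a : 'I_n.+1) : R :=
  if new_in k z then N^-1 else (a == old_label k z)%:R.

Definition predict k (g : conf A -> option bool) z (s : A) : R :=
  step_prob (g z) s.1 * label_prob k z s.2.

Lemma step_prob_gt0 o e : 0 < step_prob o e.
Proof.
case: o => [b|]; rewrite /step_prob ?invr_gt0//.
by rewrite divr_gt0 ?growth_gt0//; case: ifP; rewrite ?invr_gt0 N_gt0.
Qed.

Lemma predict_ge0 k g z s : 0 <= predict k g z s.
Proof.
rewrite mulr_ge0 ?(ltW (step_prob_gt0 _ _))// /label_prob.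
by case: ifP => _; rewrite ?ler0n// invr_ge0 ler0n.
Qed.

Lemma sum_predict k g z : \sum_s predict k g z s = 1.
Proof.
rewrite -(pair_bigA _ (fun e a => step_prob (g z) e * label_prob k z a)) /=.
have L : \sum_a label_prob k z a = 1.
  rewrite /label_prob; case: (new_in k z).
    by rewrite sumr_const card_ord -[_ *+ _]mulr_natl divff// N_neq0.
  by rewrite (bigD1 (old_label k z))//= eqxx big1 ?addr0// => a /negPf ->.
under eq_bigr do rewrite -mulr_sumr L mulr1.
rewrite big_bool /step_prob; case: (g z) => [b|]; last by rewrite [RHS]splitr mul1r.
have := @growth_gt0 n R; rewrite /growth_rate => /gt_eqF g0.
by case: b; rewrite /= -mulrDl ?[N^-1 + _]addrC divff ?g0.
Qed.

(** A linear combination of indicators, so that its expectation is a combination of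
    probabilities. *)
Lemma ln_predict k g z s : new_in k z || (s.2 == old_label k z) ->
  - ln (predict k g z s) =
  ln N * (new_in k z)%:R + (ln growth - ln N) * (g z == Some s.1)%:R +
  (ln growth + ln N) * (g z == Some (~~ s.1))%:R + ln 2 * (g z == None)%:R.
Proof.
move=> hs; have N0 := @N_gt0 n R; have g0 := @growth_gt0 n R.
rewrite /predict lnM ?posrE ?step_prob_gt0//; last first.
  rewrite /label_prob; move: hs; case: ifP => _ /=; first by rewrite invr_gt0.
  by move=> /eqP ->; rewrite eqxx.
have -> : ln (label_prob k z s.2) = - (ln N * (new_in k z)%:R).
  rewrite /label_prob; move: hs; case: ifP => _ /=.
    by rewrite lnV ?posrE// mulr1.
  by move=> /eqP ->; rewrite eqxx ln1 mulr0 oppr0.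
rewrite /step_prob; case: (g z) => [b|]; last first.
  by rewrite lnV ?posrE// !mulr0 mulr1; ring.
rewrite ln_div ?posrE//; last by case: ifP; rewrite ?invr_gt0.
case: b; case: s.1 => /=; rewrite ?lnV ?posrE// !(mulr0, mulr1); ring.
Qed.

End Predictor.

(** * Divergence of the next letter from its prediction *)

Section DivergenceBound.
Context {n : nat} {R : realType}.
Local Notation A := (bool * 'I_n.+1)%type.
Local Notation X := (kalikow_subshift [set: conf 'I_n.+1]).
Local Notation N := (n.+1%:R : R).
Local Notation growth := (@growth_rate n R).
Local Notation Omega := (borel (conf A)).
Variable mu : probability Omega R.
Hypothesis mme : maximal_entropy_measure X mu.
Local Notation pr := (prob mu).
Implicit Types (z : conf A).

Definition legal_event : set Omega := [set z : conf A | legal_on setT z].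

Lemma pr_legal : pr legal_event = 1.
Proof.
rewrite (_ : legal_event = X); first by case: mme => h _ _; rewrite /prob h.
by apply/seteqP; split=> z /kalikow_legal.
Qed.

Lemma measurable_legal : measurable legal_event.
Proof. exact: measurable_legal_on. Qed.

Lemma pr_illegal : pr (~` legal_event) = 0.
Proof. by rewrite prC ?pr_legal ?subrr//; exact: measurable_legal. Qed.

Lemma pr_gt0_legal (B : set Omega) : measurable B -> 0 < pr B ->
  exists2 z, B z & legal_on setT z.
Proof.
move=> mB B0; apply: contrapT => h; move: B0.
rewrite (pr_eq0S (B := ~` legal_event)) ?ltxx//.
- by apply: measurableC; exact: measurable_legal.
- by move=> z Bz hz; apply: h; exists z.
- exact: pr_illegal.
Qed.

Definition past_letter k z : k.-tuple A * A := (window (- k%:Z) k z, z 0).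

Definition past_dist k (p : k.-tuple A * A) : R := pr (past_letter k @^-1` [set p]).

(** The past keeps its true law, so the divergence from [past_dist] concerns the conditional law of
    the letter alone. *)
Definition predicted_dist k g (p : k.-tuple A * A) : R :=
  pr (window (- k%:Z) k @^-1` [set p.1]) * predict k g (extend (- k%:Z) p.1) p.2.

Arguments past_dist : clear implicits.
Arguments predicted_dist : clear implicits.

Definition past_determined k (T : Type) (g : conf A -> T) :=
  forall z z', (forall l : int, - k%:Z <= l < 0 -> z l = z' l) -> g z = g z'.

Lemma simple_letter (i : int) : simple_rv (fun z : Omega => (z i : A)).
Proof.
move=> a; apply: (@measurable_local _ _ `|i|.+1) => z z' zz' /= <-.
by rewrite zz'// /centered /=.
Qed.

Lemma simple_past_letter k : simple_rv (past_letter k : Omega -> _).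
Proof. by apply: simple_pair; [exact: simple_window|exact: simple_letter]. Qed.

Lemma entropy_past_letter k : entropy mu (past_letter k) = block_entropy mu k.+1.
Proof.
pose h (u : k.+1.-tuple A) := past_letter k (extend (- k%:Z) u).
rewrite (_ : past_letter k = h \o (window (- k%:Z) k.+1 : Omega -> _)).
  rewrite entropy_inj; first exact: (block_entropyE (mme_inv mme)).
    exact: simple_window.
  move=> u v huv; rewrite -(window_extend (- k%:Z) u) -(window_extend (- k%:Z) v).
  apply/(eq_windowP _ _ _ _).2 => l lk.
  have [lk'| ->] : - k%:Z <= l < - k%:Z + k%:Z \/ l = 0 by lia.
    exact: (eq_windowP _ _ _ _).1 (congr1 fst huv) l lk'.
  exact: (congr1 snd huv).
apply/funext => z; congr pair; last by rewrite extend_window//; lia.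
by apply/eq_windowP => l lk; rewrite extend_window//; lia.
Qed.

Lemma sum_predicted_dist k g : \sum_p predicted_dist k g p = 1.
Proof.
rewrite -(pair_bigA _ (fun u s => predicted_dist k g (u, s))) /=.
under eq_bigr do rewrite /predicted_dist /= -mulr_sumr sum_predict mulr1.
by apply: pr_simple_sum1; exact: simple_window.
Qed.

Lemma sum_past_dist k : \sum_p past_dist k p = 1.
Proof. exact: (pr_simple_sum1 _ (@simple_past_letter k)). Qed.

Lemma past_dist_le k p : past_dist k p <= pr (window (- k%:Z) k @^-1` [set p.1]).
Proof. exact: (le_pr_comp mu fst p (@simple_past_letter k)). Qed.

(** An atom of positive mass contains a legal point, whose label at an old site is forced. This
    gives the absolute continuity that the divergence requires. *)
Lemma past_dist_support k p : 0 < past_dist k p ->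
  new_in k (extend (- k%:Z) p.1) ||
    (p.2.2 == old_label k (extend (- k%:Z) p.1)).
Proof.
move=> /pr_gt0_legal[|z /= <- hz]; first exact: simple_past_letter.
have e (l : int) : - k%:Z <= l < 0 -> extend (- k%:Z) (window (- k%:Z) k z) l = z l.
  by move=> lk; rewrite extend_window//; lia.
have [//|nz /=] := boolP (new_in k _).
rewrite (eq_old_label e nz); apply/eqP; apply: old_label_legal hz _ _ => //.
by rewrite -(eq_new_in e).
Qed.

Lemma predicted_dist_ge0 k g p : 0 <= predicted_dist k g p.
Proof. by rewrite mulr_ge0 ?pr_ge0 ?predict_ge0. Qed.

Lemma predict_gt0 k g z (s : A) : new_in k z || (s.2 == old_label k z) ->
  0 < predict k g z s :> R.
Proof.
move=> hs; rewrite /predict mulr_gt0 ?step_prob_gt0// /label_prob.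
by case: ifP hs => _ /=; [rewrite invr_gt0 ltr0n|move=> ->].
Qed.

Lemma predicted_dist_gt0 k g p : 0 < past_dist k p -> 0 < predicted_dist k g p.
Proof.
move=> p0; rewrite /predicted_dist mulr_gt0 ?(lt_le_trans p0 (past_dist_le p))//.
exact/predict_gt0/past_dist_support.
Qed.

Definition divergence_bound k (g : conf A -> option bool) : R :=
  ln N * (pr [set z | new_in k z] - pr [set z | g z = Some (z 0).1] +
          pr [set z | g z = Some (~~ (z 0).1)]) -
  (ln growth - ln 2) * pr [set z | g z = None].

Lemma sum_past_dist_event k (F : conf A -> A -> bool) :
  (forall s, past_determined k (F ^~ s)) ->
  \sum_p past_dist k p * (F (extend (- k%:Z) p.1) p.2)%:R =
  pr [set z | F z (z 0)].
Proof.
move=> hF; rewrite (_ : [set z | F z (z 0)] =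
    [set z | (fun p => F (extend (- k%:Z) p.1) p.2) (past_letter k z)]).
  rewrite (pr_simple _ (fun p => F (extend (- k%:Z) p.1) p.2) (@simple_past_letter k)).
  rewrite [RHS]big_mkcond; apply: eq_bigr => p _; rewrite asboolb.
  by case: ifP; rewrite ?mulr1 ?mulr0.
have e z : F (extend (- k%:Z) (window (- k%:Z) k z)) (z 0) = F z (z 0).
  by apply: (hF (z 0)) => l lk; rewrite extend_window//; lia.
by apply/seteqP; split=> z /=; rewrite e.
Qed.

(** The divergence is the cross entropy, computed by [ln_predict], minus a conditional entropy that
    is at least [ln growth]. The events [c2], [c3], [c4] (right guess, wrong guess, no guess) have
    total probability 1, so [ln growth] cancels on the first two and leaves [ln 2 - ln growth] on
    the third. *)
Lemma divergence_past_le k g : past_determined k g ->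
  \sum_p past_dist k p * (ln (past_dist k p) - ln (predicted_dist k g p)) <=
  divergence_bound k g.
Proof.
move=> hg; pose E := @extend n (- k%:Z) k.
pose c1 z (s : A) := new_in k z.
pose c2 z (s : A) := g z == Some s.1.
pose c3 z (s : A) := g z == Some (~~ s.1).
pose c4 z (s : A) := g z == None.
have term p : past_dist k p * (ln (past_dist k p) - ln (predicted_dist k g p)) =
   - (past_dist k p * - ln (past_dist k p) -
      past_dist k p * - ln (pr (window (- k%:Z) k @^-1` [set p.1]))) +
   (ln N * (past_dist k p * (c1 (E p.1) p.2)%:R) +
   (ln growth - ln N) * (past_dist k p * (c2 (E p.1) p.2)%:R) +
   (ln growth + ln N) * (past_dist k p * (c3 (E p.1) p.2)%:R) +
   ln 2 * (past_dist k p * (c4 (E p.1) p.2)%:R)).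
  have := pr_ge0 mu (past_letter k @^-1` [set p]); rewrite -/(past_dist k p).
  rewrite le_eqVlt => /predU1P[<-|p0]; first by rewrite !(mul0r, mulr0); ring.
  have hs := past_dist_support p0.
  rewrite /predicted_dist lnM ?posrE ?predict_gt0//; last first.
    exact: lt_le_trans p0 (past_dist_le p).
  have := ln_predict (R := R) g hs; rewrite -/(c1 _ p.2) -/(c2 _ _) -/(c3 _ _) -/(c4 _ p.2).
  move=> /(congr1 -%R); rewrite opprK => ->.
  rewrite -/(E p.1); ring.
under eq_bigr do rewrite term.
rewrite big_split sumrN sumrB /= !big_split /= -!mulr_sumr.
have d1 s : past_determined k (c1^~ s) by move=> z z' /eq_new_in.
have d2 s : past_determined k (c2^~ s) by move=> z z' /hg; rewrite /c2 => ->.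
have d3 s : past_determined k (c3^~ s) by move=> z z' /hg; rewrite /c3 => ->.
have d4 s : past_determined k (c4^~ s) by move=> z z' /hg; rewrite /c4 => ->.
rewrite !sum_past_dist_event//.
have hent : \sum_p past_dist k p * - ln (past_dist k p) -
    \sum_p past_dist k p * - ln (pr (window (- k%:Z) k @^-1` [set p.1])) =
    block_entropy mu k.+1 - block_entropy mu k.
  rewrite -entropy_past_letter -(block_entropyE (mme_inv mme) (- k%:Z) k).
  congr (_ - _); first by apply: eq_bigr => p _; rewrite mulrN.
  by rewrite -(entropyE mu fst (@simple_past_letter k)).
rewrite hent; have := block_entropy_increment mme k.
have e2 : [set z | c2 z (z 0)] = [set z | g z = Some (z 0).1].
  by apply/seteqP; split=> z /= /eqP.
have e3 : [set z | c3 z (z 0)] = [set z | g z = Some (~~ (z 0).1)].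
  by apply/seteqP; split=> z /= /eqP.
have e4 : [set z | c4 z (z 0)] = [set z | g z = None].
  by apply/seteqP; split=> z /= /eqP.
have : pr [set z | c2 z (z 0)] + pr [set z | c3 z (z 0)] +
       pr [set z | c4 z (z 0)] = 1.
  rewrite -!(@sum_past_dist_event k)// -!big_split /= -[RHS](sum_past_dist k).
  apply: eq_bigr => p _; rewrite -!mulrDr -[RHS]mulr1; congr (_ * _).
  rewrite /c2 /c3 /c4; case: (g _) => [b|]; last first.
    by rewrite !add0r.
  by case: b; case: p.2.1; rewrite ?eqxx /= ?(addr0, add0r).
rewrite /divergence_bound -e2 -e3 -e4.
move: (pr [set z | c2 _ _]) (pr [set z | c3 _ _]) (pr [set z | c4 _ _]) => a b c abc.
have -> : c = 1 - a - b by rewrite -abc; ring.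
rewrite -/(c1 _ _); move: (pr _) (block_entropy _ _ - _) => x dd; lra.
Qed.

End DivergenceBound.

(** * Recurrence and drift *)

Section Recurrence.
Context {A : pointedType} {R : realType}.
Variable mu : probability (borel (conf A)) R.
Hypothesis inv : forall B : set (borel (conf A)), measurable B ->
  mu (left_shift @^-1` B) = mu B.
Local Notation pr := (prob mu).
Local Notation Omega := (borel (conf A)).
Local Notation shift i := (shift_by i : Omega -> Omega).

(** Any number [m] of disjoint translates has total mass [m%:R * pr W], which is at most 1. *)
Lemma pr_wandering (W : set Omega) : measurable W ->
  (forall i j : nat, (i < j)%N -> shift i%:Z @^-1` W `&` shift j%:Z @^-1` W = set0) ->
  pr W = 0.
Proof.
move=> mW dW; pose U m : set Omega := \big[setU/set0]_(i < m) (shift i%:Z @^-1` W).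
have mU m : measurable (U m).
  by apply: bigsetU_measurable => i _; exact: measurable_shift.
have hU m : pr (U m) = m%:R * pr W.
  elim: m => [|m IH]; first by rewrite /U big_ord0 pr0 mul0r.
  rewrite /U big_ord_recr /= prU//; [|exact: mU|exact: measurable_shift|].
    by rewrite -/(U m) IH pr_shift// -natr1 mulrDl mul1r.
  rewrite -subset0 -(bigcup_mkord m (fun i => shift i%:Z @^-1` W)).
  move=> z [[i im Wi] Wm].
  by rewrite -(dW i m im); split.
apply/le_anti; rewrite pr_ge0 andbT; apply/ler_addgt0Pl => e e0.
rewrite addr0; set m := Num.bound e^-1.
have h : e^-1 < m.+1%:R.
  apply: lt_trans (archi_boundP _) _; first by rewrite invr_ge0 ltW.
  by rewrite ltr_nat.
have := pr_le1 mu (mU m.+1); rewrite hU -ler_pdivlMl ?ltr0n// mulr1.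
move=> /le_trans; apply; rewrite invf_ple ?posrE ?ltr0n//.
exact: ltW.
Qed.

(* Poincare recurrence, in both time directions. *)
Lemma pr_extremal_visit (b : bool) (B : set Omega) : measurable B ->
  pr [set z | exists i : int, B (shift_by i z) /\
    forall j : int, 0 < step b * (j - i) -> ~ B (shift_by j z)] = 0.
Proof.
move=> mB; pose G (j : int) : set Omega :=
  [set z | 0 < step b * j -> ~ B (shift_by j z)].
have mG j : measurable (G j).
  rewrite /G; have [h|h] := boolP (0 < step b * j).
    rewrite (_ : [set z | _] = ~` (shift j @^-1` B)).
      by apply: measurableC; exact: measurable_shift.
    by apply/seteqP; split=> z /= h'; [exact: h'|move=> _].
  by rewrite (_ : [set z | _] = setT)//; apply/seteqP; split=> z /= _ // /negP.
(* The points whose extremal visit takes place at time 0; its translates are disjoint because an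
   extremal visit is unique. *)
pose W : set Omega := B `&` [set z | forall j, G j z].
have mW : measurable W by apply: measurableI => //; exact: measurable_forall.
have WS i z : W (shift_by i z) <-> (B (shift_by i z) /\
    forall j : int, 0 < step b * (j - i) -> ~ B (shift_by j z)).
  split=> [[Bi h]|[Bi h]]; split=> //= j j0.
    by have := h (j - i) j0; rewrite shift_by_add subrK.
  by rewrite shift_by_add; apply: h; rewrite addrK.
have W0 : pr W = 0.
  apply: pr_wandering => // i j ij; rewrite -subset0 => z [/WS[Bi hi] /WS[Bj hj]].
  case: b {G mG W mW WS} hi hj => hi hj.
    by apply: (hi j) => //; rewrite /step; lia.
  by apply: (hj i) => //; rewrite /step; lia.
pose F (m : nat) : set Omega :=
  if unpickle m is Some i then shift i @^-1` W else set0.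
rewrite (_ : [set z | _] = \bigcup_m F m).
  apply: pr_bigcup0 => m; rewrite /F; case: unpickle => [i|];
    rewrite ?pr0//; first exact: measurable_shift.
  by rewrite pr_shift.
apply/seteqP; split=> [z [i /WS Wi]|z [m _]].
  by exists (pickle i) => //; rewrite /F pickleK.
by rewrite /F; case: unpickle => // i /WS; exists i.
Qed.

End Recurrence.

(** * Drift, records and new sites *)

Section Drift.
Context {n : nat} {R : realType}.
Local Notation A := (bool * 'I_n.+1)%type.
Local Notation Omega := (borel (conf A)).
Variable mu : probability Omega R.
Hypothesis inv : forall B : set Omega, measurable B ->
  mu (left_shift @^-1` B) = mu B.
Local Notation pr := (prob mu).
Local Notation shift i := (shift_by i : Omega -> Omega).
Implicit Types (z : conf A) (b : bool).

(** As time runs forward the walk comes from minus infinity in direction [b]; this is a property of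
    the past. *)
Definition drift b : set Omega := [set z : conf A |
  forall m : nat, exists K : int, forall k : int, k <= K ->
    step b * pos z k < - m%:Z].

(* The walk is at a strict extremum, in direction b, of its past. *)
Definition record b : set Omega := [set z : conf A |
  forall k : int, k < 0 -> step b * pos z k < 0].

Definition new_site : set Omega := [set z : conf A |
  forall k : int, k < 0 -> pos z k <> 0].

Lemma measurable_drift b : measurable (drift b).
Proof.
apply: measurable_forall => m; apply: measurable_exists => K.
apply: measurable_forall => k; apply: measurable_imply.
exact: (measurable_pos k k (fun x _ => step b * x < - m%:Z)).
Qed.

Lemma measurable_record b : measurable (record b).
Proof.
apply: measurable_forall => k; apply: measurable_imply.
exact: (measurable_pos k k (fun x _ => step b * x < 0)).
Qed.

Lemma measurable_new_site : measurable new_site.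
Proof.
apply: measurable_forall => k; apply: measurable_imply.
exact: (measurable_pos k k (fun x _ => x <> 0)).
Qed.

Lemma step_sqr b : step b * step b = 1. Proof. by case: b. Qed.

Lemma drift_shift b z i : drift b (shift_by i z) <-> drift b z.
Proof.
have h (z' : conf A) j : drift b z' -> drift b (shift_by j z').
  move=> hz m; have [K hK] := hz (m + `|pos z' j|)%N.
  exists (K - j) => k kK; rewrite pos_shift; have := hK (j + k).
  have -> : j + k <= K by lia.
  move=> /(_ isT); move: (pos z' (j + k)) (pos z' j) => x y.
  by case: (b); rewrite /step; lia.
split=> [/(h _ (- i))|]; last exact: h.
by rewrite shift_by_add addNr shift_by0.
Qed.

Lemma drift_disjoint z : drift true z -> drift false z -> False.
Proof.
move=> /(_ 0%N)[K hK] /(_ 0%N)[L hL].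
have := hK (Num.min K L); have := hL (Num.min K L).
rewrite !ge_min !lexx orbT => /(_ isT) h1 /(_ isT); move: (pos _ _) h1.
by move=> x; rewrite /step; lia.
Qed.

Lemma drift_past b z z' : (forall l : int, l < 0 -> z l = z' l) ->
  drift b z -> drift b z'.
Proof.
move=> h hz m; have [K hK] := hz m; exists (Num.min K 0) => k.
rewrite le_min => /andP[kK k0]; rewrite -(@pos_ext _ z)//; first exact: hK.
by move=> l lk; apply: h; lia.
Qed.

Lemma record_shift b z i : record b (shift_by i z) <->
  forall k : int, k < i -> step b * pos z k < step b * pos z i.
Proof.
split=> h k k0.
  by have := h (k - i); rewrite pos_shift subrKC mulrBr !subr_lt0; apply.
by rewrite pos_shift mulrBr subr_lt0; apply: h; rewrite gtrDl.
Qed.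

(** Up to [K] the walk is below 0 in direction [b]; the first later time at which it is not is a
    record. *)
Lemma drift_record b z : drift b z -> exists i : int, record b (shift_by i z).
Proof.
move=> /(_ 0%N)[K hK].
have K0 : K < 0.
  by rewrite ltNge; apply/negP => /hK; rewrite pos0 mulr0 ltxx.
have ex : exists m : nat, 0 <= step b * pos z (K + m%:Z).
  by exists `|K|%N; rewrite (_ : K + _ = 0) ?pos0 ?mulr0//; lia.
have [m hm mmin] := ex_minnP ex.
exists (K + m%:Z); apply/record_shift => k km; apply: lt_le_trans hm.
have [/hK//|Kk] := leP k K.
rewrite ltNge; apply/negP => hk.
have := mmin `|k - K|%N; rewrite (_ : K + _ = k) => [/(_ hk)|]; lia.
Qed.

(** There is a last record if [c] is true, a first one if [c] is false. *)
Definition extremal_visit b c : set Omega := [set z : conf A |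
  exists i : int, record b (shift_by i z) /\
    forall j : int, 0 < step c * (j - i) -> ~ record b (shift_by j z)].

Lemma measurable_extremal_visit b c : measurable (extremal_visit b c).
Proof.
have mR i : measurable (shift i @^-1` record b).
  by apply: measurable_shift; exact: measurable_record.
apply: measurable_exists => i; apply: (measurableI (shift i @^-1` record b)) => //.
apply: measurable_forall => j; apply: measurable_imply.
exact: (measurableC (mR j)).
Qed.

Lemma pr_extremal_record b c : pr (extremal_visit b c) = 0.
Proof. by apply: pr_extremal_visit => //; exact: measurable_record. Qed.

(** Without a first record the records go back forever. Their heights are integers that decrease
    strictly into the past, and before a record the walk stays below it. *)
Lemma record_drift b z : record b z -> ~ extremal_visit b false z -> drift b z.
Proof.
move=> rz nz m.
have visit : exists i : int, record b (shift_by i z) /\ step b * pos z i <= - m%:Z.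
  elim: m => [|m [i [ri hi]]]; first by exists 0; rewrite shift_by0 pos0 mulr0.
  have : ~ forall j : int, 0 < step false * (j - i) -> ~ record b (shift_by j z).
    by move=> h; apply: nz; exists i.
  move=> /existsNP[j /not_implyP[ji /contrapT rj]]; exists j; split=> //.
  have ji' : j < i by move: ji; rewrite /step; lia.
  have /record_shift/(_ j ji') := ri.
  by move: (step b * pos z j) (step b * pos z i) hi => *; lia.
have [i [/record_shift ri hi]] := visit.
by exists (i - 1) => k ki; apply: lt_le_trans hi; apply: ri; lia.
Qed.

Lemma drift_records b z : drift b z -> ~ extremal_visit b true z ->
  forall (T : int) (m : nat), exists t : int,
    [/\ T <= t, record b (shift_by t z) & m%:Z <= step b * pos z t].
Proof.
move=> /drift_record[i0 r0] nz.
have next (i : int) : record b (shift_by i z) ->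
    exists j : int, [/\ i < j, record b (shift_by j z) &
                        step b * pos z i < step b * pos z j].
  move=> ri.
  have : ~ forall j : int, 0 < step true * (j - i) -> ~ record b (shift_by j z).
    by move=> h; apply: nz; exists i.
  move=> /existsNP[j /not_implyP[ji /contrapT rj]]; exists j.
  have ij : i < j by move: ji; rewrite /step; lia.
  by split=> //; apply: (record_shift b z j).1.
move=> T m.
have far (l : nat) : exists j : int, [/\ i0 + l%:Z <= j, record b (shift_by j z) &
    step b * pos z i0 + l%:Z <= step b * pos z j].
  elim: l => [|l [j [h1 h2 h3]]]; first by exists i0; rewrite !addr0.
  have [j' [jj' rj' h]] := next j h2; exists j'; split=> //; first by lia.
  by move: (step b * pos z j') (step b * pos z j) (step b * pos z i0) h h3 => *; lia.
have [j [h1 h2 h3]] := far (m + `|T| + `|i0| + `|(step b * pos z i0)%R|)%N.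
exists j; split=> //; first by lia.
by move: (step b * pos z j) (step b * pos z i0) h3 => *; lia.
Qed.

(** By the intermediate value property, a past that avoids 0 stays on one side of it. *)
Lemma new_site_record z : new_site z -> record true z \/ record false z.
Proof.
move=> hz; apply: contrapT => /not_orP[/existsNP[i /not_implyP[i0 hi]]].
move=> /existsNP[j /not_implyP[j0 hj]].
have {}hi : 0 <= pos z i.
  by move: hi; rewrite /step; move: (pos z i) => *; lia.
have {}hj : pos z j <= 0.
  by move: hj; rewrite /step; move: (pos z j) => *; lia.
have [ij|ji] := leP i j.
  have [|l il l0] := @pos_ivt _ z i j 0 ij; first by right; rewrite hi hj.
  by apply: (hz l) => //; lia.
have [|l il l0] := @pos_ivt _ z j i 0 (ltW ji); first by left; rewrite hi hj.
by apply: (hz l) => //; lia.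
Qed.

(** The rate of records equals the mean speed along the drift. Consider the distance of the walk
    below its running maximum: stationarity makes the net flow between consecutive distances
    constant. At distance 0 this flow is the rate of records; far away it is the mean step. *)
Lemma pr_drift_letter b :
  pr (record b `&` drift b) =
  pr (drift b `&` [set z | (z 0).1 = b]) - pr (drift b `&` [set z | (z 0).1 <> b]).
Proof.
pose S : set Omega := [set z : conf A | (z 0).1 = b].
have mS : measurable S.
  by apply: (@measurable_local _ _ 1) => z z' zz'; rewrite /S /= zz'.
have mD := measurable_drift b.
(* The distance below the running maximum, present included, is at most [m]. *)
pose Am (m : nat) : set Omega := drift b `&`
  [set z : conf A | forall k : int, k <= 0 -> step b * pos z k <= m%:Z].
have mA m : measurable (Am m).
  apply: measurableI => //; apply: measurable_forall => k; apply: measurable_imply.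
  exact: (measurable_pos k k (fun x _ => step b * x <= m%:Z)).
have mAS m : measurable (Am m `&` S) by exact: measurableI.
have mAD m : measurable (Am m `\` S) by exact: measurableD.
have pos1 z : pos z 1 = step (z 0).1 by rewrite -[1]add0r posS pos0 add0r.
have shA m z : Am m (shift_by 1 z) <-> drift b z /\
    (forall k : int, k <= 1 -> step b * pos z k <= m%:Z + step b * step (z 0).1).
  have e k : step b * pos (shift_by 1 z) k =
      step b * pos z (1 + k) - step b * step (z 0).1.
    by rewrite pos_shift pos1 mulrBr.
  split=> [[/drift_shift hd h]|[hd h]].
    split=> // k k1; have := h (k - 1); rewrite e subrKC !lerBlDr; apply; lia.
  split; first exact/drift_shift.
  by move=> k k0; rewrite e lerBlDr; apply: h; lia.
have stepS z : S z -> step b * step (z 0).1 = 1 by rewrite /S /= => ->; case: (b).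
have stepN z : ~ S z -> step b * step (z 0).1 = -1.
  by rewrite /S /=; case: (b); case: (z 0).1.
have shS m : (shift 1 @^-1` Am m) `&` S = Am m.+1 `&` S.
  apply/seteqP; split=> z [+ Sz].
    move=> /shA[hd h]; split=> //; split=> // k k0; have := h k.
    by rewrite stepS// intS addrC; apply; lia.
  move=> [hd h]; split=> //; apply/shA; split=> // k k1.
  rewrite stepS//; have [k0|->] : k <= 0 \/ k = 1 by lia.
    by have := h k k0; rewrite intS addrC.
  by rewrite pos1 stepS// lerDr.
have shN0 : (shift 1 @^-1` Am 0%N) `\` S = set0.
  rewrite -subset0 => z [/shA[_ /(_ 0 isT)] + nS].
  by rewrite stepN// pos0 mulr0.
have shN m : (shift 1 @^-1` Am m.+1) `\` S = Am m `\` S.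
  apply/seteqP; split=> z [+ nS].
    move=> /shA[hd h]; split=> //; split=> // k k0; have := h k.
    by rewrite stepN// intS addrAC subrr add0r; apply; lia.
  move=> [hd h]; split=> //; apply/shA; split=> // k k1.
  rewrite stepN// intS addrAC subrr add0r.
  have [k0|->] : k <= 0 \/ k = 1 by lia.
    exact: h.
  by rewrite pos1 stepN//; lia.
have split1 m : pr (Am m) = pr (Am m `\` S) + pr (Am m `&` S) by exact: prDI.
have split2 m : pr (Am m) =
    pr ((shift 1 @^-1` Am m) `\` S) + pr ((shift 1 @^-1` Am m) `&` S).
  rewrite -(prDI mu _ mS); last exact: measurable_shift.
  by rewrite pr_shift.
have flow m : pr (Am m.+1 `&` S) - pr (Am m `\` S) = pr (Am 0%N `&` S).
  elim: m => [|m IH].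
    have := split1 0%N; rewrite split2 shN0 pr0 shS; lra.
  by have := split1 m.+1; rewrite split2 shN shS; lra.
have cover (z : conf A) : drift b z -> exists m : nat, Am m z.
  move=> hd; have [K hK] := hd 0%N.
  have [M hM] : exists M : nat, forall l : nat, (l <= `|K|)%N ->
      step b * pos z (- l%:Z) <= M%:Z.
    exists (\max_(l < `|K|.+1) `|(step b * pos z (- l%:Z))%R|)%N => l lK.
    have := @leq_bigmax _ (fun l : 'I_(`|K|.+1) => `|(step b * pos z (- l%:Z))%R|%N)
      (Ordinal (n := `|K|.+1) (m := l) lK).
    by rewrite /=; move: (step b * pos z (- l%:Z)) (\max_(l < _) _)%N => x y; lia.
  exists M; split=> // k k0; have [/hK|kK] := leP k K.
    by move: (step b * pos z k) => *; lia.
  by have := hM `|k|%N; rewrite (_ : - `|k|%N%:Z = k); [apply|]; lia.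
have mono m m' : (m <= m')%N -> Am m `<=` Am m'.
  by move=> mm z [hd h]; split=> // k /h /le_trans; apply; lia.
(* One time unit earlier, a record means that the walk stands at its running maximum and that its
   next step goes along [b]. *)
have -> : pr (record b `&` drift b) = pr (Am 0%N `&` S).
  rewrite -(pr_shift inv 1); last by apply: measurableI => //; exact: measurable_record.
  congr (pr _); apply/seteqP; split=> z.
    move=> [/record_shift r /drift_shift hd].
    have Sz : S z.
      apply: contrapT => nS; have := r 0; rewrite pos0 mulr0 pos1 stepN//.
      by move=> /(_ isT).
    split=> //; split=> // k k0; have := r k; rewrite pos1 stepS//.
    by move: (step b * _) => x; lia.
  move=> [[hd h] Sz]; split; last exact/drift_shift.
  apply/record_shift => k k1; rewrite pos1 stepS//.
  have := h k; move: (step b * _) => x; lia.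
rewrite -[RHS]/(pr (drift b `&` S) - pr (drift b `\` S)).
have cS : \bigcup_m (Am m.+1 `&` S) = drift b `&` S.
  apply/seteqP; split=> [z [m _ [[hd _] Sz]]//|z [/cover[m Az] Sz]].
  by exists m => //; split=> //; apply: mono Az.
have cN : \bigcup_m (Am m `\` S) = drift b `\` S.
  apply/seteqP; split=> [z [m _ [[hd _] nS]]//|z [/cover[m Az] nS]].
  by exists m.
have close (e : R) : 0 < e -> exists m,
    [/\ pr (drift b `&` S) - e <= pr (Am m.+1 `&` S) <= pr (drift b `&` S) &
     pr (drift b `\` S) - e <= pr (Am m `\` S) <= pr (drift b `\` S)].
  move=> e0.
  have [K1 hK1] := pr_increasing mu (F := fun m => Am m.+1 `&` S)
    (fun m => mAS _) (fun i j ij => @setSI _ _ _ _ (mono i.+1 j.+1 ij)) e0.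
  have [K2 hK2] := pr_increasing mu (F := fun m => Am m `\` S)
    (fun m => mAD _) (fun i j ij => @setSD _ _ _ _ (mono i j ij)) e0.
  rewrite cS in hK1; rewrite cN in hK2.
  exists (maxn K1 K2); rewrite hK1 ?leq_maxl// hK2 ?leq_maxr//=; split.
    by apply: le_pr; [exact: mAS|exact: measurableI|move=> z [[]]].
  by apply: le_pr; [exact: mAD|exact: measurableD|move=> z [[]]].
apply/eqP; rewrite eq_le; apply/andP; split; apply/ler_addgt0Pl => e e0.
  have [m [/andP[h1 h2] /andP[h3 h4]]] := close e e0.
  by rewrite -(flow m); lra.
have [m [/andP[h1 h2] /andP[h3 h4]]] := close e e0.
by rewrite -(flow m); lra.
Qed.

End Drift.

(** * Approximation of events of the past *)

Section PastApproximation.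
Context {A : pointedType} {R : realType}.
Variable mu : probability (borel (conf A)) R.
Local Notation pr := (prob mu).
Local Notation Omega := (borel (conf A)).

Definition past_only (z : conf A) : conf A := fun l => if l < 0 then z l else point.

Lemma measurable_past_only :
  measurable_fun [set: Omega] (past_only : Omega -> Omega).
Proof.
move=> _ W mW; rewrite setTI; apply: measurable_preimage_conf mW => K.
by exists K => z z' zz' i iK; rewrite /past_only zz'.
Qed.

Definition past_event (G : set Omega) :=
  measurable G /\ depends_on [set l | l < 0] G.

(** Approximate [G] under the image of [mu] by [past_only]. The pulled back local set reads negative
    coordinates only, and [G] is its own preimage. *)
Lemma approx_past (G : set Omega) (e : R) : past_event G -> 0 < e ->
  exists (k : nat) (W : set Omega), depends_on [set l | - k%:Z <= l < 0] W /\
    pr ((G `\` W) `|` (W `\` G)) <= e.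
Proof.
move=> [mG pG] e0.
pose f : {mfun Omega >-> Omega} := mfun_Sub (mem_set measurable_past_only).
have [K [W [hW hpr]]] := approx_local (distribution mu f) mG e0.
exists K, (past_only @^-1` W); split.
  move=> z z' zz'; apply: hW => i iK; rewrite /past_only.
  by case: ifP => // i0; apply: zz'; move: iK i0; rewrite /centered /=; lia.
have GE : past_only @^-1` G = G.
  apply/seteqP; split=> z; apply: pG => i /= i0; by rewrite /past_only i0.
rewrite (_ : _ `|` _ = past_only @^-1` ((G `\` W) `|` (W `\` G)))//.
have GEz z : G (past_only z) = G z := congr1 (@^~ z) GE.
apply/seteqP; split=> z [[h1 h2]|[h1 h2]].
- by left; split=> //; rewrite /= GEz.
- by right; split=> //; rewrite /= GEz.
- by left; split=> //; rewrite -GEz.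
- by right; split=> //; rewrite -GEz.
Qed.

End PastApproximation.

(** * Existence of the drift *)

Section DriftDichotomy.
Context {n : nat} {R : realType}.
Local Notation A := (bool * 'I_n.+1)%type.
Local Notation X := (kalikow_subshift [set: conf 'I_n.+1]).
Local Notation N := (n.+1%:R : R).
Local Notation growth := (@growth_rate n R).
Local Notation Omega := (borel (conf A)).
Variable mu : probability Omega R.
Hypothesis mme : maximal_entropy_measure X mu.
Local Notation pr := (prob mu).
Local Notation D := (@drift n).
Implicit Types (z : conf A).

Let inv := mme_inv mme.

Lemma measurable_step_event (b : bool) :
  measurable ([set z : conf A | (z 0).1 = b] : set Omega).
Proof. by apply: (@measurable_local _ _ 1) => z z' zz' /=; rewrite zz'. Qed.

Lemma measurable_determined k (T : Type) (g : conf A -> T) (Q : T -> A -> Prop) :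
  past_determined k g -> measurable ([set z : conf A | Q (g z) (z 0)] : set Omega).
Proof.
move=> hg; apply: (@measurable_local _ _ k.+1) => z z' zz' /=.
rewrite (hg z z') ?zz'// => l lk; apply: zz'; rewrite /centered /=; lia.
Qed.

Lemma past_drift b : past_event (D b).
Proof.
split; first exact: measurable_drift.
by move=> z z'; apply: drift_past.
Qed.

Lemma pr_record_not_drift b : pr (@record n b `\` D b) = 0.
Proof.
have mE := @measurable_record n b; have mD := @measurable_drift n b.
apply: (pr_eq0S (B := @extremal_visit n b false)).
- exact: measurableD.
- exact: measurable_extremal_visit.
- by move=> z [rz nd]; apply: contrapT => /(record_drift rz).
- exact: (pr_extremal_record inv).
Qed.

Lemma pr_new_site_le : pr (@new_site n) <=
  pr (@record n true `&` D true) + pr (@record n false `&` D false).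
Proof.
have mR b := @measurable_record n b; have mD b := @measurable_drift n b.
have mRD b : measurable (@record n b `&` D b) by exact: measurableI.
have mRN b : measurable (@record n b `\` D b) by exact: measurableD.
have hE : pr (@record n true `|` @record n false) <=
    pr (@record n true) + pr (@record n false) by exact: pr_leU.
have : pr (@new_site n) <= pr (@record n true `|` @record n false).
  apply: le_pr; [exact: measurable_new_site|exact: measurableU|].
  by move=> z /new_site_record[]; [left|right].
have := prDI mu (mR true) (mD true); have := prDI mu (mR false) (mD false).
rewrite !pr_record_not_drift; lra.
Qed.

Definition gap : R := ln growth - ln 2.

Lemma gap_ge0 : 0 <= gap.
Proof.
by rewrite subr_ge0 ler_ln ?posrE ?growth_gt0//; exact: growth_ge2.
Qed.

Lemma lnN_ge0 : 0 <= ln N. Proof. by rewrite ln_ge0// ler1n. Qed.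

Lemma pr_new_in_limit (e : R) : 0 < e -> exists K, forall k, (K <= k)%N ->
  pr [set z | new_in k z] <= pr (@new_site n) + e.
Proof.
move=> e0; pose F k : set Omega := [set z : conf A | new_in k z].
have mF k : measurable (F k).
  rewrite /F; apply: (@measurable_determined k _ (@new_in n k) (fun x _ => x)).
  by move=> z z'; exact: eq_new_in.
have dF i j : (i <= j)%N -> F j `<=` F i.
  move=> ij z /asboolP h; apply/asboolP => l li; apply: h; lia.
have [K hK] := pr_decreasing mu mF dF e0.
exists K => k /hK; rewrite (_ : \bigcap_i F i = @new_site n)//.
apply/seteqP; split=> z h.
  by move=> l l0; have /asboolP := h `|l|%N Logic.I; apply; lia.
by move=> k' _; apply/asboolP => l /andP[_]; exact: h.
Qed.

(** The guess tests local approximations [W1], [W2] of the two drift events and is right outside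
    [bad], of mass at most [2 * e]. In [5 * ln N], one error comes from [new_in] and two each from
    right and wrong guesses; [2 * gap] comes from the points without guess. *)
Lemma good_predictor (e : R) : 0 < e ->
  exists (K : nat) (g : conf A -> option bool), [/\ past_determined K g,
    forall b, pr (D b `&` [set z | g z <> Some b]) <= e + e &
    forall k, (K <= k)%N -> divergence_bound mu k g <=
      (5 * ln N + 2 * gap) * e - gap * pr (~` (D true `|` D false))].
Proof.
move=> e0; have mD b := @measurable_drift n b.
have [K0 hK0] := pr_new_in_limit e0.
have [k1 [W1 [hW1 p1]]] := approx_past mu (past_drift true) e0.
have [k2 [W2 [hW2 p2]]] := approx_past mu (past_drift false) e0.
pose g z : option bool := if `[< W1 z >] then Some true
  else if `[< W2 z >] then Some false else None.
pose K := maxn K0 (maxn k1 k2).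
have detW k (W : set Omega) z z' : (k <= K)%N -> depends_on [set l | - k%:Z <= l < 0] W ->
    (forall l : int, - K%:Z <= l < 0 -> z l = z' l) -> W z <-> W z'.
  move=> kK hW zz'; split; apply: hW => l /= lk; rewrite zz'//; lia.
have hg k : (K <= k)%N -> past_determined k g.
  move=> Kk z z' zz'.
  have zzK (l : int) : - K%:Z <= l < 0 -> z l = z' l by move=> lK; apply: zz'; lia.
  have e1 : `[< W1 z >] = `[< W1 z' >].
    by apply: asbool_equiv_eq; apply: detW hW1 zzK; rewrite /K; lia.
  have e2 : `[< W2 z >] = `[< W2 z' >].
    by apply: asbool_equiv_eq; apply: detW hW2 zzK; rewrite /K; lia.
  by rewrite /g e1 e2.
pose bad : set Omega := ((D true `\` W1) `|` (W1 `\` D true)) `|`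
  ((D false `\` W2) `|` (W2 `\` D false)).
have mW1 : measurable W1 by exact: measurable_depends hW1.
have mW2 : measurable W2 by exact: measurable_depends hW2.
have mY (B1 B2 : set Omega) : measurable B1 -> measurable B2 ->
    measurable ((B1 `\` B2) `|` (B2 `\` B1)).
  by move=> m1 m2; apply: measurableU; exact: measurableD.
have mbad : measurable bad by apply: measurableU; exact: mY.
have pbad : pr bad <= e + e.
  by apply: le_trans (lerD p1 p2); apply: pr_leU; exact: mY.
have good z : ~ bad z -> [/\ D true z -> g z = Some true,
    D false z -> g z = Some false & ~ (D true `|` D false) z -> g z = None].
  move=> nb.
  have h1 : W1 z <-> D true z.
    by split=> h; apply: contrapT => h'; apply: nb; left; [right|left].
  have h2 : W2 z <-> D false z.
    by split=> h; apply: contrapT => h'; apply: nb; right; [right|left].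
  rewrite /g; split.
  - by move=> /h1 ?; rewrite asboolT.
  - move=> d2; rewrite asboolF ?asboolT//; first exact/h2.
    by move=> /h1 d1; exact: drift_disjoint d1 d2.
  - move=> nd; rewrite asboolF ?asboolF//.
      by move=> /h2 ?; apply: nd; right.
    by move=> /h1 ?; apply: nd; left.
exists K, g; split; first exact: hg.
  move=> b; apply: le_trans pbad; apply: le_pr => //.
    apply: measurableI => //.
    by apply: (@measurable_determined K _ g (fun x _ => x <> Some b)); exact: hg.
  move=> z [Db /= gz]; apply: contrapT => /good[h1 h2 _].
  by case: b Db gz => [/h1|/h2].
move=> k Kk; have hgk := hg k Kk.
pose S b : set Omega := [set z : conf A | (z 0).1 = b].
pose S' b : set Omega := [set z : conf A | (z 0).1 <> b].
have mS b : measurable (S b) by exact: measurable_step_event.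
have mS' b : measurable (S' b) by exact: measurableC (measurable_step_event b).
have mDS b : measurable (D b `&` S b) by exact: measurableI.
have mDS' b : measurable (D b `&` S' b) by exact: measurableI.
have mG1 : measurable ([set z : conf A | g z = Some (z 0).1] : set Omega).
  by apply: (@measurable_determined k _ g (fun x s => x = Some s.1)).
have mG2 : measurable ([set z : conf A | g z = Some (~~ (z 0).1)] : set Omega).
  by apply: (@measurable_determined k _ g (fun x s => x = Some (~~ s.1))).
have mG3 : measurable ([set z : conf A | g z = None] : set Omega).
  by apply: (@measurable_determined k _ g (fun x s => x = None)).
have i1 : pr (D true `&` S true) + pr (D false `&` S false) <=
    pr [set z | g z = Some (z 0).1] + (e + e).
  rewrite -prU//; last first.
    by rewrite -subset0 => z [[d1 _] [d2 _]]; exact: drift_disjoint d1 d2.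
  apply: (@le_trans _ _ (pr [set z | g z = Some (z 0).1] + pr bad)); last by rewrite lerD2l.
  apply: le_prU => //; first exact: measurableU.
  move=> z h; have [bz|/good[h1 h2 _]] := pselect (bad z); first by right.
  by left; case: h => -[d s] /=; rewrite s; [exact: h1|exact: h2].
have i2 : pr [set z | g z = Some (~~ (z 0).1)] <=
    pr (D true `&` S' true) + pr (D false `&` S' false) + (e + e).
  apply: (@le_trans _ _ (pr ((D true `&` S' true) `|` (D false `&` S' false)) + pr bad)).
    apply: le_prU => //; first exact: measurableU.
    move=> z /= h; have [bz|/good[h1 h2 h3]] := pselect (bad z); first by right.
    left; have [d1|nd1] := pselect (D true z).
      left; split=> //; move: h; rewrite h1// => -[] h.
      by rewrite /S' /= => h'; rewrite h' in h.
    have [d2|nd2] := pselect (D false z).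
      right; split=> //; move: h; rewrite h2// => -[] h.
      by rewrite /S' /= => h'; rewrite h' in h.
    by move: h; rewrite h3// => -[].
  by rewrite lerD//; exact: pr_leU.
have i3 : pr (~` (D true `|` D false)) <= pr [set z | g z = None] + (e + e).
  apply: (@le_trans _ _ (pr [set z | g z = None] + pr bad)); last by rewrite lerD2l.
  apply: le_prU => //; first by apply: measurableC; exact: measurableU.
  move=> z h; have [bz|/good[_ _ h3]] := pselect (bad z); first by right.
  by left; exact: h3.
have i0 := hK0 k (leq_trans (leq_maxl _ _) Kk).
have i4 := pr_new_site_le.
have l1 := pr_drift_letter inv true; have l2 := pr_drift_letter inv false.
rewrite /divergence_bound -/gap.
have a1 : pr [set z | new_in k z] - pr [set z | g z = Some (z 0).1] +
    pr [set z | g z = Some (~~ (z 0).1)] <= 5 * e.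
  by move: i0 i1 i2 i4 l1 l2; rewrite /S /S'; lra.
have := ler_wpM2l lnN_ge0 a1; have := ler_wpM2l gap_ge0 i3.
by lra.
Qed.

Lemma divergence_bound_ge0 k g : past_determined k g -> 0 <= divergence_bound mu k g.
Proof.
move=> hg; apply: le_trans (divergence_past_le mme hg).
apply: divergence_ge0; [by move=> p; exact: pr_ge0|exact: predicted_dist_ge0| |].
  exact: predicted_dist_gt0.
by rewrite sum_predicted_dist sum_past_dist.
Qed.

Lemma gap_gt0 : (0 < n)%N -> 0 < gap.
Proof.
move=> n0; rewrite subr_gt0 ltr_ln ?posrE ?growth_gt0//.
have N2 : 2 <= N by rewrite ler_nat.
have N0 : 0 < N^-1 by rewrite invr_gt0 ltr0n.
by rewrite /growth_rate; move: (N) N2 N0 => x; lra.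
Qed.

(** As the divergence is nonnegative, [gap] times this probability is at most the error of the
    predictor; [gap] is positive because N > 1. *)
Lemma pr_drift : (0 < n)%N -> pr (~` (D true `|` D false)) = 0.
Proof.
move=> /gap_gt0 g0; apply/le_anti; rewrite pr_ge0 andbT.
apply/ler_addgt0Pl => e e0; rewrite addr0.
pose C := 5 * ln N + 2 * gap; have C0 : 0 < C.
  by have := lnN_ge0; rewrite /C; move: g0; lra.
have r0 : 0 < e * gap / C by rewrite divr_gt0// mulr_gt0.
have [K [g [hg _ h]]] := good_predictor r0.
have := le_trans (divergence_bound_ge0 hg) (h K (leqnn K)).
by rewrite -/C mulrCA divff ?gt_eqF// mulr1 subr_ge0 [e * _]mulrC ler_pM2l.
Qed.

(* For one letter the scenery is trivial, and no drift is needed. *)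
Definition phase b : set Omega := if n == 0%N then setT else D b.

Lemma phase_predictor b (e : R) : 0 < e ->
  exists (K : nat) (g : conf A -> option bool), [/\ past_determined K g,
    pr (phase b `&` [set z | g z <> Some b]) <= e &
    forall k, (K <= k)%N -> past_determined k g /\ divergence_bound mu k g <= e].
Proof.
move=> e0; case: (posnP n) => n0.
  exists 0%N, (fun=> Some b).
  have E0 : [set z : conf A | Some b <> Some b] = set0.
    by rewrite -subset0 => z /=.
  split=> //; first by rewrite E0 setI0 pr0 ltW.
  move=> k _; split=> //; rewrite /divergence_bound -/gap.
  have N1 : N = 1 by rewrite n0.
  have g0 : gap = 0 by rewrite /gap /growth_rate N1 invr1 subrr.
  by rewrite g0 N1 ln1 !mul0r subr0 ltW.
(* With [C >= 2], the mass [2 * (e / C)] of the wrong guesses is at most [e]. *)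
pose C := 5 * ln N + 2 * gap + 2; have C0 : 2 <= C.
  by have := lnN_ge0; have := gap_ge0; rewrite /C; lra.
have C1 : 0 < C by lra.
have r0 : 0 < e / C by rewrite divr_gt0.
have [K [g [hg h1 h2]]] := good_predictor r0; exists K, g.
have re : e / C + e / C <= e.
  have : C * (e / C) = e by rewrite mulrCA divff ?gt_eqF// mulr1.
  by have := ler_wpM2r (ltW r0) C0; lra.
split=> //.
  by rewrite /phase eqn0Ngt n0; exact: le_trans (h1 b) re.
move=> k Kk; split.
  by move=> z z' zz'; apply: hg => l lK; apply: zz'; lia.
apply: le_trans (h2 k Kk) _; rewrite pr_drift// mulr0 subr0.
have : C * (e / C) = e by rewrite mulrCA divff ?gt_eqF// mulr1.
have := ltW r0; move: (e / C) => r; rewrite /C; lra.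
Qed.

End DriftDichotomy.

(** * Law of the future given the past *)

Section OneStepLaw.
Context {n : nat} {R : realType}.
Local Notation A := (bool * 'I_n.+1)%type.
Local Notation X := (kalikow_subshift [set: conf 'I_n.+1]).
Local Notation N := (n.+1%:R : R).
Local Notation growth := (@growth_rate n R).
Local Notation Omega := (borel (conf A)).
Variable mu : probability Omega R.
Hypothesis mme : maximal_entropy_measure X mu.
Local Notation pr := (prob mu).
Implicit Types (z : conf A).

Let inv := mme_inv mme.

Lemma sum_window_event k (F : conf A -> bool) : past_determined k F ->
  \sum_(u : k.-tuple A) pr (window (- k%:Z) k @^-1` [set u]) *
    (F (extend (- k%:Z) u))%:R = pr [set z | F z].
Proof.
move=> hF; rewrite (_ : [set z | F z] =
    [set z | (fun u => F (extend (- k%:Z) u)) (window (- k%:Z) k z)]).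
  rewrite (pr_simple _ (fun u : k.-tuple A => F (extend (- k%:Z) u))); last first.
    exact: simple_window.
  rewrite [RHS]big_mkcond; apply: eq_bigr => p _; rewrite asboolb.
  by case: ifP; rewrite ?mulr1 ?mulr0.
have e z : F (extend (- k%:Z) (window (- k%:Z) k z)) = F z.
  by apply: hF => l lk; rewrite extend_window//; lia.
by apply/seteqP; split=> z /=; rewrite e.
Qed.

Lemma predict_le1 k g z (s : A) : predict k g z s <= 1 :> R.
Proof.
rewrite -(sum_predict (R := R) k g z) (bigD1 s)//= lerDl.
by apply: sumr_ge0 => t _; exact: predict_ge0.
Qed.

Lemma predict_past k g (s : A) : past_determined k g ->
  past_determined k (fun z => predict k g z s : R).
Proof.
move=> hg z z' zz'; rewrite /predict (hg _ _ zz') /label_prob -(eq_new_in zz').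
by have [//|nz] := boolP (new_in k z); rewrite (eq_old_label zz' nz).
Qed.

(** The predicted probability of [s] under drift [b], where [v] tells whether the site is new. At an
    old site it refers to the one legal label; the laws below assume that [s] is legal. *)
Definition transition (b : bool) (s : A) (v : bool) : R :=
  @step_prob n R (Some b) s.1 * (if v then N^-1 else 1).

Lemma transition_ge0 b s v : 0 <= transition b s v.
Proof.
rewrite mulr_ge0 ?(ltW (@step_prob_gt0 n R _ _))//.
by case: v; rewrite ?ler01// invr_ge0 ler0n.
Qed.

Lemma transition_le1 b s v : transition b s v <= 1.
Proof.
have N1 : 1 <= N by rewrite ler1n.
have N0 : 0 < N^-1 by rewrite invr_gt0 ltr0n.
have Ni : N^-1 <= 1 by rewrite invf_le1// ltr0n.
apply: mulr_ile1; [exact/ltW/step_prob_gt0|by case: v; rewrite ?ler01// ltW| |].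
  rewrite /step_prob ler_pdivrMr ?growth_gt0// mul1r /growth_rate.
  by case: ifP => _; [rewrite lerDl ltW|rewrite lerDr ler0n].
by case: v.
Qed.

Lemma determined_le k k' (T : Type) (g : conf A -> T) : (k <= k')%N ->
  past_determined k g -> past_determined k' g.
Proof. by move=> kk h z z' zz'; apply: h => l lk; apply: zz'; lia. Qed.

(** Replace [G] by an event [W] of a finite past. There the letter follows the prediction up to a
    small total variation, and the prediction is the constant [c] up to a small set. *)
Lemma one_step_law b (G : set Omega) (s : A) (v : bool) :
  past_event G -> G `<=` phase b ->
  (forall z, G z -> legal_on [set l | l <= 0] (put 0 s z)) ->
  (forall z, G z -> `[< new_site z >] = v) ->
  pr (G `&` [set z | z 0 = s]) = transition b s v * pr G.
Proof.
move=> [mG pG] Gb Gl Gv; set c := transition b s v.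
have c0 : 0 <= c := transition_ge0 b s v.
have c1 : c <= 1 := transition_le1 b s v.
have mS : measurable ([set z : conf A | z 0 = s] : set Omega).
  exact: (@simple_letter n 0 s).
suff close (e : R) : 0 < e ->
    `|pr (G `&` [set z | z 0 = s]) - c * pr G| <= 9 * e.
  apply/eqP; rewrite -subr_eq0 -normr_le0; apply/ler_addgt0Pl => e e0.
  by rewrite addr0; have := close (e / 9) (divr_gt0 e0 (ltr0n _ 9)); lra.
move=> e0.
(* The bound [e * e] on the divergence gives total variation at most [3 * e]; the bound [e] is for
   the guess of the direction. *)
have r0 : 0 < Num.min e (e * e) by rewrite lt_min e0 mulr_gt0.
have [K1 [g [hg pg hK1]]] := phase_predictor mme b r0.
have [K2 hK2] := pr_new_in_limit mu e0.
have [K3 [W [hW pW]]] := approx_past mu (conj mG pG) e0.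
pose k := maxn K1 (maxn K2 K3).
have [hgk dk] := hK1 k (leq_maxl _ _).
have mW : measurable W by exact: measurable_depends hW.
pose w z := `[< W z >].
have hw : past_determined k w.
  have hw3 : past_determined K3 w.
    by move=> z z' zz'; apply: asbool_equiv_eq; split; apply: hW => l /zz'.
  by apply: determined_le hw3; rewrite /k; lia.
have mw : measurable ([set z | w z] : set Omega).
  by rewrite (_ : [set z | w z] = W)//; apply/seteqP; split=> z /asboolP.
have wW : [set z | w z] = W by apply/seteqP; split=> z /asboolP.
pose q z : R := predict k g z s.
have hq : past_determined k q by exact: predict_past.
pose bad z := w z && (q z != c).
have hbad : past_determined k bad.
  by move=> z z' zz'; rewrite /bad (hw _ _ zz') (hq _ _ zz').
have mnew : measurable ([set z | new_in k z] : set Omega).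
  apply: (@measurable_determined n k _ (@new_in n k) (fun x _ => x)).
  by move=> z z'; exact: eq_new_in.
have mN := @measurable_new_site n.
have newS : @new_site n `<=` [set z | new_in k z].
  by move=> z h; apply/asboolP => i /andP[_]; exact: h.
have pnew : pr ([set z | new_in k z] `\` @new_site n) <= e.
  have := prDI mu mnew mN; rewrite setIidr//.
  by have := hK2 k (leq_trans (leq_maxl _ _) (leq_maxr _ _)); lra.
pose stale : set Omega := [set z : conf A | new_in k z] `\` @new_site n.
pose offphase : set Omega := phase b `&` [set z | g z <> Some b].
have mphase : measurable (phase b : set Omega).
  by rewrite /phase; case: ifP => // _; exact: measurable_drift.
have moff : measurable offphase.
  apply: measurableI => //.
  exact: (@measurable_determined n k _ g (fun x _ => x <> Some b)).
have mbad : measurable ([set z | bad z] : set Omega).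
  exact: (@measurable_determined n k _ bad (fun x _ => x)).
(* On [G] the prediction can differ from [c] only if the direction is guessed wrongly or if a site
   that is new in the window was visited before it. *)
have badS : [set z | bad z] `<=` (W `\` G) `|`
    (offphase `|` stale).
  move=> z /andP[/asboolP Wz /eqP qc].
  have [Gz|nG] := pselect (G z); last by left.
  right; have [gz|gz] := eqVneq (g z) (Some b); last first.
    by left; split; [exact: Gb|apply/eqP].
  right; apply: contrapT => h; apply: qc.
  rewrite /q /predict gz /c /transition; congr (_ * _); rewrite /label_prob.
  have := Gv z Gz; case: asboolP => hn <-.
    by rewrite ifT//; exact: newS.
  have nn : ~~ new_in k z by apply/negP => hk; apply: h.
  rewrite (negPf nn); have zp (l : int) : - k%:Z <= l < 0 -> z l = put 0 s z l.
    by move=> lk; rewrite put_neq//; lia.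
  rewrite (eq_old_label zp nn) -(old_label_legal (Gl z Gz))//.
  - by rewrite putE eqxx.
  - by move=> l /= /andP[].
  - by rewrite -(eq_new_in zp).
have mWG : measurable (W `\` G) by exact: measurableD.
have mGW : measurable (G `\` W) by exact: measurableD.
have pWG : pr (W `\` G) <= e.
  by apply: le_trans pW; apply: (le_pr mu mWG (measurableU _ _ mGW mWG)) => z; right.
have pGW : pr (G `\` W) <= e.
  by apply: le_trans pW; apply: (le_pr mu mGW (measurableU _ _ mGW mWG)) => z; left.
have mnN : measurable stale by exact: measurableD.
have pbad : pr [set z | bad z] <= 3 * e.
  have h1 : pr [set z | bad z] <= pr (W `\` G) +
      pr (offphase `|` stale).
    by apply: (le_prU mu mbad mWG _ badS); exact: measurableU.
  have h2 := pr_leU mu moff mnN.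
  have : pr offphase <= e by apply: le_trans pg _; rewrite ge_min lexx.
  lra.
have diffW : `|pr (W `&` [set z | z 0 = s]) - c * pr W| <= 6 * e.
  pose F z (t : A) := w z && (t == s).
  pose E := @extend n (- k%:Z) k.
  pose Fp (p : k.-tuple A * A) : R := (F (E p.1) p.2)%:R.
  have P0 (p : k.-tuple A * A) : 0 <= past_dist mu p by exact: pr_ge0.
  have e1 : \sum_(p : k.-tuple A * A) past_dist mu p * Fp p = pr (W `&` [set z | z 0 = s]).
    rewrite (sum_past_dist_event mu (k := k) (F := F)).
      congr (pr _); apply/seteqP; split=> z /=.
        by move=> /andP[/asboolP ? /eqP].
      by move=> [Wz ->]; rewrite /F eqxx andbT; exact/asboolP.
    by move=> t z z' zz'; rewrite /F (hw _ _ zz').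
  pose pu (u : k.-tuple A) := pr (window (- k%:Z) k @^-1` [set u]).
  have e2 : \sum_(p : k.-tuple A * A) predicted_dist mu g p * Fp p =
      \sum_u pu u * q (E u) * (w (E u))%:R.
    rewrite -(pair_bigA _
      (fun (u : k.-tuple A) t => predicted_dist mu g (u, t) * Fp (u, t))) /=.
    apply: eq_bigr => u _; rewrite (bigD1 s)//= big1 ?addr0 => [|t ts].
      by rewrite /Fp /F /= eqxx andbT.
    by rewrite /Fp /F /= (negPf ts) andbF mulr0.
  have e3 : \sum_u pu u * (w (E u))%:R = pr W by rewrite sum_window_event// wW.
  have TV : \sum_(p : k.-tuple A * A) `|past_dist mu p - predicted_dist mu g p| <= 3 * e.
    apply: le_trans (total_variation_le P0 (@predicted_dist_ge0 _ _ mu k g)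
      (fun p => predicted_dist_gt0 mme g (p := p)) e0 (sum_past_dist mu k)
      (sum_predicted_dist mu k g)) _.
    have h1 := le_trans (divergence_past_le mme hgk) dk.
    have h2 : Num.min e (e * e) <= e * e by rewrite ge_min lexx orbT.
    have h3 := le_trans h1 h2.
    have e2' : 0 < 2 * e by lra.
    have : (\sum_(p : k.-tuple A * A) past_dist mu p * (ln (past_dist mu p) -
        ln (predicted_dist mu g p))) / (2 * e) <= e.
      by rewrite ler_pdivrMr//; apply: le_trans h3 _; rewrite mulrCA ler_pMl ?mulr_gt0//; lra.
    lra.
  have d1 : `|\sum_(p : k.-tuple A * A) past_dist mu p * Fp p -
      \sum_(p : k.-tuple A * A) predicted_dist mu g p * Fp p| <= 3 * e.
    apply: le_trans TV; rewrite -sumrB; apply: le_trans (ler_norm_sum _ _ _) _.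
    apply: ler_sum => p _; rewrite -mulrBl normrM /Fp.
    by case: (F _ _); rewrite ?normr1 ?mulr1// normr0 mulr0.
  have d2 : `|\sum_u pu u * q (E u) * (w (E u))%:R - c * pr W| <= 3 * e.
    apply: le_trans pbad; rewrite -(sum_window_event hbad) -e3 mulr_sumr -sumrB.
    apply: le_trans (ler_norm_sum _ _ _) _; apply: ler_sum => u _.
    have -> : pu u * q (E u) * (w (E u))%:R - c * (pu u * (w (E u))%:R) =
      pu u * ((q (E u) - c) * (w (E u))%:R) by ring.
    rewrite normrM (ger0_norm (pr_ge0 _ _)) ler_wpM2l ?pr_ge0// /bad -/(E u).
    case: (w _) => /=; last by rewrite mulr0 normr0.
    rewrite mulr1; case: eqP => [->|_] /=; first by rewrite subrr normr0.
    have q0 : 0 <= q (E u) by exact: predict_ge0.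
    have q1 : q (E u) <= 1 by exact: predict_le1.
    by rewrite ler_norml; lra.
  rewrite e2 in d1; rewrite -e1; apply: le_trans (ler_distD _ _ _) _.
  by apply: le_trans (lerD d1 d2) _; lra.
have mGS : measurable (G `&` [set z | z 0 = s]) by exact: measurableI.
have mWS : measurable (W `&` [set z | z 0 = s]) by exact: measurableI.
have b1 : pr (G `&` [set z | z 0 = s]) <= pr (W `&` [set z | z 0 = s]) + pr (G `\` W).
  apply: le_prU => // z [Gz zs]; have [Wz|nW] := pselect (W z); first by left.
  by right.
have b2 : pr (W `&` [set z | z 0 = s]) <= pr (G `&` [set z | z 0 = s]) + pr (W `\` G).
  apply: le_prU => // z [Gz zs]; have [Wz|nW] := pselect (G z); first by left.
  by right.
have b3 : pr G <= pr W + pr (G `\` W).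
  apply: le_prU => // z Gz; have [Wz|nW] := pselect (W z); first by left.
  by right.
have b4 : pr W <= pr G + pr (W `\` G).
  apply: le_prU => // z Gz; have [Wz|nW] := pselect (G z); first by left.
  by right.
have b5 : `|c * pr W - c * pr G| <= e.
  rewrite -mulrBr normrM (ger0_norm c0).
  apply: (@le_trans _ _ (1 * `|pr W - pr G|)); first by rewrite ler_wpM2r.
  by rewrite mul1r ler_norml; lra.
move: diffW b5; rewrite !ler_norml; move: (c * pr W) (c * pr G) => x y; lra.
Qed.

End OneStepLaw.

(** * From one letter to words *)

Section WordLaw.
Context {n : nat} {R : realType}.
Local Notation A := (bool * 'I_n.+1)%type.
Local Notation X := (kalikow_subshift [set: conf 'I_n.+1]).
Local Notation N := (n.+1%:R : R).
Local Notation growth := (@growth_rate n R).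
Local Notation Omega := (borel (conf A)).
Implicit Types (z : conf A) (w : seq A) (s : A) (t l : nat).

Definition new_at (t : int) : set Omega :=
  [set z : conf A | forall k : int, k < t -> pos z k <> pos z t].

Lemma new_at_shift t z : new_site (shift_by t%:Z z) <-> new_at t%:Z z.
Proof.
split=> h k kt.
  have := h (k - t%:Z); rewrite pos_shift subrKC subr_lt0 => /(_ kt) h1 e.
  by apply: h1; rewrite e subrr.
by rewrite pos_shift => /eqP; rewrite subr_eq0 => /eqP; apply: h; rewrite gtrDl.
Qed.

Lemma measurable_new_at t : measurable (new_at t).
Proof.
rewrite (_ : new_at t = (shift_by t%:Z : Omega -> Omega) @^-1` (@new_site n)).
  by apply: measurable_shift; exact: measurable_new_site.
by apply/seteqP; split=> z /new_at_shift.
Qed.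

Lemma eq_pos_below (T : int) z z' : (forall l : int, l < T -> z l = z' l) -> 0 <= T ->
  forall k : int, k <= T -> pos z k = pos z' k.
Proof. by move=> h T0 k kT; apply: pos_ext => m mk; apply: h; lia. Qed.

Lemma eq_new_at t z z' : (forall l : int, l < t%:Z -> z l = z' l) ->
  `[< new_at t%:Z z >] = `[< new_at t%:Z z' >].
Proof.
move=> h; have e := eq_pos_below h.
by apply: asbool_equiv_eq; split=> hz k kt; have := hz k kt; rewrite !e//; lia.
Qed.

Lemma legal_on_ext (T : int) z z' : 0 <= T -> (forall l : int, l < T -> z l = z' l) ->
  legal_on [set l | l < T] z -> legal_on [set l | l < T] z'.
Proof.
move=> T0 h hz i j /= iT jT; have e := eq_pos_below h T0.
by rewrite -!e ?ltW// -!h//; exact: hz.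
Qed.

Lemma legal_on_shift (I : set int) z k : legal_on [set i | I (i - k)] z ->
  legal_on I (shift_by k z).
Proof.
move=> h i j Ii Ij; rewrite !pos_shift => /eqP; rewrite (inj_eq (addIr _)) => /eqP.
by rewrite /shift_by ![k + _]addrC; apply: h; rewrite /= addrK.
Qed.

Lemma put_shift (s : A) z (t : int) :
  put 0 s (shift_by t z) = shift_by t (put t s z).
Proof.
apply/funext => l; rewrite /put /shift_by.
by case: eqP => [->|h]; case: eqP => // h'; [rewrite add0r in h'|lia].
Qed.

Section Law.
Variable mu : probability Omega R.
Hypothesis mme : maximal_entropy_measure X mu.
Local Notation pr := (prob mu).
Variable b : bool.

Let inv := mme_inv mme.

Lemma phase_shift z (i : int) : phase b (shift_by i z) <-> phase b z.
Proof. by rewrite /phase; case: ifP => // _; exact: drift_shift. Qed.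

Lemma one_step_law_at t (G : set Omega) (s : A) (v : bool) :
  measurable G -> depends_on [set l | l < t%:Z] G -> G `<=` phase b ->
  (forall z, G z -> legal_on [set l | l < t.+1%:Z] (put t%:Z s z)) ->
  (forall z, G z -> `[< new_at t%:Z z >] = v) ->
  pr (G `&` [set z | z t%:Z = s]) = transition b s v * pr G.
Proof.
move=> mG pG Gb Gl Gv.
pose G' : set Omega := (shift_by (- t%:Z) : Omega -> Omega) @^-1` G.
have GE z : G' (shift_by t%:Z z) <-> G z.
  by rewrite /G' /= shift_by_add addNr shift_by0.
have mG' : measurable G' by exact: measurable_shift.
have pG' : past_event G'.
  split=> // z z' zz'; apply: pG => l /= lt.
  by rewrite /shift_by; apply: zz' => /=; lia.
have G'b : G' `<=` phase b by move=> z /Gb /phase_shift.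
have zE z : z = shift_by t%:Z (shift_by (- t%:Z) z).
  by rewrite shift_by_add subrr shift_by0.
have := @one_step_law n R mu mme b G' s v pG' G'b.
rewrite -[in X in _ -> _ -> X = _](pr_shift inv t%:Z); last first.
  by apply: measurableI => //; exact: (@simple_letter n 0 s).
rewrite -[pr G'](pr_shift inv t%:Z)//.
rewrite (_ : _ @^-1` G' = G); last first.
  by apply/seteqP; split=> z; [exact: (GE z).1|exact: (GE z).2].
rewrite (_ : _ @^-1` _ = G `&` [set z | z t%:Z = s]); last first.
  apply/seteqP; split=> z [h e].
    by split; [exact: (GE z).1|rewrite /= -e /shift_by add0r].
  by split; [exact: (GE z).2|rewrite /= /shift_by add0r].
apply.
  move=> z Gz; rewrite [z]zE put_shift; apply: legal_on_shift => /=.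
  rewrite (_ : [set i : int | _] = [set l | l < t.+1%:Z]); first exact: Gl.
  by apply/seteqP; split=> i /=; lia.
move=> z Gz; rewrite -(Gv _ Gz); apply: asbool_equiv_eq.
by rewrite {1}[z]zE new_at_shift.
Qed.

Definition cylinder w t : set Omega :=
  [set z : conf A | forall i : nat, (i < t)%N -> z i%:Z = nth point w i].

Lemma depends_cylinder w t : depends_on [set l | 0 <= l < t%:Z] (cylinder w t).
Proof. by move=> z z' zz' h i it; rewrite -(h i it) zz'//=; lia. Qed.

Definition putw w z : conf A :=
  fun l : int => if 0 <= l < (size w)%:Z then nth point w `|l|%N else z l.

Lemma putw_in w z (i : nat) : (i < size w)%N -> putw w z i%:Z = nth point w i.
Proof. by move=> iw; rewrite /putw ifT//; lia. Qed.

Lemma putw_out w z (l : int) : l < 0 \/ (size w)%:Z <= l -> putw w z l = z l.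
Proof. by move=> h; rewrite /putw ifF//; apply/negP; lia. Qed.

Lemma measurable_putw w (W : set Omega) : measurable W ->
  measurable ((putw w : Omega -> Omega) @^-1` W).
Proof.
by apply: measurable_preimage_conf => K; exists K => z z' zz' i iK; rewrite /putw zz'.
Qed.

(** The one-step law is applied to each letter in turn. Legality and newness up to the end of [w]
    depend on the past and on [w] only, so they are stated on [putw w z], for all points of [G] and
    not only for those that carry [w]. *)
Lemma word_law w (vs : seq bool) (G : set Omega) : past_event G -> G `<=` phase b ->
  (forall z, G z -> legal_on [set l | l < (size w)%:Z] (putw w z)) ->
  (forall z, G z -> forall t, (t < size w)%N ->
     `[< new_at t%:Z (putw w z) >] = nth false vs t) ->
  pr (G `&` cylinder w (size w)) =
  (\prod_(t < size w) transition b (nth point w t) (nth false vs t)) * pr G.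
Proof.
move=> [mG pG] Gb Gl Gv.
suff : forall t, (t <= size w)%N -> pr (G `&` cylinder w t) =
    (\prod_(i < t) transition b (nth point w i) (nth false vs i)) * pr G.
  exact.
elim=> [_|t IH tw].
  rewrite big_ord0 mul1r; congr (pr _); apply/seteqP; split=> [z []//|z Gz].
  by split.
have agree z : cylinder w t z -> forall l : int, l < t%:Z -> z l = putw w z l.
  move=> h l lt; have [l0|l0] := ltP l 0; first by rewrite putw_out//; left.
  have -> : l = `|l|%N%:Z by lia.
  by rewrite putw_in ?h//; lia.
have mC : measurable (cylinder w t) by exact: measurable_depends (@depends_cylinder w t).
have mGC : measurable (G `&` cylinder w t) by exact: measurableI.
rewrite big_ord_recr /= mulrAC -IH; last exact: ltnW.
rewrite mulrC -(one_step_law_at (t := t) mGC).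
- congr (pr _); apply/seteqP; split=> z.
    by move=> [Gz h]; split; [split=> // i it; apply: h; exact: ltnW|exact: h].
  move=> [[Gz h] /= zt]; split=> // i; rewrite ltnS leq_eqVlt => /predU1P[->//|].
  exact: h.
- apply: depends_onI.
    by apply: depends_onS pG => l /= l0; lia.
  by apply: depends_onS (@depends_cylinder w t) => l /= /andP[].
- by move=> z [/Gb].
- move=> z [Gz Cz]; apply: (@legal_on_ext _ (putw w z)); first by lia.
    move=> l lt; have [->|lt'] : l = t%:Z \/ l < t%:Z by lia.
      by rewrite putE putw_in.
    by rewrite put_neq -?agree//; lia.
  by move=> i j /= it jt; apply: Gl => //=; lia.
- by move=> z [Gz Cz]; rewrite -(Gv z Gz t tw); apply: eq_new_at; exact: agree.
Qed.

End Law.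
End WordLaw.

(** * Exchange of words *)

Section Frontier.
Context {n : nat} {R : realType}.
Local Notation A := (bool * 'I_n.+1)%type.
Local Notation N := (n.+1%:R : R).
Local Notation growth := (@growth_rate n R).
Local Notation Omega := (borel (conf A)).
Implicit Types (z : conf A) (t l : nat).
Variable b : bool.

Definition height z (k : int) : int := step b * pos z k.

Definition new_count t z : nat := \sum_(i < t) `[< new_at i%:Z z >].

Lemma heightS z k : height z (k + 1) = height z k + step b * up z k.
Proof. by rewrite /height posS mulrDr. Qed.

Lemma height_inj z k j : height z k = height z j -> pos z k = pos z j.
Proof.
by rewrite /height => h; rewrite -[LHS]mul1r -[RHS]mul1r -(step_sqr b) -!mulrA h.
Qed.

Lemma height_up z k : step b * up z k <= 1.
Proof. by case: (up_cases z k) => ->; case: (b). Qed.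

Lemma height_ivt z (i j s : int) : i <= j -> height z i <= s <= height z j ->
  exists2 l, i <= l <= j & height z l = s.
Proof.
move=> ij h; have [|l il e] := @pos_ivt _ z i j (step b * s) ij.
  by move: h; rewrite /height; move: (pos z i) (pos z j) => x y;
    case: (b); rewrite /step; lia.
by exists l => //; rewrite /height e mulrA step_sqr mul1r.
Qed.

(** Past heights are bounded above, because the walk moves by 1 and is below 0 before [K]. They tend
    to minus infinity, so by intermediate values they fill a half line. *)
Lemma past_frontier z : drift b z -> exists U : int, forall s : int,
  (exists2 k : int, k < 0 & height z k = s) <-> s < U.
Proof.
move=> hd; have [K hK] := hd 0%N.
(* The frontier is the least strict upper bound, found by lowering [|K| + 2] as far as possible. *)
pose P m := `[< forall k : int, k < 0 -> height z k < `|K|%:Z + 2 - m%:Z >].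
have P0 : P 0%N.
  apply/asboolP => k k0; rewrite subr0.
  have [/hK|kK] := leP k K; first by rewrite -/(height z k); move: (height z k) => x; lia.
  have : forall m : nat, height z (- m%:Z) <= m%:Z.
    elim=> [|m IH]; first by rewrite /height oppr0 pos0 mulr0.
    have := heightS z (- m.+1%:Z); rewrite (_ : - m.+1%:Z + 1 = - m%:Z); last by lia.
    have : - 1 <= step b * up z (- m.+1%:Z).
      by case: (up_cases z (- m.+1%:Z)) => ->; case: (b).
    move: (step b * _) (height z (- m%:Z)) (height z (- m.+1%:Z)) IH => *; lia.
  move=> /(_ `|k|%N); rewrite (_ : - `|k|%N%:Z = k); last by lia.
  by move: (height z k) => x; lia.
have ub m : P m -> (m <= `|(`|K|%:Z + 2 - height z (-1))%R|)%N.
  by move=> /asboolP/(_ (-1) isT); move: (height z (-1)) => x; lia.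
have [m /asboolP Pm mmax] := ex_maxnP (ex_intro _ 0%N P0) ub.
set U := `|K|%:Z + 2 - m%:Z in Pm; exists U => s; split=> [[k k0 <-]|sU].
  exact: Pm.
have [k0 k00 hk0] : exists2 k : int, k < 0 & U - 1 <= height z k.
  apply: contrapT => h; have : P m.+1.
    apply/asboolP => k k0; apply: contrapT => hk; apply: h; exists k => //.
    by move: hk; rewrite /U; move: (height z k) => x; lia.
  by move=> /mmax; rewrite ltnn.
have [K' hK'] := hd `|s|%N.
pose j := Num.min K' k0.
have jK' : j <= K' by rewrite ge_min lexx.
have jk : j <= k0 by rewrite ge_min lexx orbT.
have [|l il e] := @height_ivt z j k0 s jk.
  by have := hK' j jK'; rewrite -/(height z j); move: (height z j) (height z k0) hk0 => *; lia.
by exists l => //; lia.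
Qed.

(** The walk can leave the visited half line only through the site just beyond its end, so each new
    site lengthens it by one. *)
Lemma frontier z (U : int) :
  (forall s : int, (exists2 k : int, k < 0 & height z k = s) <-> s < U) ->
  forall t (s : int), (exists2 k : int, k < t%:Z & height z k = s) <->
    s < U + (new_count t z)%:Z.
Proof.
move=> h0; elim=> [|t IH] s.
  by rewrite /new_count big_ord0 addr0; exact: h0.
have prev : height z (t%:Z - 1) < U + (new_count t z)%:Z.
  by apply: (IH _).1; exists (t%:Z - 1) => //; lia.
have le : height z t%:Z <= U + (new_count t z)%:Z.
  have := heightS z (t%:Z - 1); rewrite subrK => ->.
  have := height_up z (t%:Z - 1).
  by move: (step b * _) (height z (t%:Z - 1)) prev => *; lia.
have newE : `[< new_at t%:Z z >] = (U + (new_count t z)%:Z <= height z t%:Z).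
  apply/asboolP/idP => [hn|hU k kt e].
    by rewrite leNgt; apply/negP => /(IH _).2 [k kt /height_inj]; exact: hn.
  have : height z t%:Z < U + (new_count t z)%:Z.
    by apply: (IH _).1; exists k => //; rewrite /height e.
  by rewrite ltNge hU.
have -> : new_count t.+1 z = (new_count t z + (U + (new_count t z)%:Z <= height z t%:Z)%R)%N.
  by rewrite {1}/new_count big_ord_recr /= newE.
move: (new_count t z) prev le newE IH => c prev le newE IH.
have step1 : (exists2 k : int, k < t.+1%:Z & height z k = s) <->
    s < U + c%:Z \/ s = height z t%:Z.
  split=> [[k kt <-]|[/(IH _).2 [k kt e]|->]].
  - have [kt'|->] : k < t%:Z \/ k = t%:Z by lia.
      by left; apply: (IH _).1; exists k.
    by right.
  - by exists k => //; lia.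
  - by exists t%:Z => //; lia.
apply: iff_trans step1 _; move: (height z t%:Z) le => x le.
by have [h|h] := leP (U + c%:Z) x; split; lia.
Qed.

Lemma new_at_frontier z (U : int) :
  (forall s : int, (exists2 k : int, k < 0 & height z k = s) <-> s < U) ->
  forall t, `[< new_at t%:Z z >] = (U + (new_count t z)%:Z <= height z t%:Z).
Proof.
move=> h0 t; have IH := frontier h0 t.
apply/asboolP/idP => [hn|hU k kt e].
  by rewrite leNgt; apply/negP => /(IH _).2 [k kt /height_inj]; exact: hn.
have : height z t%:Z < U + (new_count t z)%:Z.
  by apply: (IH _).1; exists k => //; rewrite /height e.
by rewrite ltNge hU.
Qed.

(* Between a common past and a common future entered at new sites, the height
   gained in excess of the number of new sites does not depend on the path. *)
Lemma height_new_count z z' (L l : nat) : drift b z ->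
  (forall k : int, k < 0 -> z k = z' k) ->
  (forall k : int, L%:Z <= k -> z k = z' k) ->
  new_at L%:Z z -> new_at L%:Z z' -> (L <= l)%N ->
  height z l%:Z - (new_count l z)%:Z = height z' l%:Z - (new_count l z')%:Z.
Proof.
move=> hd past future newz newz' Ll.
have [U hU] := past_frontier hd.
have hU' s : (exists2 k : int, k < 0 & height z' k = s) <-> s < U.
  rewrite -hU; have e (k : int) : k < 0 -> height z k = height z' k.
    by move=> k0; congr (_ * _); apply: pos_ext => m mk; apply: past; lia.
  by split=> -[k k0 <-]; exists k => //; rewrite e.
(* A walk that enters a new site stands exactly on the frontier. *)
have atL (y : conf A) : (forall s : int, (exists2 k : int, k < 0 & height y k = s) <-> s < U) ->
    new_at L%:Z y -> height y L%:Z - (new_count L y)%:Z = U.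
  move=> hy ny; have := new_at_frontier hy L; rewrite asboolT// => /esym le1.
  have : height y (L%:Z - 1) < U + (new_count L y)%:Z.
    by apply: (frontier hy _ _).1; exists (L%:Z - 1) => //; lia.
  have := heightS y (L%:Z - 1); rewrite subrK; have := height_up y (L%:Z - 1).
  move: (step b * _) (height y (L%:Z - 1)) (height y L%:Z) le1 => *; lia.
have -> : l = (L + (l - L))%N by rewrite subnKC.
(* Newness is the comparison of [U] with the excess itself. Equal excesses and equal steps therefore
   give equal excesses at the next time. *)
elim: (l - L)%N => [|m IH]; first by rewrite addn0 !atL.
have st (y : conf A) : height y (L + m.+1)%N%:Z =
    height y (L + m)%N%:Z + step b * up y (L + m)%N%:Z.
  by rewrite -heightS; congr height; lia.
have ct (y : conf A) : (forall s : int, (exists2 k : int, k < 0 & height y k = s) <-> s < U) ->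
    new_count (L + m.+1) y =
    (new_count (L + m) y + (U <= height y (L + m)%N%:Z - (new_count (L + m) y)%:Z)%R)%N.
  by move=> hy; rewrite addnS {1}/new_count big_ord_recr /= (new_at_frontier hy) lerBrDr.
rewrite !st !ct// IH /up future; last by lia.
by rewrite !PoszD !opprD !addrA ![_ + step b * _ - _]addrAC IH.
Qed.

Definition trans_prod l z : R :=
  \prod_(t < l) transition b (z t%:Z) `[< new_at t%:Z z >].

Lemma transitionE (s : A) v :
  transition b s v = N ^ (step b * step s.1 - (nat_of_bool v)%:Z) / growth.
Proof.
rewrite /transition /step_prob mulrAC; congr (_ / _).
have -> : (if s.1 == b then N else N^-1) = N ^ (step b * step s.1).
  by case: (b); case: s.1; rewrite /= ?expr1z ?exprN1.
rewrite expfzDr ?N_neq0//; congr (_ * _).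
by case: v; rewrite ?exprN1 ?expr0z ?oppr0.
Qed.

Lemma trans_prodE l z :
  trans_prod l z = N ^ (height z l%:Z - (new_count l z)%:Z) / growth ^+ l.
Proof.
elim: l => [|l IH].
  by rewrite /trans_prod big_ord0 /height pos0 mulr0 /new_count big_ord0 expr0z divr1.
rewrite /trans_prod big_ord_recr /= -/(trans_prod l z) IH transitionE.
rewrite mulrACA -expfzDr ?N_neq0// -invfM -exprSr; congr (_ ^ _ / _).
have -> : height z l.+1%:Z = height z l%:Z + step b * up z l%:Z.
  by rewrite -heightS; congr height; lia.
by rewrite /new_count big_ord_recr /= PoszD /up; ring.
Qed.

Lemma eq_trans_prod z z' (L l : nat) : phase b z ->
  (forall k : int, k < 0 -> z k = z' k) ->
  (forall k : int, L%:Z <= k -> z k = z' k) ->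
  (n = 0%N \/ new_at L%:Z z /\ new_at L%:Z z') -> (L <= l)%N ->
  trans_prod l z = trans_prod l z'.
Proof.
move=> hp past future hn Ll; rewrite !trans_prodE; congr (_ / _).
have [n0|n0] := eqVneq n 0%N; first by rewrite n0 !exp1rz.
case: hn => [/eqP|[n1 n2]]; first by rewrite (negPf n0).
congr (_ ^ _); apply: height_new_count past future n1 n2 Ll.
by move: hp; rewrite /phase (negPf n0).
Qed.

End Frontier.

(** * Exchange of two words behind a common past *)

Section Exchange.
Context {n : nat} {R : realType}.
Local Notation A := (bool * 'I_n.+1)%type.
Local Notation X := (kalikow_subshift [set: conf 'I_n.+1]).
Local Notation Omega := (borel (conf A)).
Variable mu : probability Omega R.
Hypothesis mme : maximal_entropy_measure X mu.
Local Notation pr := (prob mu).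
Variable b : bool.
Implicit Types (z : conf A) (w u v : seq A).

Lemma putw_past w z z' : (forall l : int, l < 0 -> z l = z' l) ->
  forall l : int, l < (size w)%:Z -> putw w z l = putw w z' l.
Proof. by move=> h l lw; rewrite /putw; case: ifP => // /negP nl; apply: h; lia. Qed.

Lemma past_event_putw w (W : set Omega) : measurable W ->
  depends_on [set l | l < (size w)%:Z] W -> past_event (putw w @^-1` W).
Proof.
move=> mW pW; split; first exact: measurable_putw.
by move=> z z' zz'; apply: pW => l /= lw; apply: putw_past lw => l' /zz'.
Qed.

Definition new_flags w z : (size w).-tuple bool :=
  [tuple `[< new_at (nat_of_ord t)%:Z (putw w z) >] | t < size w].

Lemma past_new_flags w (vs : (size w).-tuple bool) :
  past_event ([set z : conf A | new_flags w z = vs] : set Omega).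
Proof.
pose F (t : 'I_(size w)) : set Omega := if tnth vs t then
  putw w @^-1` new_at t%:Z else putw w @^-1` (~` new_at t%:Z).
have pF t : past_event (F t).
  have mN := @measurable_new_at n t.
  have pN : depends_on [set l | l < (size w)%:Z] (@new_at n t%:Z).
    move=> z z' zz' /asboolP h; apply/asboolP; rewrite -(eq_new_at _ (z := z))// => l lt.
    by apply: zz' => /=; have := ltn_ord t; lia.
  rewrite /F; case: (tnth vs t); first exact: past_event_putw.
  by apply: past_event_putw; [exact: measurableC|exact: depends_onC].
rewrite (_ : [set z | _] = [set z | forall t, F t z]).
  split; first by apply: measurable_forall => t; case: (pF t).
  by move=> z z' zz' h t; apply: (pF t).2 zz' (h t).
apply/seteqP; split=> z /= h.
  by move=> t; rewrite /F -h tnth_mktuple; case: asboolP.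
apply: eq_from_tnth => t; rewrite tnth_mktuple; have := h t; rewrite /F.
by case: (tnth vs t) => /= h'; [rewrite asboolT|rewrite asboolF].
Qed.

Lemma simple_new_flags w : simple_rv (new_flags w : Omega -> _).
Proof. by move=> vs; case: (past_new_flags vs). Qed.

Lemma past_eventI (G G' : set Omega) : past_event G -> past_event G' ->
  past_event (G `&` G').
Proof.
by move=> [m1 d1] [m2 d2]; split; [exact: measurableI|exact: depends_onI].
Qed.

Lemma measurable_cylinder w t : measurable (cylinder w t : set Omega).
Proof. exact: measurable_depends (@depends_cylinder n w t). Qed.

(** Since [word_law] asks for constant newness flags, [G] is split by the flags of both words. On a
    nonempty part, any of its points identifies the two products with [trans_prod]. *)
Lemma cylinder_exchange w w' (G : set Omega) : size w' = size w ->
  past_event G -> G `<=` phase b ->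
  (forall z, G z -> legal_on [set l | l < (size w)%:Z] (putw w z)) ->
  (forall z, G z -> legal_on [set l | l < (size w')%:Z] (putw w' z)) ->
  (forall z, G z -> trans_prod b (size w) (putw w z) =
    trans_prod b (size w') (putw w' z) :> R) ->
  pr (G `&` cylinder w (size w)) = pr (G `&` cylinder w' (size w')).
Proof.
move=> sw pG Gb Gl Gl' Gt.
have mw := @simple_new_flags w; have mw' := @simple_new_flags w'.
have [mG _] := pG.
rewrite (pr_sum mu (simple_pair mw mw')); last first.
  by apply: measurableI => //; exact: measurable_cylinder.
rewrite [RHS](pr_sum mu (simple_pair mw mw')); last first.
  by apply: measurableI => //; exact: measurable_cylinder.
apply: eq_bigr => -[vs vs'] _.
set S : set Omega := _ @^-1` _.
have SE : S = [set z : conf A | new_flags w z = vs] `&` [set z : conf A | new_flags w' z = vs'].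
  apply/seteqP; split=> z.
    by move=> h; split; [exact: (congr1 fst h)|exact: (congr1 snd h)].
  by move=> [/= h1 h2]; rewrite /S /= h1 h2.
have pS : past_event (G `&` S).
  by apply: past_eventI => //; rewrite SE; apply: past_eventI; exact: past_new_flags.
rewrite -!setIA ![cylinder _ _ `&` S]setIC !setIA.
have flag (x : seq A) (xs : (size x).-tuple bool) z : new_flags x z = xs ->
    forall t, (t < size x)%N -> `[< new_at t%:Z (putw x z) >] = nth false xs t.
  move=> <- t tx; rewrite -[t in RHS]/(nat_of_ord (Ordinal tx)) -tnth_nth.
  by rewrite tnth_mktuple.
have law : pr ((G `&` S) `&` cylinder w (size w)) =
  (\prod_(t < size w) transition b (nth point w t) (nth false vs t)) * pr (G `&` S).
  apply: (word_law mme (b := b)) => //; first by move=> z [/Gb].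
  - by move=> z [/Gl].
  - by move=> z [_]; rewrite SE => -[/flag].
have law' : pr ((G `&` S) `&` cylinder w' (size w')) =
  (\prod_(t < size w') transition b (nth point w' t) (nth false vs' t)) * pr (G `&` S).
  apply: (word_law mme (b := b)) => //; first by move=> z [/Gb].
  - by move=> z [/Gl'].
  - by move=> z [_]; rewrite SE => -[_ /flag].
rewrite law law'; have [->|/set0P[z [Gz Sz]]] := eqVneq (G `&` S) set0.
  by rewrite pr0 !mulr0.
have prodE (x : seq A) (xs : (size x).-tuple bool) : new_flags x z = xs ->
    \prod_(t < size x) transition b (nth point x t) (nth false xs t) =
    trans_prod b (size x) (putw x z) :> R.
  move=> /flag hx; apply: eq_bigr => t _; rewrite putw_in//.
  by rewrite -hx.
by move: Sz; rewrite SE => -[/prodE -> /prodE ->]; rewrite Gt.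
Qed.

Variables (L : nat) (u v : seq A).
Hypotheses (su : size u = L) (sv : size v = L).

(* Points carrying the word x on [0, L) for which replacing it by y stays in the
   subshift, both points entering a new site at time L. *)
Definition swappable (x y : seq A) (I : set int) : set Omega := [set z : conf A |
  [/\ phase b z, legal_on I z, legal_on I (putw y z), cylinder x L z &
      n = 0%N \/ new_at L%:Z z /\ new_at L%:Z (putw y z)]].

Lemma measurable_swappable x y I : measurable (swappable x y I).
Proof.
have -> : swappable x y I = (phase b : set Omega) `&`
    ([set z : conf A | legal_on I z] `&` ((putw y @^-1` [set z : conf A | legal_on I z]) `&`
    (cylinder x L `&` (if n == 0%N then setT else
      new_at L%:Z `&` (putw y @^-1` new_at L%:Z))))).
  apply/seteqP; split=> z.
    by move=> [h1 h2 h3 h4 h5]; do !split=> //; case: eqP => // n0; case: h5.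
  move=> [h1 [h2 [h3 [h4]]]]; case: eqP => n0 h5; split=> //; first by left.
  by right.
have mN := @measurable_new_at n L.
apply: measurableI.
  by rewrite /phase; case: ifP => // _; exact: measurable_drift.
apply: measurableI; first exact: measurable_legal_on.
apply: measurableI; first by apply: measurable_putw; exact: measurable_legal_on.
apply: measurableI; first exact: measurable_cylinder.
by case: ifP => // _; apply: measurableI => //; exact: measurable_putw.
Qed.

Lemma putw_cylinder x z : size x = L -> cylinder x L z -> putw x z = z.
Proof.
move=> sx h; apply/funext => l; rewrite /putw sx; case: ifP => // lL.
have -> : l = `|l|%N%:Z by lia.
by rewrite h//; lia.
Qed.

Lemma putw_putw (x y : seq A) z : size x = size y -> putw x (putw y z) = putw x z.
Proof.
by move=> s; apply/funext => l; rewrite /putw s; case: ifP => // ->.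
Qed.

Lemma cylinder_putw x z : size x = L -> cylinder x L (putw x z).
Proof. by move=> sx i iL; rewrite putw_in ?sx. Qed.

Lemma phase_past z z' : (forall l : int, l < 0 -> z l = z' l) ->
  phase b z -> phase b z'.
Proof. by rewrite /phase; case: ifP => // _; exact: drift_past. Qed.

Lemma depends_swappable x y (l : nat) : size y = L -> (L <= l)%N ->
  depends_on [set i | i < l%:Z] (swappable x y [set i | i < l%:Z]).
Proof.
move=> sy Ll z z' zz' [h1 h2 h3 h4 h5].
have pzz (k : int) : k < l%:Z -> putw y z k = putw y z' k.
  by move=> kl; rewrite /putw; case: ifP => // _; exact: zz'.
have newE (y1 y2 : conf A) : (forall k : int, k < l%:Z -> y1 k = y2 k) ->
    new_at L%:Z y1 -> new_at L%:Z y2.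
  move=> e /asboolP hn; apply/asboolP; rewrite -(eq_new_at (z := y1))// => k kL.
  by apply: e; lia.
split.
- by apply: phase_past h1 => k k0; apply: zz' => /=; lia.
- by apply: legal_on_ext h2.
- by apply: legal_on_ext h3.
- by apply: depends_cylinder h4 => k /= kL; apply: zz' => /=; lia.
- case: h5 => [n0|[h5 h6]]; [by left|right; split]; first exact: newE h5.
  exact: newE h6.
Qed.

(** Fix the word [f] read on [L, l). Both sides then become the intersection of one past event [G]
    with the cylinders of [u ++ f] and [v ++ f], whose weights agree because both points enter a new
    site at time [L]. *)
Lemma pr_swap_window (l K : nat) (B : set Omega) : (L <= l)%N -> (K <= l)%N ->
  depends_on (centered K) B ->
  pr (B `&` swappable u v [set i | i < l%:Z]) =
  pr ((putw u @^-1` B) `&` swappable v u [set i | i < l%:Z]).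
Proof.
move=> Ll Kl hB; set I := [set i | i < l%:Z].
have mB : measurable B by exact: measurable_local hB.
have mW : simple_rv (window L%:Z (l - L) : Omega -> _) by exact: simple_window.
have mQ x y : measurable (swappable x y I) by exact: measurable_swappable.
rewrite (pr_sum mu mW (measurableI _ _ mB (mQ u v))).
rewrite [RHS](pr_sum mu mW (measurableI _ _ (measurable_putw u mB) (mQ v u))).
apply: eq_bigr => f _.
have suf : size (u ++ f) = l by rewrite size_cat su size_tuple subnKC.
have svf : size (v ++ f) = l by rewrite size_cat sv size_tuple subnKC.
pose W := B `&` swappable u v I; pose G : set Omega := putw (u ++ f) @^-1` W.
have windowP z : window L%:Z (l - L) z = f <->
    forall i : nat, (L <= i < l)%N -> z i%:Z = nth point f (i - L).
  split=> [<- i iL|h].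
    have il : (i - L < l - L)%N by lia.
    rewrite -[(i - L)%N]/(nat_of_ord (Ordinal il)) -tnth_nth tnth_mktuple /=.
    by congr z; lia.
  apply: eq_from_tnth => i; rewrite tnth_mktuple (tnth_nth point).
  by have := ltn_ord i => il; rewrite -PoszD h; [congr nth|]; lia.
have cylP x z : size x = L -> cylinder (x ++ f) l z <->
    cylinder x L z /\ window L%:Z (l - L) z = f.
  move=> sx; split=> [h|[h /windowP h'] i il].
    split=> [i iL|].
      by rewrite h ?nth_cat ?sx ?iL//; exact: leq_trans Ll.
    apply/windowP => i /andP[iL il].
    by rewrite h// nth_cat sx ltnNge iL.
  rewrite nth_cat sx; case: ltnP => iL; first exact: h.
  by apply: h'; rewrite iL.
have putP z : window L%:Z (l - L) z = f -> putw (u ++ f) z = putw u z.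
  move=> /windowP h; apply/funext => k; rewrite /putw suf su.
  case: ifP => kl; last by rewrite ifF//; apply/negP; move: kl => /negP; lia.
  rewrite nth_cat su; case: ltnP => kL; first by rewrite ifT//; lia.
  rewrite ifF; last by apply/negP; lia.
  have := h `|k|%N; rewrite (_ : `|k|%N%:Z = k); last by lia.
  by move=> <- //; lia.
have vu z : putw v (putw (u ++ f) z) = putw (v ++ f) z.
  apply/funext => k; rewrite /putw suf svf sv.
  case: ifP => kL; first by rewrite ifT ?nth_cat ?sv ?ifT//; lia.
  case: ifP => // kl; rewrite !nth_cat su sv ifF; first by rewrite ifF//; apply/negP; lia.
  by apply/negP; lia.
have L1 : (B `&` swappable u v I) `&` window L%:Z (l - L) @^-1` [set f] =
    G `&` cylinder (u ++ f) (size (u ++ f)).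
  rewrite suf; apply/seteqP; split=> z.
    move=> [[Bz Qz] /= zf]; have [_ _ _ cz _] := Qz.
    have cw : cylinder (u ++ f) l z by apply/(cylP _ _ su).
    split=> //; rewrite /G /= putP// putw_cylinder//.
  move=> [Gz cw]; have [cz zf] := (cylP _ _ su).1 cw.
  by move: Gz; rewrite /G /= putP// putw_cylinder.
have L2 : (putw u @^-1` B `&` swappable v u I) `&` window L%:Z (l - L) @^-1` [set f] =
    G `&` cylinder (v ++ f) (size (v ++ f)).
  rewrite svf; apply/seteqP; split=> z.
    move=> [[/= Bz [h1 h2 h3 h4 h5]] zf].
    split; last by apply/(cylP _ _ sv).
    rewrite /G /= putP//; split=> //; split=> //.
    - by apply: phase_past h1 => k k0; rewrite putw_out//; left.
    - by rewrite putw_putw ?su// putw_cylinder.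
    - exact: cylinder_putw.
    - by rewrite putw_putw ?su// (putw_cylinder sv)//; case: h5 => [|[]]; [left|right].
  move=> [Gz cw]; have [cz zf] := (cylP _ _ sv).1 cw.
  move: Gz; rewrite /G /= putP// => -[Bz [h1 h2 h3 h4 h5]].
  rewrite putw_putw ?su// (putw_cylinder sv)// in h3 h5.
  split=> //; split=> //; split=> //.
  - by apply: phase_past h1 => k k0; rewrite putw_out//; left.
  - by case: h5 => [|[]]; [left|right].
have hW : depends_on [set i | i < (size (u ++ f))%:Z] W.
  rewrite suf; apply: depends_onI; last exact: depends_swappable.
  apply: depends_onS hB => k; rewrite /centered /=; lia.
rewrite L1 L2; apply: cylinder_exchange.
- by rewrite suf svf.
- by apply: past_event_putw hW; exact: measurableI.
- move=> z [_ [h1 _ _ _ _]].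
  by apply: phase_past h1 => k k0; rewrite putw_out//; left.
- by rewrite suf => z [_ []].
- by rewrite svf => z [_ [_ _ + _ _]]; rewrite vu.
move=> z [_ [h1 _ _ _ h5]]; rewrite suf svf.
rewrite -vu; apply: (eq_trans_prod (L := L)) => //.
- by move=> k k0; rewrite [RHS]putw_out//; left.
- by move=> k k0; rewrite [RHS]putw_out// sv; right.
Qed.

Lemma legal_on_setT z : legal_on setT z <-> forall l : nat, legal_on [set i | i < l%:Z] z.
Proof.
split=> [h l i j _ _|h i j _ _]; first exact: h.
by apply: (h (`|i| + `|j|).+1) => /=; lia.
Qed.

Lemma swappableT x y : swappable x y setT =
  \bigcap_l swappable x y [set i | i < l%:Z].
Proof.
apply/seteqP; split=> [z [h1 h2 h3 h4 h5] l _|z h].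
  by split=> //; apply/(legal_on_setT _).1.
have [h1 _ _ h4 h5] := h 0%N Logic.I.
by split=> //; apply/legal_on_setT => l; have [] := h l Logic.I.
Qed.

Lemma swappable_le x y (i j : nat) : (i <= j)%N ->
  swappable x y [set k | k < j%:Z] `<=` swappable x y [set k | k < i%:Z].
Proof.
move=> ij z [h1 h2 h3 h4 h5].
by split=> // k k' /= ki k'i; [apply: h2|apply: h3] => /=; lia.
Qed.

(** Legality of the whole point is the decreasing limit, as [l] grows, of legality before time
    [l]. *)
Lemma pr_swap_local (K : nat) (B : set Omega) : depends_on (centered K) B ->
  pr (B `&` swappable u v setT) = pr ((putw u @^-1` B) `&` swappable v u setT).
Proof.
move=> hB; have mB : measurable B by exact: measurable_local hB.
have mB' : measurable (putw u @^-1` B : set Omega) by exact: measurable_putw.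
have near (C : set Omega) x y (e : R) : measurable C -> 0 < e ->
    exists K, forall l, (K <= l)%N ->
    pr (C `&` swappable x y setT) <= pr (C `&` swappable x y [set i | i < l%:Z]) <=
    pr (C `&` swappable x y setT) + e.
  move=> mC e0.
  have mF l : measurable (C `&` swappable x y [set i | i < l%:Z]).
    by apply: measurableI => //; exact: measurable_swappable.
  have [J hJ] := pr_decreasing mu mF
    (fun i j ij => @setIS _ _ _ _ (@swappable_le x y i j ij)) e0.
  have E : \bigcap_l (C `&` swappable x y [set i | i < l%:Z]) = C `&` swappable x y setT.
    rewrite swappableT; apply/seteqP; split=> [z h|z [Cz h] l _].
      by split=> [|l _]; [have [] := h 0%N Logic.I|have [] := h l Logic.I].
    by split=> //; exact: h.
  exists J => l /hJ; rewrite E => ->; rewrite andbT; apply: le_pr => //.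
    by apply: measurableI => //; exact: measurable_swappable.
  by move=> z [Cz]; rewrite swappableT => h; split=> //; exact: h.
suff close (e : R) : 0 < e ->
    `|pr (B `&` swappable u v setT) - pr ((putw u @^-1` B) `&` swappable v u setT)| <= e.
  by apply/eqP; rewrite -subr_eq0 -normr_le0; apply/ler_addgt0Pl => e /close;
    rewrite addr0.
move=> e0; have [J1 h1] := near _ u v e mB e0; have [J2 h2] := near _ v u e mB' e0.
pose l := (J1 + J2 + L + K)%N.
have /andP[] := h1 l ltac:(rewrite /l; lia); have /andP[] := h2 l ltac:(rewrite /l; lia).
rewrite -(@pr_swap_window l K B) => [|||//]; [|rewrite /l; lia..].
by move=> a1 a2 a3 a4; rewrite ler_norml; lra.
Qed.

(** Both sides are finite measures in [B], the right one being the image under [putw u] of a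
    restriction of [mu], and they agree on local sets. *)
Lemma mu_swap (B : set Omega) : measurable B ->
  mu (B `&` swappable u v setT) = mu ((putw u @^-1` B) `&` swappable v u setT).
Proof.
move=> mB.
have mQ x y : measurable (swappable x y setT) by exact: measurable_swappable.
have mput : measurable_fun [set: Omega] (putw u : Omega -> Omega).
  by move=> _ W mW; rewrite setTI; exact: measurable_putw.
have [m2 m2E] : exists m2 : {measure set Omega -> \bar R}, forall C,
    m2 C = mu ((putw u @^-1` C) `&` swappable v u setT).
  unshelve eexists.
    by refine (pushforward (mrestr mu (mQ v u)) (putw u : Omega -> Omega)).
  by [].
rewrite -m2E -[LHS]/(mrestr mu (mQ u v) B).
apply: (@measure_unique _ R Omega local_sets (fun=> setT) _ _ _ _
  (mrestr mu (mQ u v)) m2) => //.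
- exact: borel_local.
- move=> C D [K hK] [J hJ]; exists (maxn K J); apply: depends_onI.
    by apply: depends_onS hK => i; rewrite /centered /=; lia.
  by apply: depends_onS hJ => i; rewrite /centered /=; lia.
- by move=> i; exists 0%N.
- by rewrite bigcup_const.
- move=> C [K hK]; have mC : measurable (C : set Omega) by exact: measurable_local hK.
  rewrite m2E -[LHS]/(mu (C `&` swappable u v setT)) !prE ?(pr_swap_local hK)//.
    by apply: measurableI => //; exact: measurable_putw.
  by exact: measurableI.
move=> _; rewrite -[X in (X < _)%E]/(mu (setT `&` swappable u v setT)) setTI.
by rewrite prE// ltry.
Qed.

Lemma mu_swap_image (B : set Omega) : measurable B -> B `<=` swappable u v setT ->
  measurable (putw v @` B : set Omega) /\ mu (putw v @` B) = mu B.
Proof.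
move=> mB BQ.
have -> : putw v @` B = (putw u @^-1` B) `&` swappable v u setT.
  apply/seteqP; split=> [_ [z Bz <-]|z [/= Bz Qz]].
    have [h1 h2 h3 h4 h5] := BQ z Bz.
    have e : putw u (putw v z) = z by rewrite putw_putw ?su// putw_cylinder.
    split; first by rewrite /= e.
    split=> //; rewrite ?e//.
    - by apply: phase_past h1 => k k0; rewrite putw_out//; left.
    - exact: cylinder_putw.
    - by case: h5 => [|[]]; [left|right].
  exists (putw u z) => //; rewrite putw_putw ?su// putw_cylinder//.
  by case: Qz.
split; first by apply: measurableI; [exact: measurable_putw|exact: measurable_swappable].
by rewrite -mu_swap// setIidl.
Qed.

End Exchange.

(** * Times at which two points both enter a new site *)

Section CommonNewSites.
Context {n : nat}.
Local Notation A := (bool * 'I_n.+1)%type.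
Local Notation Omega := (borel (conf A)).
Implicit Types (z : conf A).

Lemma new_at_shift_by z (k j : int) : new_at j (shift_by k z) <-> new_at (k + j) z.
Proof.
split=> h i ij e.
  by apply: (h (i - k)); [lia|rewrite !pos_shift subrKC e].
apply: (h (k + i)); first by lia.
by move: e; rewrite !pos_shift => /eqP; rewrite (inj_eq (addIr _)) => /eqP.
Qed.

Lemma record_new_at b z (t : int) : record b (shift_by t z) -> new_at t z.
Proof. by move=> /record_shift h k kt e; have := h k kt; rewrite e ltxx. Qed.

Lemma pos_abs_le z (k : int) : (`|pos z k| <= `|k|)%N.
Proof.
have h (m : nat) : (`|pos z m%:Z| <= m)%N /\ (`|pos z (- m%:Z)| <= m)%N.
  elim: m => [|m [IH1 IH2]]; first by rewrite oppr0 pos0.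
  have := posS z m%:Z; have := posS z (- m.+1%:Z).
  rewrite (_ : - m.+1%:Z + 1 = - m%:Z); last by lia.
  rewrite (_ : m%:Z + 1 = m.+1%:Z); last by lia.
  move: (pos z m%:Z) (pos z m.+1%:Z) (pos z (- m%:Z)) (pos z (- m.+1%:Z)) IH1 IH2 => *.
  by case: (up_cases z m%:Z) (up_cases z (- m.+1%:Z)) => [] ? [] ?; split; lia.
have [h1 h2] := h `|k|%N; have [k0|k0] := leP 0 k.
  by move: h1; rewrite (_ : `|k|%N%:Z = k)//; lia.
by move: h2; rewrite (_ : - `|k|%N%:Z = k)//; lia.
Qed.

Lemma drift_tail b z z' (T : int) : (forall l : int, l < T -> z l = z' l) ->
  drift b z -> drift b z'.
Proof.
move=> h hd; apply/(drift_shift b z' T); apply: (@drift_past _ b (shift_by T z)).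
  by move=> l l0; apply: h; lia.
exact/drift_shift.
Qed.

(** From time [m] on the heights of the two points differ by a constant [D]. A record of [z] after
    [m], so high that [z'] rises above all that it reached before [m], is a new site for both. *)
Lemma common_new_site b z z' (m : nat) :
  (forall l : int, l < - m%:Z \/ m%:Z <= l -> z l = z' l) ->
  drift b z -> ~ extremal_visit b true z ->
  exists t : nat, [/\ (m <= t)%N, new_at t%:Z z & new_at t%:Z z'].
Proof.
move=> zz' hd nz.
have hd' : drift b z' by apply: (@drift_tail b z z' (- m%:Z)) => // l lm; apply: zz'; left.
have [K hK] := hd' 0%N.
pose Bd := (`|K| + m)%N.
have bound (k : int) : k < m%:Z -> height b z' k <= Bd%:Z.
  move=> km; have [/hK|kK] := leP k K.
    by rewrite -/(height b z' k); move: (height b z' k) => x; lia.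
  have := pos_abs_le z' k; rewrite /height /Bd; move: (pos z' k) => x.
  by case: (b); rewrite /step; lia.
have [D DE] : exists D : int, D = height b z' m%:Z - height b z m%:Z by eexists.
(* At this height of [z], the height of [z'] exceeds [Bd]. *)
have [t [mt rt ht]] := drift_records hd nz m%:Z `|(Bd%:Z + 1 - D)%R|%N.
exists `|t|%N; rewrite (_ : `|t|%N%:Z = t); last by lia.
split; [lia|exact: record_new_at rt|move=> k kt e].
have tD : height b z' t = height b z t + D.
  have := @posB_ext _ z z' m%:Z t mt; rewrite DE /height => h.
  have {}h : pos z t - pos z m%:Z = pos z' t - pos z' m%:Z.
    by apply: h => l lm; rewrite zz'//; right; case/andP: lm.
  move: (pos z t) (pos z m%:Z) (pos z' t) (pos z' m%:Z) h => *.
  by case: (b); rewrite /step; lia.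
have ek : height b z' k = height b z' t by rewrite /height e.
have [km|mk] := ltP k m%:Z.
  have := bound k km; rewrite ek tD; move: ht; rewrite -/(height b z t).
  by move: (height b z t) => *; lia.
have h : pos z k - pos z m%:Z = pos z' k - pos z' m%:Z.
  by apply: posB_ext => // l lm; rewrite zz'//; right; case/andP: lm.
have /record_shift/(_ k kt) := rt; rewrite -/(height b z k) -/(height b z t).
have kD : height b z' k = height b z k + D.
  rewrite DE /height; move: (pos z k) (pos z m%:Z) (pos z' k) (pos z' m%:Z) h => *.
  by case: (b); rewrite /step; lia.
by move: ek; rewrite tD kD => /addIr ->; rewrite ltxx.
Qed.

End CommonNewSites.

(** * Invariance under the Gibbs relation *)

Section GibbsInvariance.
Context {n : nat} {R : realType}.
Local Notation A := (bool * 'I_n.+1)%type.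
Local Notation X := (kalikow_subshift [set: conf 'I_n.+1]).
Local Notation Omega := (borel (conf A)).
Variable mu : probability Omega R.
Hypothesis mme : maximal_entropy_measure X mu.
Local Notation pr := (prob mu).
Local Notation shift i := (shift_by i : Omega -> Omega).
Implicit Types (z : conf A).

Let inv := mme_inv mme.

Lemma mu_shift (k : int) (W : set Omega) : measurable W ->
  mu (shift k @^-1` W) = mu W.
Proof.
by move=> mW; rewrite !prE ?pr_shift//; exact: measurable_shift.
Qed.

Section Pieces.
Variables (B C : set Omega) (g : Omega -> Omega).
Hypotheses (mB : measurable B) (mC : measurable C).
Hypotheses (BC : set_bij B C g) (mg : measurable_fun B g).
Hypothesis gibbs : forall z, B z -> gibbs_relation X z (g z).

(* The part of B on which g replaces the word u, read on [-m, size u - m), by v. *)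
Definition piece (b : bool) (m : nat) (u v : seq A) : set Omega := [set z : conf A |
  [/\ size v = size u, B z, swappable b (size u) u v setT (shift_by (- m%:Z) z) &
      shift_by (- m%:Z) (g z) = putw v (shift_by (- m%:Z) z)]].

Lemma measurable_piece b m u v : measurable (piece b m u v).
Proof.
have [s|s] := eqVneq (size v) (size u); last first.
  rewrite (_ : piece b m u v = set0)//; apply/seteqP; split=> // z [s'].
  by move: s; rewrite s' eqxx.
pose coord (k : int) (a : A) : set Omega := [set z : conf A | z k = a].
have mcoord k a : measurable (coord k a) by exact: (@simple_letter n k a).
(* The equation that defines the piece is tested at each coordinate [k], by naming the common letter
   [a]. *)
pose E (k : int) (a : A) : set Omega := (B `&` g @^-1` coord (k - m%:Z) a) `&`
  (shift (- m%:Z) @^-1` ((putw v : Omega -> Omega) @^-1` coord k a)).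
have mE k a : measurable (E k a).
  apply: measurableI; first exact: mg.
  by apply: measurable_shift; exact: measurable_putw.
have -> : piece b m u v = (B `&` (shift (- m%:Z) @^-1` swappable b (size u) u v setT)) `&`
    [set z | forall k : int, [set z | exists a : A, E k a z] z].
  apply/seteqP; split=> z.
    move=> [_ Bz Qz e]; split=> // k; exists (g z (k - m%:Z)); split=> //.
    by rewrite /coord /= -e.
  move=> [[Bz Qz] h]; split=> //; apply/funext => k.
  by have [a [[_ /= <-] /= ->]] := h k.
apply: measurableI.
  by apply: measurableI => //; apply: measurable_shift; exact: measurable_swappable.
by apply: measurable_forall => k; apply: measurable_exists => a.
Qed.

Lemma mu_piece_image b m u v (S : set Omega) : measurable S ->
  S `<=` piece b m u v ->
  measurable (g @` S : set Omega) /\ mu (g @` S) = mu S.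
Proof.
move=> mS Sp; have [->|/set0P[z0 /Sp[suv _ _ _]]] := eqVneq S set0.
  by rewrite image_set0.
pose S' : set Omega := shift m%:Z @^-1` S.
have mS' : measurable S' by exact: measurable_shift.
have S'Q : S' `<=` swappable b (size u) u v setT.
  move=> y /Sp[_ _ + _]; by rewrite shift_by_add addNr shift_by0.
have [mI hI] := mu_swap_image mme (erefl (size u)) suv mS' S'Q.
have -> : g @` S = shift (- m%:Z) @^-1` (putw v @` S').
  apply/seteqP; split=> [_ [z Sz <-]|z' [y S'y e]].
    exists (shift_by (- m%:Z) z); first by rewrite /S' /= shift_by_add subrr shift_by0.
    by have [_ _ _ ->] := Sp z Sz.
  exists (shift_by m%:Z y) => //; have [_ _ _] := Sp _ S'y.
  rewrite shift_by_add addNr shift_by0 e => /(congr1 (shift_by m%:Z)).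
  by rewrite !shift_by_add subrr !shift_by0.
split; first exact: measurable_shift.
by rewrite mu_shift// hI mu_shift.
Qed.

(** The null set on which [swap_time] may fail: no drift, or a last record in one of the
    directions. *)
Definition driftless : set Omega := if n == 0%N then set0 else
  ~` (@drift n true `|` @drift n false) `|`
    (@extremal_visit n true true `|` @extremal_visit n false true).

Lemma measurable_driftless : measurable driftless.
Proof.
rewrite /driftless; case: ifP => // _; apply: measurableU.
  by apply: measurableC; apply: measurableU; exact: measurable_drift.
by apply: measurableU; exact: measurable_extremal_visit.
Qed.

Lemma pr_driftless : pr driftless = 0.
Proof.
rewrite /driftless; case: eqP => [_|/eqP n0]; first exact: pr0.
have mD : measurable (~` (@drift n true `|` @drift n false) : set Omega).
  by apply: measurableC; apply: measurableU; exact: measurable_drift.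
have mV b : measurable (@extremal_visit n b true) by exact: measurable_extremal_visit.
have mVV : measurable (@extremal_visit n true true `|` @extremal_visit n false true).
  exact: measurableU.
apply/le_anti; rewrite pr_ge0 andbT; apply: le_trans (pr_leU _ mD mVV) _.
rewrite (pr_drift mme) ?lt0n// add0r; apply: le_trans (pr_leU _ (mV _) (mV _)) _.
by rewrite !(pr_extremal_record inv) addr0.
Qed.

Lemma swap_time z z' (m : nat) :
  (forall l : int, l < - m%:Z \/ m%:Z <= l -> z l = z' l) -> ~ driftless z ->
  exists (b : bool) (t : nat), [/\ (m <= t)%N, phase b z, phase b z' &
    n = 0%N \/ new_at t%:Z z /\ new_at t%:Z z'].
Proof.
rewrite /driftless /phase => zz'; have [n0 _|n0 nd] := eqVneq n 0%N.
  by exists true, m; split=> //; left.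
have {nd} [b hd nv] : exists2 b, drift b z & ~ extremal_visit b true z.
  have [d1|d1] := pselect (drift true z).
    by exists true => // h; apply: nd; right; left.
  have [d2|d2] := pselect (drift false z).
    by exists false => // h; apply: nd; right; right.
  by exfalso; apply: nd; left => -[].
have [t [mt h1 h2]] := common_new_site zz' hd nv.
exists b, t; split=> //; last by right.
by apply: (@drift_tail n b z z' (- m%:Z)) => // l lm; apply: zz'; left.
Qed.

(** One good point of the pair is enough because the conclusion of [swap_time] is symmetric.
    Consequently both the uncovered part of [B] and its image under [g] lie in the null set
    [driftless]. *)
Lemma piece_cover z : B z -> ~ driftless z \/ ~ driftless (g z) ->
  exists b m u v, piece b m u v z.
Proof.
move=> Bz nd; have [Xz Xgz fin] := gibbs Bz.
have [m zz'] : exists m : nat, forall l : int, l < - m%:Z \/ m%:Z <= l -> z l = g z l.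
  have [s hs] := (finite_seqP _).1 fin.
  exists (\max_(i <- s) `|i|).+1 => l lm; apply/eqP/negPn/negP => zl.
  have ls : l \in s by have : [set` s] l by rewrite -hs.
  have : (`|l| <= \max_(i <- s) `|i|)%N.
    exact: (@leq_bigmax_seq _ s predT (fun i : int => `|i|%N) l ls isT).
  by move: (\max_(i <- s) _)%N lm => M *; lia.
have [b [t [mt pz pz' hnew]]] : exists (b : bool) (t : nat),
    [/\ (m <= t)%N, phase b z, phase b (g z) &
     n = 0%N \/ new_at t%:Z z /\ new_at t%:Z (g z)].
  case: nd => [|nd]; first exact: swap_time.
  have [l lm|b [t [mt p1 p2 h]]] := @swap_time (g z) z m _ nd; first by rewrite zz'.
  by exists b, t; split=> //; case: h => [|[]]; [left|right].
(* The shift moves the first possible difference, at [-m], to time 0, and the common new site from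
   time [t] to the end [t + m] of the words. *)
pose y := shift_by (- m%:Z) z; pose y' := shift_by (- m%:Z) (g z).
pose u := mkseq (fun i : nat => y i%:Z) (t + m).
pose v := mkseq (fun i : nat => y' i%:Z) (t + m).
have vy : putw v y = y'.
  apply/funext => k; rewrite /putw size_mkseq; case: ifP => kL.
    by rewrite nth_mkseq; [congr y'|]; lia.
  by rewrite /y /y' /shift_by zz'//; move: kL => /negP; lia.
have legal (x : conf A) : X x -> legal_on setT (shift_by (- m%:Z) x).
  by move=> /kalikow_legal; exact: kalikow_shift.
exists b, m, u, v; split=> //; first by rewrite !size_mkseq.
rewrite -/y size_mkseq; split.
- exact/phase_shift.
- exact: legal.
- by rewrite vy; exact: legal.
- by move=> i it; rewrite nth_mkseq.
case: hnew => [|[h1 h2]]; [by left|right]; rewrite vy.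
by split; apply/new_at_shift_by; rewrite (_ : - m%:Z + _ = t%:Z)//; lia.
Qed.

(** The countably many pieces are made disjoint by [seqDU], and injectivity of [g] keeps the images
    disjoint. What remains of [B] and what remains of [C] are null separately, by [piece_cover]. *)
Lemma mu_gibbs_image : mu (g @` B) = mu B.
Proof.
have gI : {in B &, injective g} by case: BC.
have gB : g @` B = C.
  apply/seteqP; split=> [_ [z Bz <-]|z Cz]; first by case: BC => h _ _; exact: h.
  by case: BC => _ _ /(_ z Cz).
pose F (i : nat) : set Omega :=
  if unpickle i is Some (b, m, u, v) then piece b m u v else set0.
have mF i : measurable (F i).
  by rewrite /F; case: unpickle => [[[[b m] u] v]|//]; exact: measurable_piece.
pose S := seqDU F.
have mS i : measurable (S i).
  by apply: measurableD => //; apply: bigsetU_measurable => j _; exact: mF.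
have SF i : S i `<=` F i by exact: subset_seqDU.
have FB i : F i `<=` B.
  by rewrite /F; case: unpickle => [[[[b m] u] v]|//] z [].
have gS i : measurable (g @` S i : set Omega) /\ mu (g @` S i) = mu (S i).
  have := SF i; rewrite /F; case: unpickle => [[[[b m] u] v]|] h.
    exact: mu_piece_image h.
  have -> : S i = set0 by rewrite -subset0.
  by rewrite image_set0.
pose U : set Omega := \bigcup_i S i.
have UE : U = \bigcup_i F i by rewrite /U -seqDU_bigcup_eq.
have mU : measurable U by exact: bigcup_measurable.
have UB : U `<=` B by move=> z [i _ /SF /FB].
have gUE : g @` U = \bigcup_i (g @` S i) by exact: image_bigcup.
have mgU : measurable (g @` U : set Omega).
  by rewrite gUE; apply: bigcup_measurable => i _; case: (gS i).
have out z : B z -> ~ U z -> driftless z /\ driftless (g z).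
  move=> Bz nU; split; apply: contrapT => nd; apply: nU; rewrite UE;
    have [|b [m [u [v h]]]] := @piece_cover z Bz; [by left| |by right|];
    by exists (pickle (b, m, u, v)) => //; rewrite /F pickleK.
have mN := measurable_driftless.
have BU : pr B = pr U.
  have B0 : pr (B `\` U) = 0.
    apply: (pr_eq0S _ mN _ pr_driftless); first exact: measurableD.
    by move=> z [Bz /(out z Bz)[]].
  by rewrite (prDI mu mB mU) B0 add0r setIidr.
have CU : pr C = pr (g @` U).
  have C0 : pr (C `\` g @` U) = 0.
    apply: (pr_eq0S _ mN _ pr_driftless); first exact: measurableD.
    rewrite -gB => _ [[z Bz <-] nU].
    by have [] := out z Bz (fun Uz => nU (ex_intro2 _ _ z Uz erefl)).
  rewrite (prDI mu mC mgU) C0 add0r setIidr// -gB.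
  by move=> _ [z Uz <-]; exists z => //; exact: UB.
have UgU : mu (g @` U) = mu U.
  rewrite gUE (measure_semi_bigcup mu (fun i => (gS i).1)).
  - rewrite (measure_semi_bigcup mu mS)//; last exact: trivIset_seqDU.
    by apply: eq_eseriesr => i _; exact: (gS i).2.
  - apply/trivIsetP => i j _ _ ij; rewrite -subset0 => _ [[z Sz <-] [z' Sz' e]].
    have zz' : z' = z.
      by apply: gI => //; rewrite inE; [exact: FB (SF _ _ Sz')|exact: FB (SF _ _ Sz)].
    have := @trivIset_seqDU _ F; move=> /trivIsetP/(_ i j Logic.I Logic.I ij).
    by rewrite -subset0 => /(_ z); apply; split=> //; rewrite -zz'.
  - by rewrite -gUE.
rewrite gB !prE// BU CU; congr EFin.
by rewrite /prob UgU.
Qed.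

End Pieces.

End GibbsInvariance.

Theorem proposition4p3 (R : realType) (n : nat)
  (mu : probability (borel (conf (bool * 'I_n.+1)%type)) R) :
  maximal_entropy_measure (kalikow_subshift [set: conf 'I_n.+1]) mu ->
  gibbs_invariant (kalikow_subshift [set: conf 'I_n.+1]) mu.
Proof.
move=> mme; split; first by case: mme.
move=> B C g BX CX [mB mC BC mg _] gibbs.
exact: (mu_gibbs_image mme mB mC BC mg gibbs).
Qed.
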